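(* (Work in $\mathrm{ZF}+\mathrm{DC}+\mathrm{Ax}_4$.) Assume $\lambda=\mu^+$ is a true successor cardinal and $\mu=\mu^{\aleph_0}$. Then there is an $\aleph_1$-free Abelian group $G$ of cardinality $\lambda$ such that $\mathrm{Hom}(G,\mathbb Z)=\{0\}$.
   Context: The full axiom of choice is not assumed. $\mathrm{Ax}_4$ says that $[\chi]^{\aleph_0}$ can be well ordered for every cardinal $\chi$ (so $\chi^{\aleph_0}$ is a well-defined aleph). Cardinals are alephs. A cardinal $\lambda$ is a true successor cardinal if for some cardinal $\mu$, $\lambda=\mu^+$ and there is a sequence $\langle f_\alpha:\alpha\in[\mu,\lambda)\rangle$ where each $f_\alpha$ is a one-to-one function from $\alpha$ into $\mu$. An Abelian group is $\aleph_1$-free if every countable subgroup of it is free. *)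

(* Defs.v *)
(* Theorems of ZF + DC + Ax4 are rendered as statements about an arbitrary
   first-order structure (M, ∈) satisfying these axioms.  The separation and
   replacement schemas range over first-order formulas with parameters, not
   over all predicates on M: otherwise choice in the metatheory would force
   the axiom of choice to hold in M.  Sets, functions, natural numbers,
   ordinals, groups and so on are all internal objects of M. *)

Record set_structure := SetStructure {
  carrier :> Type;
  mem : carrier -> carrier -> Prop
}.

Arguments mem {s} _ _.
Notation "x ∈ y" := (mem x y) (at level 70, no associativity).

(* Variables are de Bruijn indices; quantifiers bind the index 0. *)
Inductive formula : Type :=
| FMem (i j : nat)
| FEq (i j : nat)
| FFalse
| FImp (p q : formula)
| FAnd (p q : formula)
| FOr (p q : formula)
| FAll (p : formula)
| FEx (p : formula).

Definition scons {T : Type} (x : T) (e : nat -> T) (n : nat) : T :=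
  match n with 0 => x | S k => e k end.

Fixpoint sat {M : set_structure} (e : nat -> M) (p : formula) : Prop :=
  match p with
  | FMem i j => e i ∈ e j
  | FEq i j => e i = e j
  | FFalse => False
  | FImp p q => sat e p -> sat e q
  | FAnd p q => sat e p /\ sat e q
  | FOr p q => sat e p \/ sat e q
  | FAll p => forall x : M, sat (scons x e) p
  | FEx p => exists x : M, sat (scons x e) p
  end.

Definition subset {M : set_structure} (x y : M) : Prop :=
  forall z : M, z ∈ x -> z ∈ y.

Definition is_empty {M : set_structure} (x : M) : Prop :=
  forall z : M, ~ z ∈ x.

Definition nonempty {M : set_structure} (x : M) : Prop :=
  exists z : M, z ∈ x.

Definition is_upair {M : set_structure} (p x y : M) : Prop :=
  forall z : M, z ∈ p <-> z = x \/ z = y.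

(* Kuratowski pairs: p = {{x}, {x, y}}. *)
Definition is_opair {M : set_structure} (p x y : M) : Prop :=
  exists s d : M, is_upair s x x /\ is_upair d x y /\ is_upair p s d.

Definition is_succ {M : set_structure} (y x : M) : Prop :=
  forall z : M, z ∈ y <-> z ∈ x \/ z = x.

Definition inductive_set {M : set_structure} (I : M) : Prop :=
  (forall o : M, is_empty o -> o ∈ I) /\
  (forall x y : M, x ∈ I -> is_succ y x -> y ∈ I).

Definition is_omega {M : set_structure} (w : M) : Prop :=
  inductive_set w /\ forall I : M, inductive_set I -> subset w I.

Definition extensionality (M : set_structure) : Prop :=
  forall x y : M, (forall z : M, z ∈ x <-> z ∈ y) -> x = y.

Definition foundation (M : set_structure) : Prop :=
  forall x : M, nonempty x ->
    exists y : M, y ∈ x /\ forall z : M, z ∈ y -> ~ z ∈ x.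

Definition pairing (M : set_structure) : Prop :=
  forall x y : M, exists p : M, is_upair p x y.

Definition union (M : set_structure) : Prop :=
  forall x : M, exists u : M,
    forall z : M, z ∈ u <-> exists y : M, y ∈ x /\ z ∈ y.

Definition power_set (M : set_structure) : Prop :=
  forall x : M, exists p : M, forall z : M, z ∈ p <-> subset z x.

Definition infinity (M : set_structure) : Prop :=
  exists I : M, (exists o : M, is_empty o /\ o ∈ I) /\
    (forall x : M, x ∈ I -> exists y : M, is_succ y x /\ y ∈ I).

Definition separation (M : set_structure) : Prop :=
  forall (phi : formula) (e : nat -> M) (A : M), exists B : M,
    forall x : M, x ∈ B <-> x ∈ A /\ sat (scons x e) phi.

Definition replacement (M : set_structure) : Prop :=
  forall (phi : formula) (e : nat -> M) (A : M),
    (forall x y y' : M, x ∈ A ->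
       sat (scons x (scons y e)) phi -> sat (scons x (scons y' e)) phi ->
       y = y') ->
    exists B : M, forall y : M,
      y ∈ B <-> exists x : M, x ∈ A /\ sat (scons x (scons y e)) phi.

Definition ZF (M : set_structure) : Prop :=
  extensionality M /\ foundation M /\ pairing M /\ union M /\
  power_set M /\ infinity M /\ separation M /\ replacement M.

Definition rel {M : set_structure} (r x y : M) : Prop :=
  exists p : M, is_opair p x y /\ p ∈ r.

Definition is_prod {M : set_structure} (P A B : M) : Prop :=
  forall p : M, p ∈ P <-> exists x y : M, x ∈ A /\ y ∈ B /\ is_opair p x y.

(* f is (the graph of) a function from A to B, and rel f x y says f(x) = y. *)
Definition is_fun {M : set_structure} (f A B : M) : Prop :=
  (forall p : M, p ∈ f -> exists x y : M, x ∈ A /\ y ∈ B /\ is_opair p x y) /\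
  (forall x : M, x ∈ A -> exists! y : M, rel f x y).

Definition is_inj {M : set_structure} (f A B : M) : Prop :=
  is_fun f A B /\ forall x x' y : M, rel f x y -> rel f x' y -> x = x'.

Definition is_bij {M : set_structure} (f A B : M) : Prop :=
  is_inj f A B /\ forall y : M, y ∈ B -> exists x : M, rel f x y.

Definition is_funset {M : set_structure} (P A B : M) : Prop :=
  forall f : M, f ∈ P <-> is_fun f A B.

Definition equipotent {M : set_structure} (A B : M) : Prop :=
  exists f : M, is_bij f A B.

Definition finite {M : set_structure} (A : M) : Prop :=
  exists w n : M, is_omega w /\ n ∈ w /\ equipotent A n.

(* finite or countably infinite *)
Definition countable {M : set_structure} (A : M) : Prop :=
  exists w f : M, is_omega w /\ is_inj f A w.

Definition well_orders {M : set_structure} (lt : M -> M -> Prop) (A : M) :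
    Prop :=
  (forall x : M, x ∈ A -> ~ lt x x) /\
  (forall x y z : M, x ∈ A -> y ∈ A -> z ∈ A -> lt x y -> lt y z -> lt x z) /\
  (forall x y : M, x ∈ A -> y ∈ A -> lt x y \/ x = y \/ lt y x) /\
  (forall s : M, subset s A -> nonempty s ->
     exists x : M, x ∈ s /\ forall y : M, y ∈ s -> x = y \/ lt x y).

Definition well_orderable {M : set_structure} (A : M) : Prop :=
  exists r : M, well_orders (rel r) A.

Definition ordinal {M : set_structure} (a : M) : Prop :=
  (forall x : M, x ∈ a -> subset x a) /\ well_orders mem a.

(* Cardinals are alephs, i.e. infinite initial ordinals. *)
Definition cardinal {M : set_structure} (k : M) : Prop :=
  ordinal k /\
  (exists w : M, is_omega w /\ subset w k) /\
  (forall a : M, a ∈ k -> ~ equipotent a k).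

Definition succ_cardinal {M : set_structure} (l m : M) : Prop :=
  cardinal m /\ cardinal l /\ m ∈ l /\
  (forall k : M, cardinal k -> m ∈ k -> subset l k).

(* I is the interval [m, l) of ordinals and F is the sequence of the f_a. *)
Definition true_succ_cardinal {M : set_structure} (l : M) : Prop :=
  exists m : M, succ_cardinal l m /\
  exists I F C : M,
    (forall a : M, a ∈ I <-> a ∈ l /\ subset m a) /\
    is_fun F I C /\
    (forall a f : M, rel F a f -> is_inj f a m).

Definition eq_pow_aleph0 {M : set_structure} (m : M) : Prop :=
  exists w P : M, is_omega w /\ is_funset P w m /\ equipotent m P.

Definition DC (M : set_structure) : Prop :=
  forall A R : M, nonempty A ->
    (forall x : M, x ∈ A -> exists y : M, y ∈ A /\ rel R x y) ->
    exists w f : M, is_omega w /\ is_fun f w A /\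
      (forall n n' x x' : M, n ∈ w -> is_succ n' n ->
         rel f n x -> rel f n' x' -> rel R x x').

Definition is_aleph0_subsets {M : set_structure} (S X : M) : Prop :=
  forall u : M, u ∈ S <->
    subset u X /\ exists w : M, is_omega w /\ equipotent u w.

Definition Ax4 (M : set_structure) : Prop :=
  forall k S : M, cardinal k -> is_aleph0_subsets S k -> well_orderable S.

Definition is_binop {M : set_structure} (p G : M) : Prop :=
  exists P : M, is_prod P G G /\ is_fun p P G.

Definition app2 {M : set_structure} (p x y z : M) : Prop :=
  exists q : M, is_opair q x y /\ rel p q z.

Definition is_zero {M : set_structure} (G p o : M) : Prop :=
  o ∈ G /\ forall x : M, x ∈ G -> app2 p o x x.

Definition abelian_group {M : set_structure} (G p : M) : Prop :=
  is_binop p G /\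
  (forall x y z xy yz s : M, x ∈ G -> y ∈ G -> z ∈ G ->
     app2 p x y xy -> app2 p y z yz -> app2 p xy z s -> app2 p x yz s) /\
  (forall x y s : M, x ∈ G -> y ∈ G -> app2 p x y s -> app2 p y x s) /\
  (exists o : M, is_zero G p o /\
     forall x : M, x ∈ G -> exists y : M, y ∈ G /\ app2 p x y o).

(* The operation pH of a subgroup H is the restriction of p. *)
Definition is_subgroup {M : set_structure} (H pH G p : M) : Prop :=
  subset H G /\ abelian_group H pH /\
  (forall x y z : M, x ∈ H -> y ∈ H -> app2 pH x y z -> app2 p x y z).

Definition is_hom {M : set_structure} (h G p G' p' : M) : Prop :=
  is_fun h G G' /\
  (forall x y z x' y' z' : M, x ∈ G -> y ∈ G -> app2 p x y z ->
     rel h x x' -> rel h y y' -> rel h z z' -> app2 p' x' y' z').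

Definition is_iso {M : set_structure} (h G p G' p' : M) : Prop :=
  is_hom h G p G' p' /\ is_bij h G G'.

Definition is_nat_add {M : set_structure} (w a : M) : Prop :=
  is_binop a w /\
  (forall m o : M, m ∈ w -> is_empty o -> app2 a m o m) /\
  (forall m n n' s s' : M, m ∈ w -> n ∈ w -> is_succ n' n -> is_succ s' s ->
     app2 a m n s -> app2 a m n' s').

(* c is the class of (m, n), representing m - n, for the equivalence relation
   on pairs of natural numbers given by (m, n) ~ (m', n') iff
   m + n' = m' + n. *)
Definition is_int_class {M : set_structure} (w a c m n : M) : Prop :=
  forall q : M, q ∈ c <->
    exists m' n' s : M, m' ∈ w /\ n' ∈ w /\ is_opair q m' n' /\
      app2 a m n' s /\ app2 a m' n s.

Definition is_integers {M : set_structure} (Z pZ : M) : Prop :=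
  exists w a : M, is_omega w /\ is_nat_add w a /\
  (forall c : M, c ∈ Z <->
     exists m n : M, m ∈ w /\ n ∈ w /\ is_int_class w a c m n) /\
  is_binop pZ Z /\
  (forall m n m' n' s t c c' d : M,
     m ∈ w -> n ∈ w -> m' ∈ w -> n' ∈ w ->
     app2 a m m' s -> app2 a n n' t ->
     is_int_class w a c m n -> is_int_class w a c' m' n' ->
     is_int_class w a d s t -> app2 pZ c c' d).

Definition finite_support {M : set_structure} (Z pZ B f : M) : Prop :=
  exists X : M,
    (forall b : M, b ∈ X <->
       b ∈ B /\ exists z : M, rel f b z /\ ~ is_zero Z pZ z) /\
    finite X.

Definition is_direct_sum {M : set_structure} (Z pZ B D q : M) : Prop :=
  (forall f : M, f ∈ D <-> is_fun f B Z /\ finite_support Z pZ B f) /\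
  is_binop q D /\
  (forall f g h b x y z : M, f ∈ D -> g ∈ D -> app2 q f g h -> b ∈ B ->
     rel f b x -> rel g b y -> rel h b z -> app2 pZ x y z).

(* Free: isomorphic to the direct sum of copies of Z indexed by some set. *)
Definition is_free {M : set_structure} (G p : M) : Prop :=
  exists Z pZ B D q h : M,
    is_integers Z pZ /\ is_direct_sum Z pZ B D q /\ is_iso h G p D q.

Definition aleph1_free {M : set_structure} (G p : M) : Prop :=
  forall H pH : M, is_subgroup H pH G p -> countable H -> is_free H pH.

(* Hom(G, Z) = {0}.  ZF proves that (Z, pZ) exists and is unique, so the
   existential quantifier only names it. *)
Definition trivial_dual {M : set_structure} (G p : M) : Prop :=
  exists Z pZ : M, is_integers Z pZ /\
    forall h : M, is_hom h G p Z pZ ->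
      forall x y : M, rel h x y -> is_zero Z pZ y.

(* Main.v *)
(* Let X = lambda x P(omega).  Call two functions X -> Z equivalent when, on
   each copy of P(omega), they agree on a dense open set, and let G consist of
   the classes of the functions in S, the closure of the indicators of the
   copies under subtraction and multiplication by the functions FF b c, where
   FF b c takes the value c(n) at the points that first differ from b at n.

   Hom(G, Z) = 0: if h(f) <> 0, then bisecting P(omega) repeatedly gives b such
   that h(f 1_[b|k]) <> 0 for all k.  So c |-> h(f FF b c) is a homomorphism
   from Z^omega to Z that vanishes at no indicator u_k of [k, oo).  For weights
   w_k with w_(k+1) = 2 h(u_k) w_k, it maps the sums of w_k u_k over distinct
   subsets of omega to distinct integers, against Cantor's theorem.

   G is aleph1-free: given a countable subgroup H, the points generic for H are
   those near which every element of H has a constant representative.  The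
   values there embed H in a power of Z, and Gaussian elimination produces a
   basis of H.

   G has cardinality lambda: P(omega) and Z^omega embed in mu since
   mu^aleph0 = mu, and the uniform embeddings of the ordinals below lambda in mu
   give an embedding of lambda x lambda in lambda. *)

From Stdlib Require Import List Arith Lia Classical ClassicalEpsilon Setoid Ring.
From Corelib Require Import ssreflect.
Require Import Defs.
Set SsrOldRewriteGoalsOrder.

(** The obstacle is choice. Inside [M] nothing may be selected except by a definable rule, so every
    predicate and term fed to separation, replacement or recursion carries a definability proof, and
    selections take the least candidate along an injection into the ordinal [lambda]. Passing to
    classes is what lets one family of multipliers serve both halves. The indicator of the cylinder
    of [s] below [k] is realised as [FF s (uu k)], which can be wrong at the single point [s].
    Modulo nowhere dense sets this disappears, so [h] of [f] times that indicator depends only on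
    [s] below [k], and bisection makes sense. At the limit point [b] the same family carries all of
    [Z^omega], because [FF b c x] reads [c] at an index independent of [c]; this brings the
    slenderness of [Z] to bear on [G]. On the other hand [FF b c] is locally constant away from [b],
    so every member of [S] is locally constant on a dense open set, and generic points exist by a
    Baire argument. *)

Class Model (M : set_structure) : Prop := model_zf : ZF M.

Fixpoint ren (r : nat -> nat) (p : formula) : formula :=
  match p with
  | FMem i j => FMem (r i) (r j)
  | FEq i j => FEq (r i) (r j)
  | FFalse => FFalse
  | FImp p q => FImp (ren r p) (ren r q)
  | FAnd p q => FAnd (ren r p) (ren r q)
  | FOr p q => FOr (ren r p) (ren r q)
  | FAll p => FAll (ren (fun n => match n with 0 => 0 | S k => S (r k) end) p)
  | FEx p => FEx (ren (fun n => match n with 0 => 0 | S k => S (r k) end) p)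
  end.

(** * Definability *)

Section Definability.
Context {M : set_structure}.
Implicit Types (P Q : (nat -> M) -> Prop) (s t : (nat -> M) -> M).

Lemma sat_ren (p : formula) : forall (r : nat -> nat) (e e' : nat -> M),
  (forall n, e' n = e (r n)) -> sat e (ren r p) <-> sat e' p.
Proof.
elim: p => /=.
- by move=> i j r e e' H; rewrite !H.
- by move=> i j r e e' H; rewrite !H.
- by [].
- by move=> p IHp q IHq r e e' H; rewrite (IHp _ _ _ H) (IHq _ _ _ H).
- by move=> p IHp q IHq r e e' H; rewrite (IHp _ _ _ H) (IHq _ _ _ H).
- by move=> p IHp q IHq r e e' H; rewrite (IHp _ _ _ H) (IHq _ _ _ H).
- move=> p IHp r e e' H; split=> K x; move: (K x);
    rewrite (IHp _ (scons x e) (scons x e')) // => -[|n] //=.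
- move=> p IHp r e e' H; split=> -[x K]; exists x; move: K;
    rewrite (IHp _ (scons x e) (scons x e')) // => -[|n] //=.
Qed.

(** Parameters from [M] are put at the lowest de Bruijn indices, in front of the free variables. *)
Definition capp (ps : list M) (e : nat -> M) : nat -> M := fold_right scons e ps.

Lemma capp_ge ps e n : capp ps e (length ps + n) = e n.
Proof. by elim: ps. Qed.

Lemma capp_lt ps e e' n : n < length ps -> capp ps e n = capp ps e' n.
Proof. elim: ps n => [|a ps IH] [|n] /=; try lia; auto. move=> H; apply: IH; lia. Qed.

Lemma capp_app ps qs e : capp (ps ++ qs) e = capp ps (capp qs e).
Proof. exact: fold_right_app. Qed.

(* Definability with parameters: separation and replacement in M are only
   available for these predicates and terms. *)
Definition Dp P : Prop :=
  exists (phi : formula) (ps : list M), forall e, P e <-> sat (capp ps e) phi.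

(** A term is definable through its graph: index 0 holds the value, and the arguments are shifted up
    by one. *)
Definition Dt t : Prop := Dp (fun e => e 0 = t (fun n => e (S n))).

Lemma Dp_ext P Q : (forall e, P e <-> Q e) -> Dp P -> Dp Q.
Proof. move=> H [phi [ps K]]; exists phi, ps => e; by rewrite -H. Qed.

Lemma Dp_ren (r : nat -> nat) P : Dp P -> Dp (fun e => P (fun n => e (r n))).
Proof.
move=> [phi [ps K]].
exists (ren (fun n => if n <? length ps then n else length ps + r (n - length ps)) phi), ps => e.
rewrite K; symmetry; apply: sat_ren => n.
case: (Nat.ltb_spec n (length ps)) => H.
- exact: capp_lt.
- rewrite capp_ge -{1}(Nat.sub_add _ _ H) Nat.add_comm capp_ge //.
Qed.

(** The connectives need both formulas over one parameter list. In the concatenated list [psi] is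
    shifted past the parameters of [P], and the free variables of [phi] past those of [Q]. *)
Lemma Dp_merge P Q : Dp P -> Dp Q -> exists phi psi ps, forall e,
  (P e <-> sat (capp ps e) phi) /\ (Q e <-> sat (capp ps e) psi).
Proof.
move=> [phi [ps K]] [psi [qs L]].
exists (ren (fun n => if n <? length ps then n else length qs + n) phi).
exists (ren (fun n => length ps + n) psi), (ps ++ qs) => e.
rewrite K L capp_app; split; symmetry; apply: sat_ren => n.
- case: (Nat.ltb_spec n (length ps)) => H; first exact: capp_lt.
  have -> : n = length ps + (n - length ps) by lia.
  have -> : length qs + (length ps + (n - length ps)) = length ps + (length qs + (n - length ps)) by lia.
  by rewrite !capp_ge.
- by rewrite capp_ge.
Qed.

Lemma Dp_imp P Q : Dp P -> Dp Q -> Dp (fun e => P e -> Q e).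
Proof.
move=> HP HQ; have [phi [psi [ps K]]] := Dp_merge _ _ HP HQ.
by exists (FImp phi psi), ps => e /=; case: (K e) => -> ->.
Qed.

Lemma Dp_and P Q : Dp P -> Dp Q -> Dp (fun e => P e /\ Q e).
Proof.
move=> HP HQ; have [phi [psi [ps K]]] := Dp_merge _ _ HP HQ.
by exists (FAnd phi psi), ps => e /=; case: (K e) => -> ->.
Qed.

Lemma Dp_or P Q : Dp P -> Dp Q -> Dp (fun e => P e \/ Q e).
Proof.
move=> HP HQ; have [phi [psi [ps K]]] := Dp_merge _ _ HP HQ.
by exists (FOr phi psi), ps => e /=; case: (K e) => -> ->.
Qed.

Lemma Dp_iff P Q : Dp P -> Dp Q -> Dp (fun e => P e <-> Q e).
Proof. by move=> HP HQ; apply: Dp_and; apply: Dp_imp. Qed.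

(** An arbitrary proposition of the metatheory is admissible as long as it does not mention the
    variables: by excluded middle it amounts to truth or falsity. *)
Lemma Dp_const (A : Prop) : Dp (fun _ => A).
Proof.
case: (classic A) => H.
- by exists (FImp FFalse FFalse), nil => e /=; tauto.
- by exists FFalse, nil => e /=; tauto.
Qed.

Lemma Dp_not P : Dp P -> Dp (fun e => ~ P e).
Proof. by move=> HP; apply: Dp_imp => //; apply: Dp_const. Qed.

(** A quantifier binds index 0, but the parameters occupy the lowest indices; the bound variable has
    to be moved in front of them. *)
Lemma bind_params (phi : formula) (ps : list M) :
  exists psi, forall x e, sat (capp ps (scons x e)) phi <-> sat (scons x (capp ps e)) psi.
Proof.
exists (ren (fun n => if n <? length ps then S n else if n =? length ps then 0 else n) phi) => x e.
symmetry; apply: sat_ren => n.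
case: (Nat.ltb_spec n (length ps)) => H /=; first exact: capp_lt.
case: (Nat.eqb_spec n (length ps)) => [->|H'].
- by have := capp_ge ps (scons x e) 0; rewrite Nat.add_0_r.
- have -> : n = length ps + S (n - length ps - 1) by lia.
  rewrite capp_ge; have -> : length ps + S (n - length ps - 1) = S (length ps + (n - length ps - 1)) by lia.
  by rewrite /= capp_ge.
Qed.

Lemma bind_params2 (phi : formula) (ps : list M) :
  exists psi, forall x y e, sat (capp ps (scons x (scons y e))) phi <->
                            sat (scons x (scons y (capp ps e))) psi.
Proof.
exists (ren (fun n => if n <? length ps then S (S n) else
             if n <? S (S (length ps)) then n - length ps else n) phi) => x y e.
symmetry; apply: sat_ren => n.
case: (Nat.ltb_spec n (length ps)) => H /=; first exact: capp_lt.
have -> : n = length ps + (n - length ps) by lia.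
rewrite capp_ge; case: (Nat.ltb_spec _ _) => H'.
- have -> : length ps + (n - length ps) - length ps = n - length ps by lia.
  by case: (n - length ps) H' => [|[|k]] //; lia.
- have -> : n - length ps = S (S (n - length ps - 2)) by lia.
  have -> : length ps + S (S (n - length ps - 2)) = S (S (length ps + (n - length ps - 2))) by lia.
  by rewrite /= capp_ge.
Qed.

Lemma Dp_all (Q : (nat -> M) -> M -> Prop) :
  Dp (fun e => Q (fun n => e (S n)) (e 0)) -> Dp (fun e => forall x, Q e x).
Proof.
move=> [phi [ps K]]; have [psi L] := bind_params phi ps.
exists (FAll psi), ps => e /=; split=> H x; move: (H x); by rewrite -L -(K (scons x e)).
Qed.

Lemma Dp_ex (Q : (nat -> M) -> M -> Prop) :
  Dp (fun e => Q (fun n => e (S n)) (e 0)) -> Dp (fun e => exists x, Q e x).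
Proof.
move=> [phi [ps K]]; have [psi L] := bind_params phi ps.
exists (FEx psi), ps => e /=; split=> -[x H]; exists x; move: H; by rewrite -L -(K (scons x e)).
Qed.

Lemma Dt_var k : Dt (fun e => e k).
Proof. by exists (FEq 0 (S k)), nil. Qed.

Lemma Dt_const (c : M) : Dt (fun _ => c).
Proof. by exists (FEq 1 0), (c :: nil). Qed.

Lemma Dt_ren (r : nat -> nat) t : Dt t -> Dt (fun e => t (fun n => e (r n))).
Proof.
move=> H.
exact: (Dp_ren (fun n => match n with 0 => 0 | S k => S (r k) end) _ H).
Qed.

(** The language has no function symbols, so a definable term is substituted through its graph, as
    [exists x, x = t e /\ R e x]. *)
Lemma Dp_comp (R : (nat -> M) -> M -> Prop) t :
  Dp (fun e => R (fun n => e (S n)) (e 0)) -> Dt t -> Dp (fun e => R e (t e)).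
Proof.
move=> HR Ht.
apply: (Dp_ext (fun e => exists x, x = t e /\ R e x)).
- by move=> e; split=> [[x [-> H]]|H] //; exists (t e).
- by apply: Dp_ex; apply: Dp_and.
Qed.

Lemma Dp_mem s t : Dt s -> Dt t -> Dp (fun e => s e ∈ t e).
Proof.
move=> Hs Ht; apply: (Dp_comp (fun e x => x ∈ t e)) => //.
apply: (Dp_comp (fun e y => e 0 ∈ y) (fun e => t (fun n => e (S n)))).
- by exists (FMem 1 0), nil.
- exact: (Dt_ren S).
Qed.

Lemma Dp_eq s t : Dt s -> Dt t -> Dp (fun e => s e = t e).
Proof.
move=> Hs Ht; apply: (Dp_comp (fun e x => x = t e)) => //.
Qed.

Lemma Dt_comp (F : (nat -> M) -> M -> M) t :
  Dt (fun e => F (fun n => e (S n)) (e 0)) -> Dt t -> Dt (fun e => F e (t e)).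
Proof.
move=> HF Ht.
apply: (Dp_comp (fun e y => e 0 = F (fun n => e (S n)) y) (fun e => t (fun n => e (S n)))).
- apply: (Dp_ren (fun n => match n with 0 => 1 | 1 => 0 | k => k end) _ HF).
- exact: (Dt_ren S).
Qed.

Lemma Dt_app1 (F : M -> M) t : Dt (fun e => F (e 0)) -> Dt t -> Dt (fun e => F (t e)).
Proof. by move=> HF; apply: (Dt_comp (fun _ => F)). Qed.

Lemma Dt_app2 (F : M -> M -> M) s t :
  Dt (fun e => F (e 0) (e 1)) -> Dt s -> Dt t -> Dt (fun e => F (s e) (t e)).
Proof.
move=> HF Hs Ht; apply: (Dt_comp (fun e x => F x (t e))) => //.
apply: (Dt_comp (fun e y => F (e 0) y) (fun e => t (fun n => e (S n)))).
- exact: (Dt_ren (fun n => match n with 0 => 1 | 1 => 0 | k => k end) _ HF).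
- exact: (Dt_ren S).
Qed.

Lemma Dp_app1 (R : M -> Prop) t : Dp (fun e => R (e 0)) -> Dt t -> Dp (fun e => R (t e)).
Proof. by move=> HR; apply: (Dp_comp (fun _ => R)). Qed.

Lemma Dp_app2 (R : M -> M -> Prop) s t :
  Dp (fun e => R (e 0) (e 1)) -> Dt s -> Dt t -> Dp (fun e => R (s e) (t e)).
Proof.
move=> HR Hs Ht; apply: (Dp_comp (fun e x => R x (t e))) => //.
apply: (Dp_comp (fun e y => R (e 0) y) (fun e => t (fun n => e (S n)))).
- exact: (Dp_ren (fun n => match n with 0 => 1 | 1 => 0 | k => k end) _ HR).
- exact: (Dt_ren S).
Qed.

Lemma Dt_app3 (F : M -> M -> M -> M) s t u :
  Dt (fun e => F (e 0) (e 1) (e 2)) -> Dt s -> Dt t -> Dt u ->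
  Dt (fun e => F (s e) (t e) (u e)).
Proof.
move=> HF Hs Ht Hu; apply: (Dt_comp (fun e x => F x (t e) (u e))) => //.
apply: (Dt_comp (fun e y => F (e 0) y (u (fun n => e (S n)))) (fun e => t (fun n => e (S n))));
  last exact: (Dt_ren S).
apply: (Dt_comp (fun e z => F (e 1) (e 0) z) (fun e => u (fun n => e (S (S n)))));
  last exact: (Dt_ren (fun n => S (S n))).
exact: (Dt_ren (fun n => match n with 0 => 2 | 1 => 1 | 2 => 0 | k => k end) _ HF).
Qed.

Lemma Dp_app3 (R : M -> M -> M -> Prop) s t u :
  Dp (fun e => R (e 0) (e 1) (e 2)) -> Dt s -> Dt t -> Dt u ->
  Dp (fun e => R (s e) (t e) (u e)).
Proof.
move=> HF Hs Ht Hu; apply: (Dp_comp (fun e x => R x (t e) (u e))) => //.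
apply: (Dp_comp (fun e y => R (e 0) y (u (fun n => e (S n)))) (fun e => t (fun n => e (S n))));
  last exact: (Dt_ren S).
apply: (Dp_comp (fun e z => R (e 1) (e 0) z) (fun e => u (fun n => e (S (S n)))));
  last exact: (Dt_ren (fun n => S (S n))).
exact: (Dp_ren (fun n => match n with 0 => 2 | 1 => 1 | 2 => 0 | k => k end) _ HF).
Qed.

Lemma Dp_subset s t : Dt s -> Dt t -> Dp (fun e => subset (s e) (t e)).
Proof.
move=> Hs Ht; apply: Dp_all; apply: Dp_imp; apply: Dp_mem; try exact: Dt_var; exact: (Dt_ren S).
Qed.

Lemma decide (A : Prop) : {A} + {~ A}.
Proof. exact: excluded_middle_informative. Qed.

Definition ite (A : Prop) (x y : M) : M := match decide A with left _ => x | right _ => y end.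

Lemma ite_true (A : Prop) x y : A -> ite A x y = x.
Proof. by rewrite /ite; case: (decide A). Qed.

Lemma ite_false (A : Prop) x y : ~ A -> ite A x y = y.
Proof. by rewrite /ite; case: (decide A). Qed.

Lemma Dt_ite P s t : Dp P -> Dt s -> Dt t -> Dt (fun e => ite (P e) (s e) (t e)).
Proof.
move=> HP Hs Ht.
apply: (Dp_ext (fun e => (P (fun n => e (S n)) /\ e 0 = s (fun n => e (S n))) \/
                         (~ P (fun n => e (S n)) /\ e 0 = t (fun n => e (S n))))).
- move=> e; rewrite /ite; case: (decide _) => H; tauto.
- have HP' := Dp_ren S _ HP.
  by apply: Dp_or; apply: Dp_and => //; apply: Dp_not.
Qed.

End Definability.

(* [dd] proves definability goals; [dbase], [dbase2], ... are extension points,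
   redefined whenever new operations become available. *)
Ltac dbase := fail.
Ltac dstep :=
  cbv beta;
  first
    [ assumption
    | match goal with
      | H : Dp (fun e => ?P (e 0)) |- Dp (fun e => ?P _) => apply: (Dp_app1 P _ H)
      | H : Dt (fun e => ?F (e 0)) |- Dt (fun e => ?F _) => apply: (Dt_app1 F _ H)
      | H : Dt ?t |- Dt (fun e => ?t (fun n => e _)) => apply: (Dt_ren _ _ H)
      | H : Dp (fun e => ?P (e 0) (e 1) (e 2)) |- Dp (fun e => ?P _ _ _) => apply: (Dp_app3 P _ _ _ H)
      | H : Dt (fun e => ?F (e 0) (e 1) (e 2)) |- Dt (fun e => ?F _ _ _) => apply: (Dt_app3 F _ _ _ H)
      | H : Dp (fun e => ?P (e 0) (e 1)) |- Dp (fun e => ?P _ _) => apply: (Dp_app2 P _ _ H)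
      | H : Dt (fun e => ?F (e 0) (e 1)) |- Dt (fun e => ?F _ _) => apply: (Dt_app2 F _ _ H)
      end
    | lazymatch goal with
      | |- Dp (fun e => forall x, _) => first [ apply: Dp_const | apply: Dp_imp | apply: Dp_all ]
      | |- Dp (fun e => exists x, _) => first [ apply: Dp_const | apply: Dp_ex ]
      | |- Dp (fun e => _ /\ _) => apply: Dp_and
      | |- Dp (fun e => _ \/ _) => apply: Dp_or
      | |- Dp (fun e => ~ _) => apply: Dp_not
      | |- Dp (fun e => _ <-> _) => apply: Dp_iff
      | |- Dp (fun e => _ = _) => apply: Dp_eq
      | |- Dp (fun e => _ ∈ _) => apply: Dp_mem
      | |- Dp (fun e => subset _ _) => apply: Dp_subset
      | |- Dt (fun e => ite _ _ _) => apply: Dt_ite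
      | |- Dt (fun e => e _) => apply: Dt_var
      end
    | apply: Dt_const
    | apply: Dp_const
    | dbase ].
Ltac dd := repeat dstep.

(** * Descriptions, and separation and replacement for definable predicates *)

Section Basic.
Context {M : set_structure} {HM : Model M}.
Implicit Types (A B x y z : M).

Lemma ext x y : (forall z, z ∈ x <-> z ∈ y) -> x = y.
Proof. case: (model_zf) => H _; exact: H. Qed.

Lemma exists_empty : exists o : M, is_empty o.
Proof. by case: model_zf => _ [_ [_ [_ [_ [[I [[o [H _]] _]] _]]]]]; exists o. Qed.

Lemma emp_sig : {o : M | is_empty o}.
Proof. exact: (constructive_indefinite_description _ exists_empty). Qed.

Definition emp : M := proj1_sig emp_sig.

Lemma in_emp x : ~ x ∈ emp.
Proof. exact: (proj2_sig emp_sig). Qed.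

(* Opaque, so that conversion never looks inside a description. *)
Lemma the_sig : {the : (M -> Prop) -> M |
  (forall P x, P x -> (forall y, P y -> y = x) -> the P = x) /\
  (forall P, ~ (exists! x, P x) -> the P = emp)}.
Proof.
exists (fun P => match decide (exists! x, P x) with
  | left _ => epsilon (inhabits emp) P | right _ => emp end); split=> P.
- move=> x H K; case: (decide _) => L; first by apply: K; apply: epsilon_spec; exists x.
  by case: L; exists x; split=> // y /K ->.
- by case: (decide _).
Qed.

Definition the : (M -> Prop) -> M := proj1_sig the_sig.

Lemma the_eq (P : M -> Prop) x : P x -> (forall y, P y -> y = x) -> the P = x.
Proof. exact: (proj1 (proj2_sig the_sig)). Qed.

Lemma the_default (P : M -> Prop) : ~ (exists! x, P x) -> the P = emp.
Proof. exact: (proj2 (proj2_sig the_sig)). Qed.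

Lemma the_spec (P : M -> Prop) : (exists! x, P x) -> P (the P).
Proof. move=> [x [H K]]; rewrite (the_eq _ x) // => y /K //. Qed.

(** The second disjunct of the graph is forced by totality: without a unique witness the value is
    [emp]. *)
Lemma Dt_the (P : (nat -> M) -> M -> Prop) :
  Dp (fun e => P (fun n => e (S n)) (e 0)) -> Dt (fun e => the (P e)).
Proof.
move=> HP.
apply: (Dp_ext (fun e =>
  (P (fun n => e (S n)) (e 0) /\ forall z, P (fun n => e (S n)) z -> z = e 0) \/
  (~ (exists x, P (fun n => e (S n)) x /\ forall z, P (fun n => e (S n)) z -> z = x) /\ e 0 = emp))).
- move=> e; split.
  + move=> [[H K]|[H K]]; first by rewrite (the_eq _ (e 0)).
    rewrite the_default // => -[x [L1 L2]]; case: H; exists x; split=> // z /L2 //.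
  + case: (classic (exists! x, P (fun n => e (S n)) x)) => [[x [H1 H2]]|H].
    * move=> ->; left; rewrite (the_eq _ x) //; last by move=> y /H2.
      by split=> // y /H2.
    * rewrite the_default // => ->; right; split=> // -[x [L1 L2]]; case: H; exists x; split=> // z /L2 //.
- have H1 : Dp (fun e => P (fun n => e (S (S n))) (e 0)).
    exact: (Dp_ren (fun n => match n with 0 => 0 | S k => S (S k) end) _ HP).
  have H2 : Dp (fun e => P (fun n => e (S (S (S n)))) (e 0)).
    exact: (Dp_ren (fun n => match n with 0 => 0 | S k => S (S (S k)) end) _ HP).
  dd; first [apply: Dt_var | idtac].
Qed.

(** Written as a description, it makes sense for every metatheoretic [P]; the expected members are
    guaranteed only for definable [P], by [in_sep]. The same holds for [img] and [lam]. *)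
Definition sep A (P : M -> Prop) : M := the (fun B => forall x, x ∈ B <-> x ∈ A /\ P x).

Lemma in_sep A (P : M -> Prop) x :
  Dp (fun e => P (e 0)) -> x ∈ sep A P <-> x ∈ A /\ P x.
Proof.
move=> [phi [ps K]]; have [psi L] := bind_params phi ps.
case: model_zf => _ [_ [_ [_ [_ [_ [H _]]]]]].
case: (H psi (capp ps (fun _ => A)) A) => B HB.
have HB' y : y ∈ B <-> y ∈ A /\ P y by rewrite HB -L -(K (scons y _)).
rewrite /sep (the_eq _ B) // => C HC; apply: ext => z; by rewrite HC HB'.
Qed.

Lemma Dt_sep (A : (nat -> M) -> M) (P : (nat -> M) -> M -> Prop) :
  Dt A -> Dp (fun e => P (fun n => e (S n)) (e 0)) -> Dt (fun e => sep (A e) (P e)).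
Proof.
move=> HA HP; rewrite /sep; apply: Dt_the.
have H1 : Dp (fun e => P (fun n => e (S (S n))) (e 0)).
  exact: (Dp_ren (fun n => match n with 0 => 0 | S k => S (S k) end) _ HP).
have H2 := Dt_ren (fun n => S (S n)) _ HA; dd.
Qed.

Definition img A (F : M -> M) : M := the (fun B => forall y, y ∈ B <-> exists x, x ∈ A /\ y = F x).

Lemma in_img A (F : M -> M) y :
  Dt (fun e => F (e 0)) -> y ∈ img A F <-> exists x, x ∈ A /\ y = F x.
Proof.
move=> HF.
have [phi [ps K]] : Dp (fun e => e 1 = F (e 0)).
  exact: (Dp_ren (fun n => match n with 0 => 1 | 1 => 0 | k => k end) _ HF).
have [psi L] := bind_params2 phi ps.
case: model_zf => _ [_ [_ [_ [_ [_ [_ H]]]]]].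
have R x z : sat (scons x (scons z (capp ps (fun _ => A)))) psi <-> z = F x.
  by rewrite -L -(K (scons x (scons z _))).
case: (H psi (capp ps (fun _ => A)) A) => [x z z' _|B HB]; first by rewrite !R => -> ->.
have HB' z : z ∈ B <-> exists x, x ∈ A /\ z = F x.
  by rewrite HB; split=> -[x K']; exists x; move: K'; rewrite R.
rewrite /img (the_eq _ B) // => C HC; apply: ext => z; by rewrite HC HB'.
Qed.

Lemma Dt_img (A : (nat -> M) -> M) (F : (nat -> M) -> M -> M) :
  Dt A -> Dt (fun e => F (fun n => e (S n)) (e 0)) -> Dt (fun e => img (A e) (F e)).
Proof.
move=> HA HF; rewrite /img; apply: Dt_the.
have H1 : Dt (fun e => F (fun n => e (S (S (S n)))) (e 0)).
  exact: (Dt_ren (fun n => match n with 0 => 0 | S k => S (S (S k)) end) _ HF).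
have H2 := Dt_ren (fun n => S (S (S n))) _ HA; have H3 := Dt_ren (fun n => S (S n)) _ HA; dd.
Qed.

End Basic.

#[export] Hint Extern 0 (Dt _) => solve [dd] : core.
#[export] Hint Extern 0 (Dp _) => solve [dd] : core.

(** * Set theory in a model of ZF *)

Section Pairs.
Context {M : set_structure} {HM : Model M}.
Implicit Types (A B x y z f g : M) (s t : (nat -> M) -> M).

Definition upair x y : M := the (fun p => is_upair p x y).

Lemma in_upair x y z : z ∈ upair x y <-> z = x \/ z = y.
Proof.
case: (model_zf) => _ [_ [H _]]; case: (H x y) => p Hp.
rewrite /upair (the_eq _ p) // => q Hq; apply: ext => w; by rewrite (Hp w) (Hq w).
Qed.

Lemma is_upair_eq p x y : is_upair p x y <-> p = upair x y.
Proof.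
split=> [H|-> z]; last exact: in_upair.
by apply: ext => z; rewrite (H z) in_upair.
Qed.

Lemma Dt_upair s t : Dt s -> Dt t -> Dt (fun e => upair (s e) (t e)).
Proof. apply: Dt_app2; rewrite /upair /is_upair; apply: Dt_the; dd. Qed.

Definition opair x y : M := upair (upair x x) (upair x y).

Lemma is_opair_eq p x y : is_opair p x y <-> p = opair x y.
Proof.
split=> [[s [d [/is_upair_eq -> [/is_upair_eq -> /is_upair_eq ->]]]]|->] //.
exists (upair x x), (upair x y); by rewrite !is_upair_eq.
Qed.

Lemma opair_inj x y x' y' : opair x y = opair x' y' -> x = x' /\ y = y'.
Proof.
move=> E.
have H z : z ∈ opair x y <-> z ∈ opair x' y' by rewrite E.
have U1 u v w w' : upair u v = upair w w' -> (u = w \/ u = w') /\ (v = w \/ v = w').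
  move=> K; have := in_upair u v u; have := in_upair u v v; rewrite K !in_upair; tauto.
have X : x = x'.
{ have K : upair x x ∈ opair x' y' by apply/H; rewrite in_upair; left.
  move: K; rewrite in_upair => -[] K.
  - by case: (U1 _ _ _ _ K) => -[].
  - have := in_upair x x x'; rewrite K in_upair; intuition congruence. }
subst x'; split=> //.
have K1 : upair x y ∈ opair x y' by apply/H; rewrite in_upair; right.
have K2 : upair x y' ∈ opair x y by apply/H; rewrite in_upair; right.
move: K1 K2; rewrite !in_upair => -[] K1 -[] K2; case: (U1 _ _ _ _ K1); case: (U1 _ _ _ _ K2);
  intuition congruence.
Qed.

Lemma Dt_opair s t : Dt s -> Dt t -> Dt (fun e => opair (s e) (t e)).
Proof. by move=> *; apply: Dt_upair; apply: Dt_upair. Qed.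

Definition pr1 p : M := the (fun x => exists y, p = opair x y).
Definition pr2 p : M := the (fun y => exists x, p = opair x y).

Lemma pr1_opair x y : pr1 (opair x y) = x.
Proof. apply: the_eq; first by exists y. by move=> z [w /opair_inj []]. Qed.

Lemma pr2_opair x y : pr2 (opair x y) = y.
Proof. apply: the_eq; first by exists x. by move=> z [w /opair_inj []]. Qed.

Definition Un x : M := the (fun u => forall z, z ∈ u <-> exists y, y ∈ x /\ z ∈ y).

Lemma in_Un x z : z ∈ Un x <-> exists y, y ∈ x /\ z ∈ y.
Proof.
case: (model_zf) => _ [_ [_ [H _]]]; case: (H x) => u Hu.
rewrite /Un (the_eq _ u) // => v Hv; apply: ext => w; by rewrite Hu Hv.
Qed.

Definition pow x : M := the (fun p => forall z, z ∈ p <-> subset z x).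

Lemma in_pow x z : z ∈ pow x <-> subset z x.
Proof.
case: (model_zf) => _ [_ [_ [_ [H _]]]]; case: (H x) => u Hu.
rewrite /pow (the_eq _ u) // => v Hv; apply: ext => w; by rewrite Hu Hv.
Qed.

Lemma Dt_Un s : Dt s -> Dt (fun e => Un (s e)).
Proof. apply: Dt_app1; apply: Dt_the; dd. Qed.

Lemma Dt_pow s : Dt s -> Dt (fun e => pow (s e)).
Proof. apply: Dt_app1; apply: Dt_the; dd. Qed.

Definition sc x : M := Un (upair x (upair x x)).

Lemma in_sc x z : z ∈ sc x <-> z ∈ x \/ z = x.
Proof.
rewrite /sc in_Un; split.
- by move=> [y []]; rewrite in_upair => -[->|->]; [left|rewrite in_upair; tauto].
- move=> [H|->]; first by exists x; rewrite in_upair; tauto.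
  exists (upair x x); rewrite !in_upair; tauto.
Qed.

Lemma is_succ_eq y x : is_succ y x <-> y = sc x.
Proof. split=> [H|-> z]; [by apply: ext => z; rewrite in_sc (H z)|exact: in_sc]. Qed.

Lemma is_empty_eq x : is_empty x <-> x = emp.
Proof.
split=> [H|->]; last exact: in_emp.
by apply: ext => z; split=> [/H|/in_emp].
Qed.

Lemma Dt_sc s : Dt s -> Dt (fun e => sc (s e)).
Proof. by move=> H; apply: Dt_Un; apply: Dt_upair => //; apply: Dt_upair. Qed.

Lemma Dt_pr1 s : Dt s -> Dt (fun e => pr1 (s e)).
Proof. apply: Dt_app1; apply: Dt_the; apply: Dp_ex; apply: Dp_eq; dd; apply: Dt_opair; dd. Qed.

Lemma Dt_pr2 s : Dt s -> Dt (fun e => pr2 (s e)).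
Proof. apply: Dt_app1; apply: Dt_the; apply: Dp_ex; apply: Dp_eq; dd; apply: Dt_opair; dd. Qed.

Definition prod A B : M := Un (img A (fun x => img B (fun y => opair x y))).

End Pairs.

Ltac dbase ::=
  lazymatch goal with
  | |- Dt (fun e => the _) => apply: Dt_the
  | |- Dt (fun e => sep _ _) => apply: Dt_sep
  | |- Dt (fun e => img _ _) => apply: Dt_img
  | |- Dt (fun e => upair _ _) => apply: Dt_upair
  | |- Dt (fun e => opair _ _) => apply: Dt_opair
  | |- Dt (fun e => pr1 _) => apply: Dt_pr1
  | |- Dt (fun e => pr2 _) => apply: Dt_pr2
  | |- Dt (fun e => Un _) => apply: Dt_Un
  | |- Dt (fun e => pow _) => apply: Dt_pow
  | |- Dt (fun e => sc _) => apply: Dt_sc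
  end.

Section Functions.
Context {M : set_structure} {HM : Model M}.
Implicit Types (A B C x y z f g : M) (s t : (nat -> M) -> M).

Lemma in_prod A B p : p ∈ prod A B <-> exists x y, x ∈ A /\ y ∈ B /\ p = opair x y.
Proof.
rewrite /prod in_Un; split.
- move=> [q []]; rewrite in_img; last by dd.
  by move=> [x [Hx ->]]; rewrite in_img; dd; move=> [y [Hy ->]]; exists x, y.
- move=> [x [y [Hx [Hy ->]]]]; exists (img B (fun y => opair x y)).
  rewrite !in_img; dd; split; [by exists x|by exists y].
Qed.

Lemma in_prod_opair A B x y : opair x y ∈ prod A B <-> x ∈ A /\ y ∈ B.
Proof.
rewrite in_prod; split; last by move=> [H K]; exists x, y.
by move=> [x' [y' [Hx [Hy /opair_inj [-> ->]]]]].
Qed.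

Lemma Dt_prod s t : Dt s -> Dt t -> Dt (fun e => prod (s e) (t e)).
Proof. apply: Dt_app2; rewrite /prod; dd. Qed.

Lemma is_prod_eq P A B : is_prod P A B <-> P = prod A B.
Proof.
split=> [H|-> p].
- apply: ext => p; rewrite (H p) in_prod.
  by split=> -[x [y [? [? /is_opair_eq ?]]]]; exists x, y.
- by rewrite in_prod; split=> -[x [y [? [? /is_opair_eq ?]]]]; exists x, y.
Qed.

Lemma rel_iff f x y : rel f x y <-> opair x y ∈ f.
Proof.
split=> [[p [/is_opair_eq -> //]]|H]; exists (opair x y); by rewrite is_opair_eq.
Qed.

Lemma Dp_rel s t (u : (nat -> M) -> M) : Dt s -> Dt t -> Dt u -> Dp (fun e => rel (s e) (t e) (u e)).
Proof.
move=> Hs Ht Hu; apply: (Dp_ext (fun e => opair (t e) (u e) ∈ s e)).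
- by move=> e; rewrite rel_iff.
- dd.
Qed.

Definition app f x : M := the (fun y => opair x y ∈ f).

Lemma Dt_app s t : Dt s -> Dt t -> Dt (fun e => app (s e) (t e)).
Proof. apply: Dt_app2; rewrite /app; dd. Qed.

Definition lam A (F : M -> M) : M := img A (fun x => opair x (F x)).

Lemma Dt_lam (A : (nat -> M) -> M) (F : (nat -> M) -> M -> M) :
  Dt A -> Dt (fun e => F (fun n => e (S n)) (e 0)) -> Dt (fun e => lam (A e) (F e)).
Proof. move=> HA HF; rewrite /lam; apply: Dt_img => //; apply: Dt_opair => //; dd. Qed.

Lemma rel_lam A F x y : Dt (fun e => F (e 0)) -> rel (lam A F) x y <-> x ∈ A /\ y = F x.
Proof.
move=> HF; rewrite rel_iff /lam in_img; last by apply: Dt_opair => //; dd.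
split=> [[x' [Hx /opair_inj [-> ->]]] //|[Hx ->]]; by exists x.
Qed.

Lemma app_lam A F x : Dt (fun e => F (e 0)) -> x ∈ A -> app (lam A F) x = F x.
Proof.
move=> HF Hx; apply: the_eq => [|y].
- by apply/rel_iff; rewrite rel_lam.
- by move/rel_iff; rewrite rel_lam // => -[].
Qed.

Lemma is_fun_lam A B F : Dt (fun e => F (e 0)) -> (forall x, x ∈ A -> F x ∈ B) -> is_fun (lam A F) A B.
Proof.
move=> HF H; split=> [p|x Hx].
- rewrite in_img; last by apply: Dt_opair => //; dd.
  move=> [x [Hx ->]]; exists x, (F x); rewrite is_opair_eq; auto.
- exists (F x); split; first by apply/(rel_lam _ _ _ _ HF).
  by move=> y /(rel_lam _ _ _ _ HF) [_ ->].
Qed.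

Lemma rel_app f A B x y : is_fun f A B -> rel f x y <-> x ∈ A /\ y = app f x.
Proof.
move=> [H1 H2].
have D : rel f x y -> x ∈ A.
  move=> /rel_iff /H1 [x' [y' [Hx [_ /is_opair_eq /opair_inj [-> _]]]]] //.
split=> [H|[Hx ->]].
- split; first exact: D.
  case: (H2 _ (D H)) => z [Hz U]; symmetry; apply: the_eq; first by apply/rel_iff.
  by move=> w /rel_iff /U <-; rewrite (U _ H).
- case: (H2 _ Hx) => z [Hz U]; have -> // : app f x = z.
  by apply: the_eq; [apply/rel_iff|move=> w /rel_iff /U].
Qed.

Lemma app_in f A B x : is_fun f A B -> x ∈ A -> app f x ∈ B.
Proof.
move=> H Hx; have : rel f x (app f x) by apply/(rel_app _ _ _ _ _ H).
by move=> /rel_iff /(proj1 H) [x' [y' [_ [Hy /is_opair_eq /opair_inj [_ ->]]]]].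
Qed.

Lemma fun_ext f g A B C : is_fun f A B -> is_fun g A C ->
  (forall x, x ∈ A -> app f x = app g x) -> f = g.
Proof.
move=> Hf Hg H; apply: ext => p; split.
- move=> K; case: (proj1 Hf _ K) => x [y [Hx [_ /is_opair_eq E]]]; subst p.
  by apply/rel_iff/(rel_app _ _ _ _ _ Hg); split=> //; rewrite -H //; apply (rel_app _ _ _ _ _ Hf); apply/rel_iff.
- move=> K; case: (proj1 Hg _ K) => x [y [Hx [_ /is_opair_eq E]]]; subst p.
  by apply/rel_iff/(rel_app _ _ _ _ _ Hf); split=> //; rewrite H //; apply (rel_app _ _ _ _ _ Hg); apply/rel_iff.
Qed.

Definition funs A B : M := sep (pow (prod A B)) (fun f => is_fun f A B).

Lemma Dp_is_fun s t (u : (nat -> M) -> M) : Dt s -> Dt t -> Dt u -> Dp (fun e => is_fun (s e) (t e) (u e)).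
Proof.
apply: Dp_app3.
apply: (Dp_ext (fun e => (forall p, p ∈ e 0 -> exists x y, x ∈ e 1 /\ y ∈ e 2 /\ p = opair x y) /\
  (forall x, x ∈ e 1 -> exists y, opair x y ∈ e 0 /\ forall z, opair x z ∈ e 0 -> y = z))).
- move=> e; rewrite /is_fun; split=> -[H1 H2]; split=> z Hz.
  + case: (H1 _ Hz) => x [y [? [? /is_opair_eq ?]]]; by exists x, y.
  + case: (H2 _ Hz) => y [/rel_iff ? K]; exists y; split=> // w /rel_iff; exact: K.
  + case: (H1 _ Hz) => x [y [? [? /is_opair_eq ?]]]; by exists x, y.
  + case: (H2 _ Hz) => y [/rel_iff ? K]; exists y; split=> // w /rel_iff; exact: K.
- dd.
Qed.

Lemma in_funs A B f : f ∈ funs A B <-> is_fun f A B.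
Proof.
rewrite /funs in_sep; last by apply: Dp_is_fun; dd.
split=> [[_ //]|H]; split=> //; apply/in_pow => p /(proj1 H) [x [y [Hx [Hy /is_opair_eq ->]]]].
by apply/in_prod_opair.
Qed.

Lemma Dt_funs s t : Dt s -> Dt t -> Dt (fun e => funs (s e) (t e)).
Proof.
apply: Dt_app2; rewrite /funs; apply: Dt_sep; first by apply: Dt_pow; apply: Dt_prod; dd.
by apply: Dp_is_fun; dd.
Qed.

Lemma app_funs f A B x : f ∈ funs A B -> x ∈ A -> app f x ∈ B.
Proof. by move=> /in_funs; apply: app_in. Qed.

Lemma lam_funs A B F : Dt (fun e => F (e 0)) -> (forall x, x ∈ A -> F x ∈ B) -> lam A F ∈ funs A B.
Proof. by move=> HF H; apply/in_funs/is_fun_lam. Qed.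

Lemma funs_ext f g A B C : f ∈ funs A B -> g ∈ funs A C ->
  (forall x, x ∈ A -> app f x = app g x) -> f = g.
Proof. move=> /in_funs Hf /in_funs Hg; exact: fun_ext Hf Hg. Qed.

Definition inj A B : Prop := exists f, is_inj f A B.

Lemma inj_intro A B F : Dt (fun e => F (e 0)) -> (forall x, x ∈ A -> F x ∈ B) ->
  (forall x y, x ∈ A -> y ∈ A -> F x = F y -> x = y) -> inj A B.
Proof.
move=> HF H1 H2; exists (lam A F); split; first exact: is_fun_lam.
move=> x x' y /(rel_lam _ _ _ _ HF) [Hx ->] /(rel_lam _ _ _ _ HF) [Hx' E]; exact: H2.
Qed.

Lemma is_inj_elim f A B : is_inj f A B ->
  (forall x, x ∈ A -> app f x ∈ B) /\
  (forall x y, x ∈ A -> y ∈ A -> app f x = app f y -> x = y).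
Proof.
move=> [Hf Hi]; split=> [x|x y Hx Hy E]; first exact: app_in Hf.
by apply: (Hi x y (app f x)); apply/(rel_app _ _ _ _ _ Hf).
Qed.

Lemma inj_trans A B C : inj A B -> inj B C -> inj A C.
Proof.
move=> [f /is_inj_elim [f1 f2]] [g /is_inj_elim [g1 g2]].
apply: (inj_intro _ _ (fun x => app g (app f x))) => [|x Hx|x y Hx Hy E]; auto.
by apply: Dt_app; [dd|apply: Dt_app; dd].
Qed.

Lemma inj_subset A B : subset A B -> inj A B.
Proof. by move=> H; apply: (inj_intro _ _ (fun x => x)) => //; dd. Qed.

Lemma bij_intro A B F : Dt (fun e => F (e 0)) -> (forall x, x ∈ A -> F x ∈ B) ->
  (forall x y, x ∈ A -> y ∈ A -> F x = F y -> x = y) ->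
  (forall y, y ∈ B -> exists x, x ∈ A /\ F x = y) -> is_bij (lam A F) A B.
Proof.
move=> HF H1 H2 H3; split.
- split; first exact: is_fun_lam.
  move=> x x' y /(rel_lam _ _ _ _ HF) [Hx ->] /(rel_lam _ _ _ _ HF) [Hx' E]; exact: H2.
- move=> y /H3 [x [Hx E]]; exists x; by rewrite rel_lam.
Qed.

End Functions.

Ltac dbase2 := fail.
Ltac dbase ::=
  lazymatch goal with
  | |- Dt (fun e => the _) => apply: Dt_the
  | |- Dt (fun e => sep _ _) => apply: Dt_sep
  | |- Dt (fun e => img _ _) => apply: Dt_img
  | |- Dt (fun e => lam _ _) => apply: Dt_lam
  | |- Dt (fun e => upair _ _) => apply: Dt_upair
  | |- Dt (fun e => opair _ _) => apply: Dt_opair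
  | |- Dt (fun e => pr1 _) => apply: Dt_pr1
  | |- Dt (fun e => pr2 _) => apply: Dt_pr2
  | |- Dt (fun e => Un _) => apply: Dt_Un
  | |- Dt (fun e => pow _) => apply: Dt_pow
  | |- Dt (fun e => sc _) => apply: Dt_sc
  | |- Dt (fun e => app _ _) => apply: Dt_app
  | |- Dt (fun e => prod _ _) => apply: Dt_prod
  | |- Dt (fun e => funs _ _) => apply: Dt_funs
  | |- Dp (fun e => rel _ _ _) => apply: Dp_rel
  | |- Dp (fun e => is_fun _ _ _) => apply: Dp_is_fun
  | _ => dbase2
  end.

(** * The Schröder-Bernstein theorem *)

Section Bernstein.
Context {M : set_structure} {HM : Model M}.

(* [a] lies in the orbit under [g \o f] of a point outside the range of [g]. *)
Let reach (A B f g a : M) : Prop :=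
  forall Y, (forall x, x ∈ A -> ~ (exists b, b ∈ B /\ x = app g b) -> x ∈ Y) ->
            (forall x, x ∈ A -> x ∈ Y -> app g (app f x) ∈ Y) -> a ∈ Y.

(** The bijection is [f] on reached points and the inverse of [g] elsewhere. Both are definable,
    since injectivity of [g] makes its inverse a unique description. *)
Lemma bernstein (A B : M) : inj A B -> inj B A -> equipotent A B.
Proof.
move=> [f /is_inj_elim [f1 f2]] [g /is_inj_elim [g1 g2]].
have R1 x : x ∈ A -> ~ (exists b, b ∈ B /\ x = app g b) -> reach A B f g x by move=> Hx K Y Y1 Y2; auto.
have R2 x : x ∈ A -> reach A B f g x -> reach A B f g (app g (app f x)).
  by move=> Hx K Y Y1 Y2; exact: (Y2 x Hx (K Y Y1 Y2)).
have G x : x ∈ A -> ~ reach A B f g x -> exists b, b ∈ B /\ x = app g b.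
  move=> Hx K; apply: NNPP => L; apply: K; exact: R1.
set inv := fun x => the (fun b => b ∈ B /\ x = app g b).
have I b : b ∈ B -> inv (app g b) = b by move=> Hb; apply: the_eq => // c [Hc E]; apply: g2.
have DR : Dp (fun e => reach A B f g (e 0)) by rewrite /reach; dd.
exists (lam A (fun x => ite (reach A B f g x) (app f x) (inv x))).
apply: bij_intro.
- by rewrite /inv; dd.
- move=> x Hx; rewrite /ite; case: (decide _) => K; auto.
  by case: (G _ Hx K) => b [Hb ->]; rewrite I.
- move=> x y Hx Hy; rewrite /ite; case: (decide _) => K; case: (decide _) => L; auto.
  + case: (G _ Hy L) => b [Hb E]; rewrite E I // => E'; case: L; rewrite E -E'; exact: R2.
  + case: (G _ Hx K) => b [Hb E]; rewrite E I // => E'; case: K; rewrite E E'; exact: R2.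
  + by case: (G _ Hx K) => b [Hb ->]; case: (G _ Hy L) => c [Hc ->]; rewrite !I // => ->.
- move=> b Hb; case: (classic (reach A B f g (app g b))) => K; last first.
    by exists (app g b); split; auto; rewrite ite_false // I.
  (* If [b] were not the [f]-image of a reached point, the reached points other than [g b] would
     still contain all starting points and be closed under [g \o f]; so [g b] could not be
     reached. *)
  apply: NNPP => N.
  set Q := fun x => x <> app g b /\ reach A B f g x.
  have S x : x ∈ sep A Q <-> x ∈ A /\ Q x by apply: in_sep; rewrite /Q; dd.
  enough (U : app g b ∈ sep A Q) by (move/S: U => [_ [U _]]; exact: U).
  apply: K => x Hx.
  + move=> L; apply/S; split=> //; split; [by move=> E; apply: L; exists b|exact: R1].
  + move=> /S [_ [_ L]]; apply/S; split; first by auto.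
    split; last exact: R2.
    move=> E; apply: N; exists x; split=> //; rewrite ite_true //; apply: g2; auto.
Qed.

End Bernstein.

(** * The set of natural numbers, induction and recursion *)

Section Omega.
Context {M : set_structure} {HM : Model M}.
Implicit Types (x y z m n k : M).

Lemma exists_omega : exists w : M, is_omega w.
Proof.
case: (model_zf) => _ [_ [_ [_ [_ [[I [[o [Ho HI]] HS]] _]]]]].
have II : inductive_set I.
  split=> [o' /is_empty_eq ->|x y Hx /is_succ_eq ->]; first by move/is_empty_eq: Ho HI => ->.
  by case: (HS _ Hx) => y' [/is_succ_eq -> //].
set Q := fun x : M => forall J : M, inductive_set J -> x ∈ J.
have S x : x ∈ sep I Q <-> x ∈ I /\ Q x.
  by apply: in_sep; rewrite /Q /inductive_set /is_empty /is_succ; dd.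
exists (sep I Q); split; first split.
- move=> o' Ho'; apply/S; split; first exact: (proj1 II).
  by move=> J [HJ _]; apply: HJ.
- move=> x y /S [Hx Qx] Hy; apply/S; split; first exact: (proj2 II) Hy.
  by move=> J HJ; apply: (proj2 HJ) Hy; apply: Qx.
- by move=> J HJ x /S [_]; apply.
Qed.

Definition omega : M := the (@is_omega M).

Lemma is_omega_unique (w w' : M) : is_omega w -> is_omega w' -> w = w'.
Proof. move=> [H1 H2] [K1 K2]; apply: ext => z; split; [exact: H2|exact: K2]. Qed.

Lemma is_omega_eq (w : M) : is_omega w <-> w = omega.
Proof.
have H : is_omega omega.
  by apply: the_spec; case: exists_omega => v Hv; exists v; split=> // v'; apply: is_omega_unique.
by split=> [K|-> //]; apply: is_omega_unique.
Qed.

Lemma omega_emp : emp ∈ omega.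
Proof. by have /is_omega_eq [[H _] _] : omega = omega by []; apply: H; apply/is_empty_eq. Qed.

Lemma omega_sc n : n ∈ omega -> sc n ∈ omega.
Proof. by move=> Hn; have /is_omega_eq [[_ H] _] : omega = omega by []; apply: (H n) => //; apply/is_succ_eq. Qed.

(** Definability of [P] is essential: the [omega] of [M] may contain nonstandard elements, and
    minimality is known only against sets of [M]. *)
Lemma omega_ind (P : M -> Prop) : Dp (fun e => P (e 0)) -> P emp ->
  (forall n, n ∈ omega -> P n -> P (sc n)) -> forall n, n ∈ omega -> P n.
Proof.
move=> DP H0 HS n Hn.
have S x : x ∈ sep omega P <-> x ∈ omega /\ P x by apply: in_sep.
have /is_omega_eq [_ H] : omega = omega by [].
enough (U : n ∈ sep omega P) by (move/S: U => [_ U]; exact: U).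
apply: (H (sep omega P)) => //; split=> [o /is_empty_eq ->|x y /S [Hx Px] /is_succ_eq ->]; apply/S.
- by split=> //; apply: omega_emp.
- by split; [apply: omega_sc|apply: HS].
Qed.

Lemma omega_case n : n ∈ omega -> n = emp \/ exists m, m ∈ omega /\ n = sc m.
Proof.
move: n; apply: omega_ind; [dd|by left|by move=> n Hn _; right; exists n].
Qed.

Lemma omega_trans n : n ∈ omega -> forall m, m ∈ n -> m ∈ omega.
Proof.
move: n; apply: omega_ind; [dd|by move=> m /in_emp|].
by move=> n Hn IH m /in_sc [|->]; auto.
Qed.

Lemma nat_trans n : n ∈ omega -> forall m k, m ∈ n -> k ∈ m -> k ∈ n.
Proof.
move: n; apply: omega_ind; [dd|by move=> m k /in_emp|].
move=> n Hn IH m k /in_sc [H|->] K; apply/in_sc; left=> //; exact: IH K.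
Qed.

Lemma nat_irrefl n : n ∈ omega -> ~ n ∈ n.
Proof.
move: n; apply: omega_ind; [dd|exact: in_emp|].
move=> n Hn IH /in_sc [H|H].
- apply: IH; apply: (nat_trans _ Hn (sc n)) => //; apply/in_sc; by right.
- apply: IH; rewrite -{2}H; apply/in_sc; by right.
Qed.

Lemma emp_in_sc n : n ∈ omega -> emp ∈ sc n.
Proof.
move: n; apply: omega_ind; [dd|by apply/in_sc; right|by move=> n Hn IH; apply/in_sc; left].
Qed.

Lemma sc_in_sc n : n ∈ omega -> forall m, m ∈ n -> sc m ∈ sc n.
Proof.
move: n; apply: omega_ind; [dd|by move=> m /in_emp|].
move=> n Hn IH m /in_sc [H|->]; apply/in_sc; [by left; apply: IH|by right].
Qed.

Lemma nat_total n : n ∈ omega -> forall m, m ∈ omega -> m ∈ n \/ m = n \/ n ∈ m.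
Proof.
move: n; apply: omega_ind; first by dd.
- move=> m /omega_case [->|[k [Hk ->]]]; [by right; left|by right; right; apply: emp_in_sc].
- move=> n Hn IH m Hm; case: (IH _ Hm) => [H|[->|H]].
  + by left; apply/in_sc; left.
  + by left; apply/in_sc; right.
  + case: (omega_case _ Hm) H => [->|[k [Hk ->]]]; first by move/in_emp.
    move/in_sc => [H|->]; [by right; right; apply: sc_in_sc|by right; left].
Qed.

Lemma sc_inj m n : m ∈ omega -> n ∈ omega -> sc m = sc n -> m = n.
Proof.
move=> Hm Hn E.
have : m ∈ sc n by rewrite -E; apply/in_sc; right.
have : n ∈ sc m by rewrite E; apply/in_sc; right.
move=> /in_sc [H|//] /in_sc [K|//].
by case: (nat_irrefl m Hm); apply: (nat_trans m Hm n).
Qed.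

Lemma sc_not_emp n : sc n <> emp.
Proof. move=> H; apply: (in_emp n); rewrite -H; apply/in_sc; by right. Qed.

Lemma nat_least (P : M -> Prop) : Dp (fun e => P (e 0)) -> (exists n, n ∈ omega /\ P n) ->
  exists n, n ∈ omega /\ P n /\ forall m, m ∈ n -> ~ P m.
Proof.
move=> DP [n [Hn Pn]]; apply: NNPP => N.
enough (H : forall k, k ∈ omega -> forall m, m ∈ k -> ~ P m).
{ by apply: (H (sc n)) Pn; [apply: omega_sc|apply/in_sc; right]. }
apply: omega_ind; [by dd|by move=> m /in_emp|].
move=> k Hk IH m /in_sc [H|->]; first exact: IH.
by move=> Pk; apply: N; exists k.
Qed.

Lemma sc_in n : n ∈ omega -> forall m, m ∈ n -> sc m ∈ n \/ sc m = n.
Proof.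
by move=> Hn m H; have := sc_in_sc _ Hn _ H; move/in_sc.
Qed.

Lemma nat_max m n : m ∈ omega -> n ∈ omega ->
  exists k, k ∈ omega /\ subset m k /\ subset n k.
Proof.
move=> Hm Hn; case: (nat_total _ Hn _ Hm) => [H|[->|H]].
- exists n; split=> //; split=> // x; exact: nat_trans.
- by exists n; split=> //; split=> x.
- exists m; split=> //; split=> // x; exact: nat_trans.
Qed.

(** No codomain is fixed in advance. An attempt is any set [g] whose [app]-values obey the clauses
    below [n], and its value at [n] does not depend on [g]. *)
Definition nrec (a : M) (F : M -> M -> M) (n : M) : M :=
  the (fun y => exists g, app g emp = a /\ (forall k, k ∈ n -> app g (sc k) = F k (app g k)) /\ y = app g n).

Lemma Dt_nrec (a : (nat -> M) -> M) (F : (nat -> M) -> M -> M -> M) (t : (nat -> M) -> M) :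
  Dt a -> Dt (fun e => F (fun i => e (S (S i))) (e 0) (e 1)) -> Dt t ->
  Dt (fun e => nrec (a e) (F e) (t e)).
Proof.
move=> Ha HF Ht; rewrite /nrec; apply: Dt_the.
have Ha' := Dt_ren (fun i => S (S i)) _ Ha.
have Ht' := Dt_ren (fun i => S (S i)) _ Ht.
have Ht'' := Dt_ren (fun i => S (S (S i))) _ Ht.
have HF' : Dt (fun e => F (fun i => e (S (S (S i)))) (e 0) (app (e 1) (e 0))).
  apply: (Dt_comp (fun e v => F (fun i => e (S (S (S i)))) (e 0) v)); last by dd.
  exact: (Dt_ren (fun i => match i with 0 => 1 | 1 => 0 | S (S j) => S (S (S (S j))) end) _ HF).
dd.
Qed.

Section Recursion.
Variables (a : M) (F : M -> M -> M).
Hypothesis DF : Dt (fun e => F (e 0) (e 1)).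

Let attempt (g n : M) := app g emp = a /\ (forall k, k ∈ n -> app g (sc k) = F k (app g k)).

Let D2 (s t : (nat -> M) -> M) : Dt s -> Dt t -> Dt (fun e => F (s e) (t e)).
Proof. exact: Dt_app2. Qed.

Let Dat (s t : (nat -> M) -> M) : Dt s -> Dt t -> Dp (fun e => attempt (s e) (t e)).
Proof. apply: Dp_app2; rewrite /attempt; dd; apply: D2; dd. Qed.

Lemma attempt_unique n : n ∈ omega -> forall g g', attempt g n -> attempt g' n -> app g n = app g' n.
Proof.
move: n; apply: omega_ind; first by dd; apply: Dat; dd.
- by move=> g g' [-> _] [-> _].
- move=> n Hn IH g g' [H1 H2] [K1 K2].
  have Hs : n ∈ sc n by apply/in_sc; right.
  rewrite H2 // K2 // (IH g g') //; split=> // k Hk; [apply: H2|apply: K2]; apply/in_sc; by left.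
Qed.

Lemma attempt_exists n : n ∈ omega -> exists g, attempt g n.
Proof.
move: n; apply: omega_ind; first by dd; apply: Dat; dd.
- exists (lam omega (fun _ => a)); split; last by move=> k /in_emp.
  by rewrite app_lam //; apply: omega_emp.
- move=> n Hn [g [H1 H2]].
  have D : Dt (fun e => ite (e 0 = sc n) (F n (app g n)) (app g (e 0))).
    by dd.
  exists (lam omega (fun k => ite (k = sc n) (F n (app g n)) (app g k))); split.
  + rewrite app_lam //; last exact: omega_emp.
    by rewrite ite_false // => H; case: (sc_not_emp n).
  + move=> k Hk; have Hk' : k ∈ omega by apply: omega_trans Hk; apply: omega_sc.
    have Kn : k <> sc n by move=> E; subst k; apply: (nat_irrefl (sc n)) => //; apply: omega_sc.
    rewrite !app_lam //; last exact: omega_sc.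
    rewrite (ite_false (k = _)) //; move/in_sc: Hk => [Hk|->]; last by rewrite ite_true.
    rewrite ite_false ?H2 // => /(sc_inj _ _ Hk' Hn) E; subst k; exact: (nat_irrefl n).
Qed.

Lemma nrec_attempt n g : n ∈ omega -> attempt g n -> nrec a F n = app g n.
Proof.
move=> Hn Hg; apply: the_eq; first by exists g; case: Hg.
by move=> y [g' [H1 [H2 ->]]]; apply: attempt_unique.
Qed.

Lemma nrec_0 : nrec a F emp = a.
Proof.
case: (attempt_exists _ omega_emp) => g Hg; rewrite (nrec_attempt _ _ omega_emp Hg); by case: Hg.
Qed.

Lemma nrec_S n : n ∈ omega -> nrec a F (sc n) = F n (nrec a F n).
Proof.
move=> Hn; case: (attempt_exists _ (omega_sc _ Hn)) => g Hg.
rewrite (nrec_attempt _ _ (omega_sc _ Hn) Hg) (nrec_attempt n g) //; case: Hg => H1 H2.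
- by apply: H2; apply/in_sc; right.
- by split=> // k Hk; apply: H2; apply/in_sc; left.
Qed.

End Recursion.
End Omega.

#[global] Opaque the sep img upair opair pr1 pr2 Un pow sc prod app lam funs omega nrec emp.

Ltac dbase3 := fail.
Ltac dbase2 ::=
  lazymatch goal with
  | |- Dt (fun e => nrec _ _ _) => apply: Dt_nrec
  | _ => dbase3
  end.

#[export] Hint Resolve omega_emp omega_sc : core.

(** * Natural numbers and integers *)

Section NatOps.
Context {M : set_structure} {HM : Model M}.
Implicit Types (x y z m n k : M).

(* The operations first replace arguments outside omega by 0, so that the
   semiring laws hold on all of M up to this normalization. *)
Lemma nn_sig : {f : M -> M | f = fun x => ite (x ∈ omega) x emp}.
Proof. by exists (fun x => ite (x ∈ omega) x emp). Qed.
Definition nn := proj1_sig nn_sig.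
Lemma nnE : nn = fun x => ite (x ∈ omega) x emp.
Proof. exact: (proj2_sig nn_sig). Qed.
Definition eqN x y : Prop := nn x = nn y.
Lemma nadd_sig : {f : M -> M -> M | f = fun x y => nrec (nn x) (fun _ v => sc v) (nn y)}.
Proof. by exists (fun x y => nrec (nn x) (fun _ v => sc v) (nn y)). Qed.
Definition nadd := proj1_sig nadd_sig.
Lemma naddE : nadd = fun x y => nrec (nn x) (fun _ v => sc v) (nn y).
Proof. exact: (proj2_sig nadd_sig). Qed.
Lemma nmul_sig : {f : M -> M -> M | f = fun x y => nrec emp (fun _ v => nadd v x) (nn y)}.
Proof. by exists (fun x y => nrec emp (fun _ v => nadd v x) (nn y)). Qed.
Definition nmul := proj1_sig nmul_sig.
Lemma nmulE : nmul = fun x y => nrec emp (fun _ v => nadd v x) (nn y).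
Proof. exact: (proj2_sig nmul_sig). Qed.
Definition none : M := sc emp.

Lemma Dt_nn s : Dt s -> Dt (fun e : nat -> M => nn (s e)).
Proof. apply: Dt_app1; rewrite nnE; dd. Qed.

Lemma Dt_nadd s t : Dt s -> Dt t -> Dt (fun e : nat -> M => nadd (s e) (t e)).
Proof. apply: Dt_app2; rewrite naddE nnE; dd. Qed.

Lemma Dt_nmul s t : Dt s -> Dt t -> Dt (fun e : nat -> M => nmul (s e) (t e)).
Proof. apply: Dt_app2; rewrite nmulE nnE; dd; apply: Dt_nadd; dd. Qed.

End NatOps.

Ltac dbase4 := fail.
Ltac dbase3 ::=
  lazymatch goal with
  | |- Dt (fun e => nn _) => apply: Dt_nn
  | |- Dt (fun e => nadd _ _) => apply: Dt_nadd
  | |- Dt (fun e => nmul _ _) => apply: Dt_nmul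
  | _ => dbase4
  end.

Section NatArith.
Context {M : set_structure} {HM : Model M}.
Implicit Types (x y z m n k : M).

Lemma nn_id x : x ∈ omega -> nn x = x.
Proof. by move=> H; rewrite nnE ite_true. Qed.

Lemma nn_in x : nn x ∈ omega.
Proof. rewrite nnE /ite; case: (decide _) => // _; exact: omega_emp. Qed.

Lemma nn_nn x : nn (nn x) = nn x.
Proof. exact/nn_id/nn_in. Qed.

Lemma nadd_0 m : nadd m emp = nn m.
Proof. by rewrite naddE (nn_id emp) // nrec_0. Qed.

Lemma nadd_S m n : n ∈ omega -> nadd m (sc n) = sc (nadd m n).
Proof. by move=> Hn; rewrite naddE (nn_id (sc n)) ?(nn_id n) ?nrec_S //; apply: omega_sc. Qed.

Lemma nadd_nnl m n : nadd (nn m) n = nadd m n.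
Proof. by rewrite naddE nn_nn. Qed.

Lemma nadd_nnr m n : nadd m (nn n) = nadd m n.
Proof. by rewrite naddE nn_nn. Qed.

Lemma nadd_in m n : nadd m n ∈ omega.
Proof.
rewrite -nadd_nnr; move: (nn n) (nn_in n); apply: omega_ind.
- by dd.
- by rewrite nadd_0; apply: nn_in.
- by move=> k Hk IH; rewrite nadd_S //; apply: omega_sc.
Qed.

#[local] Hint Resolve nn_in nadd_in : core.

Lemma nadd_0l n : nadd emp n = nn n.
Proof.
rewrite -nadd_nnr; move: (nn n) (nn_in n); apply: omega_ind.
- by dd.
- by rewrite nadd_0 nn_id.
- by move=> k Hk IH; rewrite nadd_S // IH.
Qed.

Lemma nadd_Sl m n : m ∈ omega -> nadd (sc m) n = sc (nadd m n).
Proof.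
move=> Hm; rewrite -(nadd_nnr (sc m)) -(nadd_nnr m); move: (nn n) (nn_in n); apply: omega_ind.
- by dd.
- by rewrite !nadd_0 !nn_id //; apply: omega_sc.
- by move=> k Hk IH; rewrite !nadd_S // IH.
Qed.

Lemma nadd_comm m n : nadd m n = nadd n m.
Proof.
rewrite -nadd_nnr -(nadd_nnl n); move: (nn n) (nn_in n); apply: omega_ind.
- by dd.
- by rewrite nadd_0 nadd_0l.
- by move=> k Hk IH; rewrite nadd_S // nadd_Sl // IH.
Qed.

Lemma nadd_assoc m n k : nadd m (nadd n k) = nadd (nadd m n) k.
Proof.
rewrite -(nadd_nnr n) -(nadd_nnr _ k); move: (nn k) (nn_in k); apply: omega_ind.
- by dd.
- by rewrite !nadd_0 nadd_nnr nn_id //; apply: nadd_in.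
- by move=> l Hl IH; rewrite !nadd_S // ?IH //; apply: nadd_in.
Qed.

Lemma nmul_0 m : nmul m emp = emp.
Proof. by rewrite nmulE (nn_id emp) // nrec_0. Qed.

Lemma nmul_S m n : n ∈ omega -> nmul m (sc n) = nadd (nmul m n) m.
Proof.
by move=> Hn; rewrite nmulE (nn_id (sc n)) ?(nn_id n) ?nrec_S //; apply: omega_sc.
Qed.

Lemma nmul_nnr m n : nmul m (nn n) = nmul m n.
Proof. by rewrite nmulE nn_nn. Qed.

Lemma nmul_nnl m n : nmul (nn m) n = nmul m n.
Proof.
rewrite -nmul_nnr -(nmul_nnr m); move: (nn n) (nn_in n); apply: omega_ind.
- by dd.
- by rewrite !nmul_0.
- by move=> k Hk IH; rewrite !nmul_S // IH nadd_nnr.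
Qed.

Lemma nmul_in m n : nmul m n ∈ omega.
Proof.
rewrite -nmul_nnr; move: (nn n) (nn_in n); apply: omega_ind.
- by dd.
- by rewrite nmul_0; apply: omega_emp.
- by move=> k Hk IH; rewrite nmul_S //; apply: nadd_in.
Qed.

#[local] Hint Resolve nmul_in : core.

Lemma nmul_0l n : nmul emp n = emp.
Proof.
rewrite -nmul_nnr; move: (nn n) (nn_in n); apply: omega_ind.
- by dd.
- by rewrite nmul_0.
- by move=> k Hk IH; rewrite nmul_S // IH nadd_0 nn_id //; apply: omega_emp.
Qed.

Lemma nmul_Sl m n : m ∈ omega -> nmul (sc m) n = nadd (nmul m n) n.
Proof.
move=> Hm; rewrite -(nmul_nnr (sc m)) -(nmul_nnr m) -(nadd_nnr _ n).
move: (nn n) (nn_in n); apply: omega_ind.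
- by dd.
- by rewrite !nmul_0 nadd_0 nn_id //; apply: omega_emp.
- move=> k Hk IH; rewrite !nmul_S // IH !nadd_S // -!nadd_assoc; by rewrite (nadd_comm k m).
Qed.

Lemma nmul_comm m n : nmul m n = nmul n m.
Proof.
rewrite -nmul_nnr -(nmul_nnl n); move: (nn n) (nn_in n); apply: omega_ind.
- by dd.
- by rewrite nmul_0 nmul_0l.
- by move=> k Hk IH; rewrite nmul_S // nmul_Sl // IH.
Qed.

Lemma nmul_addl m n k : nmul (nadd m n) k = nadd (nmul m k) (nmul n k).
Proof.
rewrite -!(nmul_nnr _ k); move: (nn k) (nn_in k); apply: omega_ind.
- by dd.
- by rewrite !nmul_0 nadd_0 nn_id //; apply: omega_emp.
- move=> l Hl IH; rewrite !nmul_S // IH -!nadd_assoc; congr nadd.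
  by rewrite !nadd_assoc (nadd_comm m).
Qed.

Lemma nmul_assoc m n k : nmul m (nmul n k) = nmul (nmul m n) k.
Proof.
rewrite -(nmul_nnr n k) -(nmul_nnr _ k); move: (nn k) (nn_in k); apply: omega_ind.
- by dd.
- by rewrite !nmul_0.
- by move=> l Hl IH; rewrite !nmul_S // nmul_comm nmul_addl nmul_comm IH (nmul_comm n).
Qed.

Lemma nmul_1l m : nmul none m = nn m.
Proof. by rewrite nmul_Sl ?nmul_0l ?nadd_0l //; apply: omega_emp. Qed.

Lemma eqN_equiv : Equivalence eqN.
Proof.
by split; [move=> x|move=> x y H|move=> x y z H K]; rewrite /eqN; congruence.
Qed.

(** The [ring] tactic wants laws on a whole type; they hold on [M] up to [eqN], and [eqN_eq] returns
    to equality for members of [omega]. *)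
Lemma nat_semiring : semi_ring_theory emp none nadd nmul eqN.
Proof.
split; rewrite /eqN.
- by move=> n; rewrite nadd_0l nn_nn.
- by move=> n m; rewrite nadd_comm.
- by move=> n m p; rewrite nadd_assoc.
- by move=> n; rewrite nmul_1l nn_nn.
- by move=> n; rewrite nmul_0l.
- by move=> n m; rewrite nmul_comm.
- by move=> n m p; rewrite nmul_assoc.
- by move=> n m p; rewrite nmul_addl.
Qed.

Lemma nat_ring_ext : sring_eq_ext nadd nmul eqN.
Proof.
split=> x y H x' y' H'; rewrite /eqN.
- by rewrite -(nadd_nnl x) -(nadd_nnr _ x') -(nadd_nnl y) -(nadd_nnr _ y') H H'.
- by rewrite -(nmul_nnl x) -(nmul_nnr _ x') -(nmul_nnl y) -(nmul_nnr _ y') H H'.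
Qed.

Lemma eqN_eq x y : x ∈ omega -> y ∈ omega -> eqN x y -> x = y.
Proof. by move=> /nn_id Hx /nn_id Hy; rewrite /eqN Hx Hy. Qed.

Lemma nadd_cancel m n k : m ∈ omega -> n ∈ omega -> nadd m k = nadd n k -> m = n.
Proof.
move=> Hm Hn; rewrite -(nadd_nnr m) -(nadd_nnr n); move: (nn k) (nn_in k); apply: omega_ind.
- by dd.
- by rewrite !nadd_0 !nn_id.
- move=> l Hl IH; rewrite !nadd_S // => /(sc_inj _ _ (nadd_in _ _) (nadd_in _ _)); exact: IH.
Qed.

Lemma nat_diff m n : m ∈ omega -> n ∈ omega ->
  exists k, k ∈ omega /\ (m = nadd n k \/ n = nadd m k).
Proof.
move=> Hm; move: n; apply: omega_ind.
- by dd.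
- by exists m; rewrite nadd_0l nn_id //; auto.
- move=> n Hn [k [Hk [E|E]]].
  + case: (omega_case _ Hk) E => [->|[l [Hl ->]]] E.
    * exists none; split; first exact/omega_sc/omega_emp.
      by right; rewrite E nadd_0 nn_id // nadd_S ?nadd_0 ?nn_id //; apply: omega_emp.
    * by exists l; split=> //; left; rewrite nadd_Sl // E nadd_S.
  + by exists (sc k); split; [exact: omega_sc|right; rewrite nadd_S // E].
Qed.

Lemma nat_mul_eq0 m n : m ∈ omega -> n ∈ omega -> nmul m n = emp -> m = emp \/ n = emp.
Proof.
move=> Hm Hn; case: (omega_case _ Hn) => [->|[k [Hk ->]]]; first by right.
case: (omega_case _ Hm) => [->|[l [Hl ->]]]; first by left.
by rewrite nmul_S // nadd_S // => /sc_not_emp.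
Qed.

Lemma nat_euclid a d : a ∈ omega -> d ∈ omega -> d <> emp ->
  exists q r, q ∈ omega /\ r ∈ d /\ a = nadd (nmul q d) r.
Proof.
move=> Ha Hd D0; move: a Ha; apply: omega_ind.
- by dd.
- exists emp, emp; split; first exact: omega_emp.
  split; last by rewrite nmul_0l nadd_0 nn_id //; apply: omega_emp.
  by case: (omega_case _ Hd) => [//|[k [Hk ->]]]; apply: emp_in_sc.
- move=> a Ha [q [r [Hq [Hr E]]]].
  have Hr' := omega_trans _ Hd _ Hr.
  case: (sc_in _ Hd _ Hr) => H.
  + by exists q, (sc r); rewrite nadd_S // E.
  + exists (sc q), emp; split; first exact: omega_sc.
    split; first by case: (omega_case _ Hd) => [//|[k [Hk ->]]]; apply: emp_in_sc.
    by rewrite nadd_0 nn_id ?nmul_Sl // -{2}H ?nadd_S // ?E //; apply: nadd_in.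
Qed.

Lemma nat_parity m n : m ∈ omega -> n ∈ omega -> nadd m m <> sc (nadd n n).
Proof.
move=> Hm; move: n; move: m Hm; apply: omega_ind.
- by dd.
- by move=> n Hn; rewrite nadd_0l nn_id // => H; apply: (sc_not_emp _ (eq_sym H)).
- move=> m Hm IH n Hn; rewrite nadd_S ?nadd_Sl //.
  move=> /(sc_inj _ _ (omega_sc _ (nadd_in _ _)) (nadd_in _ _)) E.
  case: (omega_case _ Hn) E => [->|[k [Hk ->]]].
  + by rewrite nadd_0l nn_id //; apply: sc_not_emp.
  + rewrite nadd_S ?nadd_Sl //.
    by move/(sc_inj _ _ (nadd_in _ _) (omega_sc _ (nadd_in _ _))); apply: IH.
Qed.

End NatArith.


#[export] Hint Resolve nadd_in nmul_in nn_in : core.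

(** * Integers as classes of pairs of naturals *)

Section IntOps.
Context {M : set_structure} {HM : Model M}.
Implicit Types (x y z m n k : M).

(** Packing an operation with its defining equation in an opaque proof keeps conversion from
    unfolding it; [clE] unfolds on demand. The class stands for [m - n]. *)
Lemma cl_sig : {f : M -> M -> M | f = fun m n => sep (prod omega omega) (fun q => nadd m (pr2 q) = nadd (pr1 q) n)}.
Proof. by exists (fun m n => sep (prod omega omega) (fun q => nadd m (pr2 q) = nadd (pr1 q) n)). Qed.
Definition cl := proj1_sig cl_sig.
Lemma clE : cl = fun m n => sep (prod omega omega) (fun q => nadd m (pr2 q) = nadd (pr1 q) n).
Proof. exact: (proj2_sig cl_sig). Qed.
Definition ZZ : M := img (prod omega omega) (fun q => cl (pr1 q) (pr2 q)).
Lemma zz_sig : {f : M -> M | f = fun x => ite (x ∈ ZZ) x (cl emp emp)}.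
Proof. by exists (fun x => ite (x ∈ ZZ) x (cl emp emp)). Qed.
Definition zz := proj1_sig zz_sig.
Lemma zzE : zz = fun x => ite (x ∈ ZZ) x (cl emp emp).
Proof. exact: (proj2_sig zz_sig). Qed.
Definition eqZ x y : Prop := zz x = zz y.
(** [f] and [g] compute the two components of the result from representatives. The description has a
    value once the resulting class is independent of these, which is the first hypothesis of
    [zop_rep]. *)
Definition zop (f g : M -> M -> M -> M -> M) x y : M :=
  the (fun d => exists m n m' n', m ∈ omega /\ n ∈ omega /\ m' ∈ omega /\ n' ∈ omega /\
    zz x = cl m n /\ zz y = cl m' n' /\ d = cl (f m n m' n') (g m n m' n')).
Lemma zadd_sig : {f : M -> M -> M | f = fun x y => zop (fun m n m' n' => nadd m m') (fun m n m' n' => nadd n n') x y}.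
Proof. by exists (fun x y => zop (fun m n m' n' => nadd m m') (fun m n m' n' => nadd n n') x y). Qed.
Definition zadd := proj1_sig zadd_sig.
Lemma zaddE : zadd = fun x y => zop (fun m n m' n' => nadd m m') (fun m n m' n' => nadd n n') x y.
Proof. exact: (proj2_sig zadd_sig). Qed.
Lemma zmul_sig : {f : M -> M -> M | f = fun x y => zop (fun m n m' n' => nadd (nmul m m') (nmul n n')) (fun m n m' n' => nadd (nmul m n') (nmul n m')) x y}.
Proof. by exists (fun x y => zop (fun m n m' n' => nadd (nmul m m') (nmul n n')) (fun m n m' n' => nadd (nmul m n') (nmul n m')) x y). Qed.
Definition zmul := proj1_sig zmul_sig.
Lemma zmulE : zmul = fun x y => zop (fun m n m' n' => nadd (nmul m m') (nmul n n')) (fun m n m' n' => nadd (nmul m n') (nmul n m')) x y.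
Proof. exact: (proj2_sig zmul_sig). Qed.
Lemma zsub_sig : {f : M -> M -> M | f = fun x y => zop (fun m n m' n' => nadd m n') (fun m n m' n' => nadd n m') x y}.
Proof. by exists (fun x y => zop (fun m n m' n' => nadd m n') (fun m n m' n' => nadd n m') x y). Qed.
Definition zsub := proj1_sig zsub_sig.
Lemma zsubE : zsub = fun x y => zop (fun m n m' n' => nadd m n') (fun m n m' n' => nadd n m') x y.
Proof. exact: (proj2_sig zsub_sig). Qed.
Definition z0 : M := cl emp emp.
Definition z1 : M := cl none emp.
Definition zneg x : M := zsub z0 x.

Lemma Dt_cl s t : Dt s -> Dt t -> Dt (fun e : nat -> M => cl (s e) (t e)).
Proof. apply: Dt_app2; rewrite clE; dd. Qed.

Lemma Dt_zz s : Dt s -> Dt (fun e : nat -> M => zz (s e)).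
Proof. apply: Dt_app1; rewrite zzE; dd; apply: Dt_cl; dd. Qed.

Lemma Dt_zadd s t : Dt s -> Dt t -> Dt (fun e : nat -> M => zadd (s e) (t e)).
Proof. apply: Dt_app2; rewrite zaddE /zop zzE; dd; apply: Dt_cl; dd. Qed.

Lemma Dt_zmul s t : Dt s -> Dt t -> Dt (fun e : nat -> M => zmul (s e) (t e)).
Proof. apply: Dt_app2; rewrite zmulE /zop zzE; dd; apply: Dt_cl; dd. Qed.

Lemma Dt_zsub s t : Dt s -> Dt t -> Dt (fun e : nat -> M => zsub (s e) (t e)).
Proof. apply: Dt_app2; rewrite zsubE /zop zzE; dd; apply: Dt_cl; dd. Qed.

Lemma Dt_zneg s : Dt s -> Dt (fun e : nat -> M => zneg (s e)).
Proof. by move=> H; apply: Dt_zsub => //; apply: Dt_const. Qed.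

End IntOps.

Ltac dbase5 := fail.
Ltac dbase4 ::=
  lazymatch goal with
  | |- Dt (fun e => cl _ _) => apply: Dt_cl
  | |- Dt (fun e => zz _) => apply: Dt_zz
  | |- Dt (fun e => zadd _ _) => apply: Dt_zadd
  | |- Dt (fun e => zmul _ _) => apply: Dt_zmul
  | |- Dt (fun e => zsub _ _) => apply: Dt_zsub
  | |- Dt (fun e => zneg _) => apply: Dt_zneg
  | _ => dbase5
  end.

Section IntRing.
Context {M : set_structure} {HM : Model M}.
Implicit Types (x y z m n k : M).

Add Ring nat_ring : (@nat_semiring M HM) (setoid (@eqN_equiv M HM) (@nat_ring_ext M HM)).

Lemma in_cl m n q : q ∈ cl m n <->
  exists m' n', m' ∈ omega /\ n' ∈ omega /\ q = opair m' n' /\ nadd m n' = nadd m' n.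
Proof.
rewrite clE in_sep // in_prod; split.
- by move=> [[x [y [Hx [Hy ->]]]]]; rewrite pr1_opair pr2_opair => E; exists x, y.
- by move=> [x [y [Hx [Hy [-> E]]]]]; split; [exists x, y|rewrite pr1_opair pr2_opair].
Qed.

Lemma opair_in_cl m n m' n' : m' ∈ omega -> n' ∈ omega ->
  opair m' n' ∈ cl m n <-> nadd m n' = nadd m' n.
Proof.
move=> Hm Hn; rewrite in_cl; split=> [[x [y [_ [_ [/opair_inj [-> ->] //]]]]]|E].
by exists m', n'.
Qed.

Lemma cl_eq m n m' n' : m ∈ omega -> n ∈ omega -> m' ∈ omega -> n' ∈ omega ->
  cl m n = cl m' n' <-> nadd m n' = nadd m' n.
Proof.
move=> Hm Hn Hm' Hn'; split=> [E|E].
- by apply/opair_in_cl => //; rewrite E; apply/opair_in_cl.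
- apply: ext => q; rewrite !in_cl; split=> -[x [y [Hx [Hy [Eq K]]]]]; exists x, y; do !split=> //.
  + apply: (nadd_cancel _ _ n) => //.
    transitivity (nadd (nadd m' n) y); first by apply: eqN_eq => //; ring.
    rewrite -E; transitivity (nadd (nadd m y) n'); first by apply: eqN_eq => //; ring.
    by rewrite K; apply: eqN_eq => //; ring.
  + apply: (nadd_cancel _ _ n') => //.
    transitivity (nadd (nadd m n') y); first by apply: eqN_eq => //; ring.
    rewrite E; transitivity (nadd (nadd m' y) n); first by apply: eqN_eq => //; ring.
    by rewrite K; apply: eqN_eq => //; ring.
Qed.

Lemma in_ZZ x : x ∈ ZZ <-> exists m n, m ∈ omega /\ n ∈ omega /\ x = cl m n.
Proof.
rewrite /ZZ in_img //; split.
- by move=> [q [/in_prod [m [n [Hm [Hn ->]]]] ->]]; rewrite pr1_opair pr2_opair; exists m, n.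
- move=> [m [n [Hm [Hn ->]]]]; exists (opair m n); by rewrite in_prod_opair pr1_opair pr2_opair.
Qed.

Lemma cl_in m n : m ∈ omega -> n ∈ omega -> cl m n ∈ ZZ.
Proof. by move=> Hm Hn; apply/in_ZZ; exists m, n. Qed.

Lemma zz_id x : x ∈ ZZ -> zz x = x.
Proof. by move=> H; rewrite zzE ite_true. Qed.

Lemma zz_in x : zz x ∈ ZZ.
Proof. rewrite zzE /ite; case: (decide _) => // _; exact: cl_in. Qed.

Lemma zz_rep x : exists m n, m ∈ omega /\ n ∈ omega /\ zz x = cl m n.
Proof. exact/in_ZZ/zz_in. Qed.

Lemma zop_rep f g x y m n m' n' :
  (forall m n m' n' p q p' q', m ∈ omega -> n ∈ omega -> m' ∈ omega -> n' ∈ omega ->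
    p ∈ omega -> q ∈ omega -> p' ∈ omega -> q' ∈ omega ->
    nadd m q = nadd p n -> nadd m' q' = nadd p' n' ->
    cl (f m n m' n') (g m n m' n') = cl (f p q p' q') (g p q p' q')) ->
  m ∈ omega -> n ∈ omega -> m' ∈ omega -> n' ∈ omega ->
  zz x = cl m n -> zz y = cl m' n' -> zop f g x y = cl (f m n m' n') (g m n m' n').
Proof.
move=> H Hm Hn Hm' Hn' Ex Ey; apply: the_eq; first by exists m, n, m', n'.
move=> z [p [q [p' [q' [Hp [Hq [Hp' [Hq' [Fx [Fy ->]]]]]]]]]].
apply: H => //; apply/cl_eq => //; congruence.
Qed.

Lemma zadd_rep x y m n m' n' : m ∈ omega -> n ∈ omega -> m' ∈ omega -> n' ∈ omega ->
  zz x = cl m n -> zz y = cl m' n' -> zadd x y = cl (nadd m m') (nadd n n').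
Proof.
move=> Hm Hn Hm' Hn' Ex Ey; rewrite zaddE; apply: (zop_rep (fun m n m' n' => nadd m m') (fun m n m' n' => nadd n n')) => // i j i' j' p q p' q' ? ? ? ? ? ? ? ? E1 E2; apply/cl_eq => //.
transitivity (nadd (nadd i q) (nadd i' q')); first by apply: eqN_eq => //; ring.
by rewrite E1 E2; apply: eqN_eq => //; ring.
Qed.

Lemma zsub_rep x y m n m' n' : m ∈ omega -> n ∈ omega -> m' ∈ omega -> n' ∈ omega ->
  zz x = cl m n -> zz y = cl m' n' -> zsub x y = cl (nadd m n') (nadd n m').
Proof.
move=> Hm Hn Hm' Hn' Ex Ey; rewrite zsubE; apply: (zop_rep (fun m n m' n' => nadd m n') (fun m n m' n' => nadd n m')) => // i j i' j' p q p' q' ? ? ? ? ? ? ? ? E1 E2; apply/cl_eq => //.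
transitivity (nadd (nadd i q) (nadd p' j')); first by apply: eqN_eq => //; ring.
by rewrite E1 -E2; apply: eqN_eq => //; ring.
Qed.

Lemma zmul_rep x y m n m' n' : m ∈ omega -> n ∈ omega -> m' ∈ omega -> n' ∈ omega ->
  zz x = cl m n -> zz y = cl m' n' ->
  zmul x y = cl (nadd (nmul m m') (nmul n n')) (nadd (nmul m n') (nmul n m')).
Proof.
move=> Hm Hn Hm' Hn' Ex Ey; rewrite zmulE; apply: (zop_rep (fun m n m' n' => nadd (nmul m m') (nmul n n')) (fun m n m' n' => nadd (nmul m n') (nmul n m'))) => // i j i' j' p q p' q' ? ? ? ? ? ? ? ? E1 E2.
(* One factor changes its representative at a time. *)
transitivity (cl (nadd (nmul p i') (nmul q j')) (nadd (nmul p j') (nmul q i'))); apply/cl_eq => //.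
- transitivity (nadd (nmul (nadd i q) i') (nmul (nadd p j) j')); first by apply: eqN_eq => //; ring.
  transitivity (nadd (nmul (nadd p j) i') (nmul (nadd i q) j')); first by rewrite E1.
  by apply: eqN_eq => //; ring.
- transitivity (nadd (nmul p (nadd i' q')) (nmul q (nadd p' j'))); first by apply: eqN_eq => //; ring.
  transitivity (nadd (nmul p (nadd p' j')) (nmul q (nadd i' q'))); first by rewrite E2.
  by apply: eqN_eq => //; ring.
Qed.

Lemma zz_cl m n : m ∈ omega -> n ∈ omega -> zz (cl m n) = cl m n.
Proof. by move=> Hm Hn; apply/zz_id/cl_in. Qed.

Lemma zadd_in x y : zadd x y ∈ ZZ.
Proof.
case: (zz_rep x) => m [n [Hm [Hn Ex]]]; case: (zz_rep y) => m' [n' [Hm' [Hn' Ey]]].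
by rewrite (zadd_rep _ _ _ _ _ _ Hm Hn Hm' Hn' Ex Ey); apply: cl_in.
Qed.

Lemma zmul_in x y : zmul x y ∈ ZZ.
Proof.
case: (zz_rep x) => m [n [Hm [Hn Ex]]]; case: (zz_rep y) => m' [n' [Hm' [Hn' Ey]]].
by rewrite (zmul_rep _ _ _ _ _ _ Hm Hn Hm' Hn' Ex Ey); apply: cl_in.
Qed.

Lemma zsub_in x y : zsub x y ∈ ZZ.
Proof.
case: (zz_rep x) => m [n [Hm [Hn Ex]]]; case: (zz_rep y) => m' [n' [Hm' [Hn' Ey]]].
by rewrite (zsub_rep _ _ _ _ _ _ Hm Hn Hm' Hn' Ex Ey); apply: cl_in.
Qed.

Lemma zneg_in x : zneg x ∈ ZZ.
Proof. exact: zsub_in. Qed.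

Lemma z0_in : z0 ∈ ZZ.
Proof. exact: cl_in. Qed.

Lemma z1_in : z1 ∈ ZZ.
Proof. by apply: cl_in => //; apply: omega_sc. Qed.

Hint Resolve zadd_in zmul_in zsub_in zneg_in z0_in z1_in : core.

Lemma none_in : none ∈ omega.
Proof. exact: omega_sc. Qed.
Hint Resolve none_in : core.

Lemma zz0 : zz z0 = cl emp emp.
Proof. exact: zz_cl. Qed.

Lemma zz1 : zz z1 = cl none emp.
Proof. exact: zz_cl. Qed.

Lemma zneg_rep x m n : m ∈ omega -> n ∈ omega -> zz x = cl m n -> zneg x = cl n m.
Proof.
move=> Hm Hn Ex; rewrite /zneg (zsub_rep _ _ _ _ _ _ omega_emp omega_emp Hm Hn zz0 Ex).
by apply/cl_eq => //; apply: eqN_eq => //; ring.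
Qed.

(** Each integer is replaced by a representing pair, which turns a ring axiom into a semiring
    identity in [omega]. *)
Ltac zaxiom :=
  repeat match goal with
  | |- forall x, _ => let x := fresh "x" in move=> x;
     let m := fresh "m" in let n := fresh "n" in
     let Hm := fresh "Hm" in let Hn := fresh "Hn" in let E := fresh "E" in
     case: (zz_rep x) => m [n [Hm [Hn E]]]
  end;
  let A := fresh "Z" in have A := zz0; let B := fresh "Z" in have B := zz1;
  repeat match goal with
  | H : zz ?x = cl _ _, K : zz ?y = cl _ _ |- context [zadd ?x ?y] =>
      let E := fresh "E" in pose proof (fun a b c d => zadd_rep _ _ _ _ _ _ a b c d H K) as E;
      specialize (E ltac:(auto) ltac:(auto) ltac:(auto) ltac:(auto));
      let E' := fresh "E" in pose proof (zz_id _ (zadd_in x y)) as E'; rewrite {2}E in E';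
      let v := fresh "v" in set v := zadd x y in E' *; clearbody v; clear E
  | H : zz ?x = cl _ _, K : zz ?y = cl _ _ |- context [zmul ?x ?y] =>
      let E := fresh "E" in pose proof (fun a b c d => zmul_rep _ _ _ _ _ _ a b c d H K) as E;
      specialize (E ltac:(auto) ltac:(auto) ltac:(auto) ltac:(auto));
      let E' := fresh "E" in pose proof (zz_id _ (zmul_in x y)) as E'; rewrite {2}E in E';
      let v := fresh "v" in set v := zmul x y in E' *; clearbody v; clear E
  | H : zz ?x = cl _ _, K : zz ?y = cl _ _ |- context [zsub ?x ?y] =>
      let E := fresh "E" in pose proof (fun a b c d => zsub_rep _ _ _ _ _ _ a b c d H K) as E;
      specialize (E ltac:(auto) ltac:(auto) ltac:(auto) ltac:(auto));
      let E' := fresh "E" in pose proof (zz_id _ (zsub_in x y)) as E'; rewrite {2}E in E';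
      let v := fresh "v" in set v := zsub x y in E' *; clearbody v; clear E
  | H : zz ?x = cl _ _ |- context [zneg ?x] =>
      let E := fresh "E" in pose proof (fun a b => zneg_rep _ _ _ a b H) as E;
      specialize (E ltac:(auto) ltac:(auto));
      let E' := fresh "E" in pose proof (zz_id _ (zneg_in x)) as E'; rewrite {2}E in E';
      let v := fresh "v" in set v := zneg x in E' *; clearbody v; clear E
  end;
  rewrite /eqZ;
  repeat match goal with H : zz ?x = cl _ _ |- context [zz ?x] => rewrite H end;
  apply/cl_eq; auto; apply: eqN_eq; auto; ring.

Lemma int_ring : ring_theory z0 z1 zadd zmul zsub zneg eqZ.
Proof. split; zaxiom. Qed.

Lemma eqZ_equiv : Equivalence eqZ.
Proof.
by split; [move=> x|move=> x y H|move=> x y z H K]; rewrite /eqZ; congruence.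
Qed.

Lemma int_ring_ext : ring_eq_ext zadd zmul zneg eqZ.
Proof.
split=> x y H => [x' y' H'|x' y' H'|]; move: (H); rewrite /eqZ.
- case: (zz_rep x) => m [n [Hm [Hn E]]]; case: (zz_rep x') => m' [n' [Hm' [Hn' E']]] _.
  have F := eq_trans (eq_sym H) E; have F' := eq_trans (eq_sym H') E'.
  by rewrite (zadd_rep _ _ _ _ _ _ Hm Hn Hm' Hn' E E') (zadd_rep _ _ _ _ _ _ Hm Hn Hm' Hn' F F').
- case: (zz_rep x) => m [n [Hm [Hn E]]]; case: (zz_rep x') => m' [n' [Hm' [Hn' E']]] _.
  have F := eq_trans (eq_sym H) E; have F' := eq_trans (eq_sym H') E'.
  by rewrite (zmul_rep _ _ _ _ _ _ Hm Hn Hm' Hn' E E') (zmul_rep _ _ _ _ _ _ Hm Hn Hm' Hn' F F').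
- case: (zz_rep x) => m [n [Hm [Hn E]]] _.
  have F := eq_trans (eq_sym H) E.
  by rewrite (zneg_rep _ _ _ Hm Hn E) (zneg_rep _ _ _ Hm Hn F).
Qed.

Lemma eqZ_eq x y : x ∈ ZZ -> y ∈ ZZ -> eqZ x y -> x = y.
Proof. by move=> /zz_id Hx /zz_id Hy; rewrite /eqZ Hx Hy. Qed.

End IntRing.

#[export] Hint Resolve none_in zadd_in zmul_in zsub_in zneg_in z0_in z1_in zz_in : core.

Ltac zring := apply: eqZ_eq; [solve [auto]|solve [auto]|ring].

(** * Binary operations as sets of the model *)

Section Operations.
Context {M : set_structure} {HM : Model M}.
Implicit Types (G x y z p q : M) (op : M -> M -> M).

Definition mkop G op : M := lam (prod G G) (fun q => op (pr1 q) (pr2 q)).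

Lemma app2_rel p x y z : app2 p x y z <-> rel p (opair x y) z.
Proof.
split=> [[q [/is_opair_eq -> //]]|H]; exists (opair x y); by rewrite is_opair_eq.
Qed.

Lemma Dt_op_pair op : Dt (fun e => op (e 0) (e 1)) -> Dt (fun e => op (pr1 (e 0)) (pr2 (e 0))).
Proof. by move=> H; apply: Dt_app2; dd. Qed.

Lemma app2_mkop G op x y z : Dt (fun e => op (e 0) (e 1)) ->
  app2 (mkop G op) x y z <-> x ∈ G /\ y ∈ G /\ z = op x y.
Proof.
move=> D; rewrite app2_rel rel_lam; last exact: Dt_op_pair.
by rewrite in_prod_opair pr1_opair pr2_opair; tauto.
Qed.

Lemma is_binop_iff p G : is_binop p G <-> is_fun p (prod G G) G.
Proof.
split=> [[P [/is_prod_eq -> //]]|H]; exists (prod G G); by rewrite is_prod_eq.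
Qed.

Lemma is_binop_mkop G op : Dt (fun e => op (e 0) (e 1)) ->
  (forall x y, x ∈ G -> y ∈ G -> op x y ∈ G) -> is_binop (mkop G op) G.
Proof.
move=> D H; apply/is_binop_iff/is_fun_lam; first exact: Dt_op_pair.
by move=> q /in_prod [x [y [Hx [Hy ->]]]]; rewrite pr1_opair pr2_opair; apply: H.
Qed.

Lemma abelian_group_mkop G op o :
  Dt (fun e => op (e 0) (e 1)) ->
  (forall x y, x ∈ G -> y ∈ G -> op x y ∈ G) ->
  (forall x y z, x ∈ G -> y ∈ G -> z ∈ G -> op (op x y) z = op x (op y z)) ->
  (forall x y, x ∈ G -> y ∈ G -> op x y = op y x) ->
  o ∈ G -> (forall x, x ∈ G -> op o x = x) ->
  (forall x, x ∈ G -> exists y, y ∈ G /\ op x y = o) ->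
  abelian_group G (mkop G op).
Proof.
move=> D Hc Ha Hcm Ho H0 Hi; split; first exact: is_binop_mkop.
split; [|split].
- move=> x y z xy yz s Hx Hy Hz; rewrite !app2_mkop //.
  move=> [_ [_ ->]] [_ [_ ->]] [_ [_ ->]]; split=> //; split; [exact: Hc|exact: Ha].
- move=> x y s Hx Hy; rewrite !app2_mkop // => -[_ [_ ->]]; do 2 split=> //; exact: Hcm.
- exists o; split; first split=> // x Hx; first by rewrite app2_mkop // H0.
  by move=> x /[dup] Hx /Hi [y [Hy E]]; exists y; rewrite app2_mkop // E.
Qed.

End Operations.

Section Integers.
Context {M : set_structure} {HM : Model M}.
Implicit Types (x y z m n k d : M).

Add Ring nat_ring : (@nat_semiring M HM) (setoid (@eqN_equiv M HM) (@nat_ring_ext M HM)).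

Definition pZZ : M := mkop ZZ zadd.

Lemma app2_pZZ x y z : app2 pZZ x y z <-> x ∈ ZZ /\ y ∈ ZZ /\ z = zadd x y.
Proof. exact: app2_mkop. Qed.

Lemma is_int_class_eq c m n : m ∈ omega -> n ∈ omega ->
  is_int_class omega (mkop omega nadd) c m n <-> c = cl m n.
Proof.
move=> Hm Hn.
have H q : (exists m' n' s : M, m' ∈ omega /\ n' ∈ omega /\ is_opair q m' n' /\
      app2 (mkop omega nadd) m n' s /\ app2 (mkop omega nadd) m' n s) <-> q ∈ cl m n.
{ rewrite in_cl; split.
  - move=> [m' [n' [s [Hm' [Hn' [/is_opair_eq -> []]]]]]].
    rewrite !app2_mkop // => -[_ [_ ->]] [_ [_ E]]; by exists m', n'.
  - move=> [m' [n' [Hm' [Hn' [-> E]]]]]; exists m', n', (nadd m n').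
    by rewrite is_opair_eq !app2_mkop. }
split=> [K|-> q]; last by rewrite H.
by apply: ext => q; rewrite (K q) H.
Qed.

Lemma zadd_cl m n m' n' : m ∈ omega -> n ∈ omega -> m' ∈ omega -> n' ∈ omega ->
  zadd (cl m n) (cl m' n') = cl (nadd m m') (nadd n n').
Proof. by move=> Hm Hn Hm' Hn'; apply: zadd_rep => //; rewrite zz_cl. Qed.

Lemma zmul_cl m n m' n' : m ∈ omega -> n ∈ omega -> m' ∈ omega -> n' ∈ omega ->
  zmul (cl m n) (cl m' n') = cl (nadd (nmul m m') (nmul n n')) (nadd (nmul m n') (nmul n m')).
Proof. by move=> Hm Hn Hm' Hn'; apply: zmul_rep => //; rewrite zz_cl. Qed.

Lemma zneg_cl m n : m ∈ omega -> n ∈ omega -> zneg (cl m n) = cl n m.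
Proof. by move=> Hm Hn; apply: zneg_rep => //; rewrite zz_cl. Qed.

Lemma integers_ZZ : is_integers ZZ pZZ.
Proof.
exists omega, (mkop omega nadd); split; first by apply/is_omega_eq.
split; last split; last split.
- split; first by apply: is_binop_mkop.
  split=> [m o Hm /is_empty_eq ->|m n n' s s' Hm Hn /is_succ_eq -> /is_succ_eq ->]; rewrite !app2_mkop //.
  + by rewrite nadd_0 nn_id.
  + by move=> [_ [_ ->]]; rewrite nadd_S //; do 2 split=> //; apply: omega_sc.
- move=> c; rewrite in_ZZ; split=> -[m [n [Hm [Hn K]]]]; exists m, n; do 2 split=> //; exact/is_int_class_eq.
- by apply: is_binop_mkop.
- move=> m n m' n' s t c c' d Hm Hn Hm' Hn'; rewrite !app2_mkop // => -[_ [_ ->]] [_ [_ ->]].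
  rewrite !is_int_class_eq // => -> -> ->; rewrite zadd_cl //.
  by do !split=> //; apply: cl_in.
Qed.

Lemma int_sign z : z ∈ ZZ -> exists k, k ∈ omega /\ (z = cl k emp \/ z = zneg (cl k emp)).
Proof.
move=> /in_ZZ [m [n [Hm [Hn ->]]]]; case: (nat_diff _ _ Hm Hn) => k [Hk [->|->]]; exists k; split=> //.
- by left; apply/cl_eq => //; apply: eqN_eq => //; ring.
- by right; rewrite zneg_cl //; apply/cl_eq => //; apply: eqN_eq => //; ring.
Qed.

Lemma cl_euclid q d r : q ∈ omega -> d ∈ omega -> r ∈ omega ->
  cl (nadd (nmul q d) r) emp = zadd (zmul (cl q emp) (cl d emp)) (cl r emp).
Proof.
move=> Hq Hd Hr; rewrite zmul_cl // zadd_cl //; apply/cl_eq => //; apply: eqN_eq => //; ring.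
Qed.

Lemma zmul_pos k l : k ∈ omega -> l ∈ omega ->
  zmul (cl k emp) (cl l emp) = cl (nmul k l) emp.
Proof. move=> Hk Hl; rewrite zmul_cl //; apply/cl_eq => //; apply: eqN_eq => //; ring. Qed.

End Integers.

Section IntegerDomain.
Context {M : set_structure} {HM : Model M}.
Implicit Types (x y z m n k d : M).

Add Ring int_ring : (@int_ring M HM) (setoid (@eqZ_equiv M HM) (@int_ring_ext M HM)).

Lemma is_zero_ZZ x : is_zero ZZ pZZ x <-> x = z0.
Proof.
split=> [[Hx H]|->].
- have /app2_pZZ [_ [_ E]] := H _ z0_in.
  by rewrite E; zring.
- by split=> // x' Hx'; apply/app2_pZZ; do 2 split=> //; zring.
Qed.

Lemma zsub_eq0 x y : x ∈ ZZ -> y ∈ ZZ -> zsub x y = z0 -> x = y.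
Proof.
move=> Hx Hy E; have -> : x = zadd (zsub x y) y by zring.
by rewrite E; zring.
Qed.

Lemma cl_sc k : k ∈ omega -> cl (sc k) emp = zadd (cl k emp) z1.
Proof.
move=> Hk; rewrite zadd_cl // nadd_0 nn_id // /none nadd_S // nadd_0 nn_id //.
Qed.

(** Every integer is reached from 0 by steps in a single direction, so this is induction on the
    absolute value. *)
Lemma int_ind (P : M -> Prop) : Dp (fun e => P (e 0)) -> P z0 ->
  (forall z, z ∈ ZZ -> P z -> P (zadd z z1)) -> (forall z, z ∈ ZZ -> P z -> P (zsub z z1)) ->
  forall z, z ∈ ZZ -> P z.
Proof.
move=> D H0 H1 H2 z /int_sign [k [Hk [->|->]]]; move: k Hk; apply: omega_ind => //.
- by move=> k Hk IH; rewrite cl_sc //; apply: H1 => //; apply: cl_in.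
- by rewrite zneg_cl.
- move=> k Hk IH; rewrite cl_sc //.
  have -> : zneg (zadd (cl k emp) z1) = zsub (zneg (cl k emp)) z1 by zring.
  exact: H2.
Qed.

Lemma cl_eq0 k : k ∈ omega -> cl k emp = z0 -> k = emp.
Proof. by move=> Hk /cl_eq; rewrite nadd_0 nadd_0 !nn_id //; apply. Qed.

Lemma zmul_eq0 x y : x ∈ ZZ -> y ∈ ZZ -> zmul x y = z0 -> x = z0 \/ y = z0.
Proof.
have A k l : k ∈ omega -> l ∈ omega -> zmul (cl k emp) (cl l emp) = z0 -> k = emp \/ l = emp.
{ by move=> Hk Hl; rewrite zmul_pos // => /(cl_eq0 _ (nmul_in _ _)); apply: nat_mul_eq0. }
move=> /int_sign [k [Hk Ex]] /int_sign [l [Hl Ey]] H.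
have {H} : k = emp \/ l = emp.
{ apply: A => //; move: Ex Ey H => [->|->] [->|->] // H.
  - have -> : zmul (cl k emp) (cl l emp) = zneg (zmul (cl k emp) (zneg (cl l emp))) by zring.
    by rewrite H; zring.
  - have -> : zmul (cl k emp) (cl l emp) = zneg (zmul (zneg (cl k emp)) (cl l emp)) by zring.
    by rewrite H; zring.
  - have -> : zmul (cl k emp) (cl l emp) = zmul (zneg (cl k emp)) (zneg (cl l emp)) by zring.
    by rewrite H. }
have N : zneg (cl emp emp) = z0 by rewrite zneg_cl.
by move=> [E|E]; [left; case: Ex|right; case: Ey] => ->; rewrite E.
Qed.

Lemma z_parity x : x ∈ ZZ -> zadd x x <> z1.
Proof.
have E0 : nadd emp emp = emp by rewrite nadd_0 nn_id.
have N0 y : y ∈ omega -> nadd y emp = y by move=> Hy; rewrite nadd_0 nn_id.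
move=> /int_sign [k [Hk [->|->]]].
- rewrite zadd_cl // E0 /z1.
  move/(proj1 (cl_eq _ _ _ _ (nadd_in _ _) omega_emp none_in omega_emp)).
  rewrite !N0 // => H; apply: (nat_parity k emp) => //; by rewrite E0.
- rewrite zneg_cl // zadd_cl // E0 /z1.
  move/(proj1 (cl_eq _ _ _ _ omega_emp (nadd_in _ _) none_in omega_emp)).
  rewrite E0 nadd_Sl // => H; exact: (sc_not_emp _ (eq_sym H)).
Qed.

(* Least positive element, then Euclidean division. *)
Lemma int_principal (Q : M -> Prop) : Dp (fun e => Q (e 0)) ->
  (forall a b x y, a ∈ ZZ -> b ∈ ZZ -> x ∈ ZZ -> y ∈ ZZ -> Q x -> Q y ->
     Q (zadd (zmul a x) (zmul b y))) ->
  (exists x, x ∈ ZZ /\ Q x /\ x <> z0) ->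
  exists d, d ∈ ZZ /\ Q d /\ d <> z0 /\
    forall x, x ∈ ZZ -> Q x -> exists z, z ∈ ZZ /\ x = zmul z d.
Proof.
move=> D C [x0 [Hx0 [Qx0 N0]]].
have Neg x : x ∈ ZZ -> Q x -> Q (zneg x).
  move=> Hx Qx; have -> : zneg x = zadd (zmul (zneg z1) x) (zmul z0 x) by zring.
  exact: C.
have [d [Hd [[d0 Qd] Min]]] : exists d, d ∈ omega /\ (d <> emp /\ Q (cl d emp)) /\
    forall m, m ∈ d -> ~ (m <> emp /\ Q (cl m emp)).
{ apply: nat_least => //.
  case: (int_sign _ Hx0) => k [Hk [E|E]]; exists k; split=> //; split.
  - by move=> K; apply: N0; rewrite E K.
  - by rewrite -E.
  - by move=> K; apply: N0; rewrite E K zneg_cl.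
  - have -> : cl k emp = zneg x0; last exact: Neg.
    by rewrite E !zneg_cl. }
exists (cl d emp); split; first exact: cl_in.
split=> //; split; first by move=> /(cl_eq0 _ Hd).
have A a : a ∈ omega -> Q (cl a emp) -> exists q, q ∈ omega /\ cl a emp = zmul (cl q emp) (cl d emp).
{ move=> Ha Qa; case: (nat_euclid _ _ Ha Hd d0) => q [r [Hq [Hr E]]].
  have Hr' := omega_trans _ Hd _ Hr.
  have Hc k : k ∈ omega -> cl k emp ∈ ZZ by move=> Hk; apply: cl_in.
  have F : cl a emp = zadd (zmul (cl q emp) (cl d emp)) (cl r emp) by rewrite E cl_euclid.
  have Qr : Q (cl r emp).
    have -> : cl r emp = zadd (zmul z1 (cl a emp)) (zmul (zneg (cl q emp)) (cl d emp)).
      have K := Hc _ Hr'; have K2 := Hc _ Hq; rewrite F; zring.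
    by apply: C; auto.
  have r0 : r = emp by apply: NNPP => K; apply: (Min _ Hr).
  exists q; split=> //; rewrite F r0 -/z0; zring. }
move=> x Hx Qx; case: (int_sign _ Hx) => k [Hk [E|E]].
- case: (A k Hk); first by rewrite -E.
  by move=> q [Hq F]; exists (cl q emp); split; [exact: cl_in|rewrite E].
- case: (A k Hk).
  { have -> : cl k emp = zneg x by rewrite E !zneg_cl.
    exact: Neg. }
  move=> q [Hq F]; exists (zneg (cl q emp)); split=> //; rewrite E F; zring.
Qed.

(** Nonnegative [m] goes to [2m] and [-(m+1)] to [2m+1]; parity keeps the two cases apart. *)
Lemma inj_ZZ_omega : inj ZZ omega.
Proof.
set Q := fun z k => (exists m, m ∈ omega /\ z = cl m emp /\ k = nadd m m) \/
                    (exists m, m ∈ omega /\ z = cl emp (sc m) /\ k = sc (nadd m m)).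
have DQ : Dp (fun e => Q (e 0) (e 1)) by rewrite /Q; dd.
have Qex z : z ∈ ZZ -> exists k, k ∈ omega /\ Q z k.
{ move=> /int_sign [k [Hk [->|->]]].
  - by exists (nadd k k); split=> //; left; exists k.
  - rewrite zneg_cl //; case: (omega_case _ Hk) => [->|[m [Hm ->]]].
    + by exists (nadd emp emp); split=> //; left; exists emp.
    + by exists (sc (nadd m m)); split; [auto|right; exists m]. }
have C1 m n : m ∈ omega -> n ∈ omega -> cl m emp <> cl emp (sc n).
{ move=> Hm Hn /cl_eq; rewrite nadd_S // => H; apply: (sc_not_emp (nadd m n)).
  rewrite H ?nadd_0 ?nn_id //; auto. }
have C2 m n : m ∈ omega -> n ∈ omega -> cl emp (sc m) = cl emp (sc n) -> m = n.
{ move=> Hm Hn /cl_eq; rewrite !nadd_0l !nn_id; auto => H; symmetry; apply: sc_inj; auto. }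
have C3 m n : m ∈ omega -> n ∈ omega -> cl m emp = cl n emp -> m = n.
{ by move=> Hm Hn /cl_eq; rewrite !nadd_0 !nn_id; auto. }
have I m : m ∈ omega -> forall n, n ∈ omega -> nadd m m = nadd n n -> m = n.
{ move: m; apply: omega_ind => //.
  - move=> n Hn; case: (omega_case _ Hn) => [-> //|[k [Hk ->]]].
    by rewrite nadd_0 nn_id // nadd_S // => H; case: (sc_not_emp _ (eq_sym H)).
  - move=> m Hm IH n Hn; case: (omega_case _ Hn) => [->|[k [Hk ->]]].
    + by rewrite nadd_0 nn_id // nadd_S // => /sc_not_emp.
    + rewrite !nadd_S ?nadd_Sl // => /(sc_inj _ _ (omega_sc _ (nadd_in _ _)) (omega_sc _ (nadd_in _ _))).
      by move=> /(sc_inj _ _ (nadd_in _ _) (nadd_in _ _)) /(IH _ Hk) ->. }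
have Qun z k k' : Q z k -> Q z k' -> k = k'.
{ move=> [[m [Hm [-> ->]]]|[m [Hm [-> ->]]]] [[n [Hn [E ->]]]|[n [Hn [E ->]]]].
  - by rewrite (C3 _ _ Hm Hn E).
  - by case: (C1 _ _ Hm Hn E).
  - by case: (C1 _ _ Hn Hm).
  - by rewrite (C2 _ _ Hm Hn E). }
have T z : z ∈ ZZ -> the (Q z) ∈ omega /\ Q z (the (Q z)).
{ move=> Hz; case: (Qex _ Hz) => k [Hk K]; rewrite (the_eq _ k) // => k' K'; exact: (Qun z). }
apply: (inj_intro _ _ (fun z => the (Q z))) => //.
- by move=> z /T [].
- move=> z z' /T [_ K] /T [_ K'] E; move: K'; rewrite -E {E}.
  case: K => [[m [Hm [-> ->]]]|[m [Hm [-> ->]]]] [[n [Hn [-> E]]]|[n [Hn [-> E]]]].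
  + by rewrite (I _ Hm _ Hn E).
  + by case: (nat_parity _ _ Hm Hn E).
  + by case: (nat_parity _ _ Hn Hm); rewrite E.
  + by move/(sc_inj _ _ (nadd_in _ _) (nadd_in _ _)): E => /(I _ Hm _ Hn) ->.
Qed.

Definition zsum (c n : M) : M := nrec z0 (fun k v => zadd v (app c k)) n.

Lemma zsum_0 c : zsum c emp = z0.
Proof. by rewrite /zsum nrec_0. Qed.

Lemma zsum_S c n : n ∈ omega -> zsum c (sc n) = zadd (zsum c n) (app c n).
Proof. by move=> Hn; rewrite /zsum nrec_S. Qed.

Lemma Dt_zsum s t : Dt s -> Dt t -> Dt (fun e : nat -> M => zsum (s e) (t e)).
Proof. by apply: Dt_app2; rewrite /zsum; dd. Qed.

End IntegerDomain.

Ltac dbase6 := fail.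
Ltac dbase5 ::=
  lazymatch goal with
  | |- Dt (fun e => zsum _ _) => apply: Dt_zsum
  | _ => dbase6
  end.

Section Sums.
Context {M : set_structure} {HM : Model M}.
Add Ring int_ring : (@int_ring M HM) (setoid (@eqZ_equiv M HM) (@int_ring_ext M HM)).

Lemma zsum_in (c n : M) : n ∈ omega -> zsum c n ∈ ZZ.
Proof.
move=> Hn; case: (omega_case _ Hn) => [->|[k [Hk ->]]]; first by rewrite zsum_0.
by rewrite zsum_S.
Qed.

Lemma zsum_ext (c c' n : M) : n ∈ omega -> (forall k, k ∈ n -> app c k = app c' k) ->
  zsum c n = zsum c' n.
Proof.
move: n; apply: omega_ind => //; first by rewrite !zsum_0.
move=> n Hn IH H; rewrite !zsum_S // IH ?H //; first by apply/in_sc; right.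
by move=> k Hk; apply: H; apply/in_sc; left.
Qed.

Lemma zsum_linear (c c1 c2 a b n : M) : n ∈ omega ->
  (forall k, k ∈ n -> app c k = zadd (zmul a (app c1 k)) (zmul b (app c2 k))) ->
  zsum c n = zadd (zmul a (zsum c1 n)) (zmul b (zsum c2 n)).
Proof.
move: n; apply: omega_ind => //; first by move=> _; rewrite !zsum_0; zring.
move=> n Hn IH H; have H' k : k ∈ n -> app c k = zadd (zmul a (app c1 k)) (zmul b (app c2 k)).
  by move=> Hk; apply: H; apply/in_sc; left.
rewrite !zsum_S // IH // H; last by apply/in_sc; right.
zring.
Qed.

Lemma zsum_stable (c n m : M) : n ∈ omega -> m ∈ omega -> subset n m ->
  (forall k, k ∈ m -> ~ k ∈ n -> app c k = z0) -> zsum c m = zsum c n.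
Proof.
move=> Hn; move: m; apply: omega_ind => //.
- move=> S _; case: (omega_case _ Hn) => [-> //|[k [Hk E]]].
  by case: (in_emp emp); apply: S; rewrite E; apply: emp_in_sc.
- move=> m Hm IH S H; case: (nat_total _ (omega_sc _ Hm) _ Hn) => [K|[-> //|K]].
  + have S' : subset n m.
      by move/in_sc: K => [K|-> //] x; apply: nat_trans.
    have N : ~ m ∈ n by move=> /S'; apply: nat_irrefl.
    rewrite zsum_S // IH ?H //.
    * by have := zsum_in c n Hn => ?; zring.
    * by apply/in_sc; right.
    * by move=> k L; apply: H; apply/in_sc; left.
  + by case: (nat_irrefl (sc m)); auto.
Qed.

End Sums.

(** * Well-ordered choice and cardinal arithmetic *)

Section Choice.
Context {M : set_structure} {HM : Model M}.
Implicit Types (A B x y z f a b : M).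

Lemma the_ext (P Q : M -> Prop) : (forall x, P x <-> Q x) -> the P = the Q.
Proof.
move=> H; case: (classic (exists! x, P x)) => [[x [K U]]|N].
- rewrite (the_eq P x) //; last by move=> y /U.
  by symmetry; apply: the_eq; [apply/H|move=> y /H /U].
- rewrite !the_default // => -[x [K U]]; apply: N; exists x; split; first by apply/H.
  by move=> y /H /U.
Qed.

Lemma equipotent_sym A B : equipotent A B -> inj B A.
Proof.
move=> [f [/[dup] [[Hf _]] /is_inj_elim [f1 f2] f3]].
have S b : b ∈ B -> exists a, a ∈ A /\ app f a = b.
  by move=> /f3 [a /(rel_app _ _ _ _ _ Hf) [Ha ->]]; exists a.
have T b : b ∈ B -> the (fun a => a ∈ A /\ app f a = b) ∈ A /\ app f (the (fun a => a ∈ A /\ app f a = b)) = b.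
{ move=> Hb; case: (S _ Hb) => a [Ha E]; apply: (the_spec (fun a => a ∈ A /\ app f a = b)).
  by exists a; split=> // c [Hc E']; apply: f2 => //; rewrite E. }
apply: (inj_intro _ _ (fun b => the (fun a => a ∈ A /\ app f a = b))) => //.
- by move=> b /T [].
- by move=> b c /T [_ E] /T [_ E'] K; rewrite -E K.
Qed.

Definition least_principle L : Prop := forall P : M -> Prop, Dp (fun e => P (e 0)) ->
  (exists a, a ∈ L /\ P a) -> exists a, a ∈ L /\ P a /\ forall b, b ∈ L -> P b -> a = b \/ a ∈ b.

Lemma ordinal_least L : ordinal L -> least_principle L.
Proof.
move=> [_ [_ [_ [_ W]]]] P D [a [Ha Pa]].
have S x : x ∈ sep L P <-> x ∈ L /\ P x by apply: in_sep.
case: (W (sep L P)) => [x /S [] //||x [/S [Hx Px] K]]; first by exists a; apply/S.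
by exists x; do 2 split=> //; move=> b Hb Pb; apply: K; apply/S.
Qed.

(** The substitute for choice: along an injection [f] of [A] into an ordinal, the candidate with the
    least image is selected definably. *)
Definition pick f A (P : M -> Prop) : M :=
  the (fun x => x ∈ A /\ P x /\ forall y, y ∈ A -> P y -> app f x = app f y \/ app f x ∈ app f y).

Lemma Dt_pick f A (P : (nat -> M) -> M -> Prop) :
  Dp (fun e => P (fun n => e (S n)) (e 0)) -> Dt (fun e => pick f A (P e)).
Proof.
move=> H; rewrite /pick.
have H1 : Dp (fun e => P (fun n => e (S (S n))) (e 0)).
  exact: (Dp_ren (fun n => match n with 0 => 0 | S k => S (S k) end) _ H).
dd.
Qed.

Lemma pick_spec f A L (P : M -> Prop) : ordinal L -> is_inj f A L -> Dp (fun e => P (e 0)) ->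
  (exists x, x ∈ A /\ P x) -> pick f A P ∈ A /\ P (pick f A P).
Proof.
move=> /[dup] OL /ordinal_least W /is_inj_elim [f1 f2] D [x [Hx Px]].
case: (W (fun a => exists x, x ∈ A /\ P x /\ a = app f x)) => //.
  by exists (app f x); split; [exact: f1|exists x].
move=> a [Ha [[z [Hz [Pz E]]] Min]].
have -> : pick f A P = z.
{ apply: the_eq.
  - by do 2 split=> //; move=> y Hy Py; rewrite -E; apply: Min; auto; exists y.
  - move=> y [Hy [Py K]]; apply: f2 => //.
    case: OL => _ [I [T _]].
    case: (K _ Hz Pz) => // K1; case: (Min (app f y)); auto; [by exists y|by rewrite -E|].
    by rewrite E => K2; case: (I (app f y)); auto; apply: (T _ (app f z)); auto. }
by [].
Qed.

(** Inverting a surjection takes choice in general; the well-ordering that [A] inherits from [L]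
    supplies the least preimage. *)
Lemma inj_image A B L (F : M -> M) : ordinal L -> inj A L -> Dt (fun e => F (e 0)) ->
  (forall b, b ∈ B -> exists a, a ∈ A /\ b = F a) -> inj B A.
Proof.
move=> OL [f Hf] DF S.
have T b : b ∈ B -> pick f A (fun a => b = F a) ∈ A /\ b = F (pick f A (fun a => b = F a)).
  by move=> Hb; apply: (pick_spec f A L) => //; apply: S.
apply: (inj_intro _ _ (fun b => pick f A (fun a => b = F a))).
- apply: (Dt_pick f A (fun e a => e 0 = F a)); dd.
- by move=> b /T [].
- by move=> b c /T [_ E] /T [_ E'] K; rewrite E E' K.
Qed.

End Choice.

(* W embeds in L by sending each point to the least element of L not yet used. *)
Section Greedy.
Context {M : set_structure} {HM : Model M}.
Variables (L K W : M) (lt : M -> M -> Prop).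
Hypotheses (OL : ordinal L) (NLK : ~ inj L K).
Hypothesis Dlt : Dp (fun e => lt (e 0) (e 1)).
Hypothesis lt_irr : forall w, ~ lt w w.
Hypothesis lt_trans : forall w1 w2 w3, lt w1 w2 -> lt w2 w3 -> lt w1 w3.
Hypothesis lt_total : forall w w', w ∈ W -> w' ∈ W -> w = w' \/ lt w w' \/ lt w' w.
Hypothesis lt_ind : forall P : M -> Prop, Dp (fun e => P (e 0)) ->
  (forall w, w ∈ W -> (forall w', w' ∈ W -> lt w' w -> P w') -> P w) ->
  forall w, w ∈ W -> P w.
Hypothesis lt_seg : forall w, w ∈ W -> inj (sep W (fun w' => lt w' w)) K.

Let fresh g w c : Prop := forall v, v ∈ W -> lt v w -> app g v <> c.
Let nxt g w : M := the (fun c => c ∈ L /\ fresh g w c /\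
  forall d, d ∈ L -> fresh g w d -> c = d \/ c ∈ d).
Let attempt g w : Prop := forall v, v ∈ W -> v = w \/ lt v w -> app g v = nxt g v.

Let Dfresh s t u : Dt s -> Dt t -> Dt u -> Dp (fun e => fresh (s e) (t e) (u e)).
Proof. apply: Dp_app3; rewrite /fresh; dd. Qed.

Let Dnxt s t : Dt s -> Dt t -> Dt (fun e => nxt (s e) (t e)).
Proof. apply: Dt_app2; rewrite /nxt; dd; apply: Dfresh; dd. Qed.

Let Datt s t : Dt s -> Dt t -> Dp (fun e => attempt (s e) (t e)).
Proof. apply: Dp_app2; rewrite /attempt; dd; apply: Dnxt; dd. Qed.

Let nxt_ext g g' w : (forall v, v ∈ W -> lt v w -> app g v = app g' v) -> nxt g w = nxt g' w.
Proof.
move=> H.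
have F c : fresh g w c <-> fresh g' w c.
  by split=> E v Hv lv; [rewrite -H|rewrite H] => //; apply: E.
apply: the_ext => c; rewrite F; split=> -[Hc [E Min]]; do 2 split=> //; move=> d Hd /F; exact: Min.
Qed.

Let attempt_le g w v : attempt g w -> v = w \/ lt v w -> attempt g v.
Proof.
move=> A [-> //|l]; rewrite /attempt => u Hu l'; apply: A => //; right.
by case: l' => [-> //|l']; apply: lt_trans l.
Qed.

Let attempt_uniq g g' w : w ∈ W -> attempt g w -> attempt g' w -> app g w = app g' w.
Proof.
move=> Hw A A'.
enough (H : forall v, v ∈ W -> (v = w \/ lt v w) -> app g v = app g' v) by (apply: H => //; left; reflexivity).
apply: lt_ind; first by dd.
move=> v Hv IH l; rewrite A // A' //; apply: nxt_ext => u Hu lu; apply: IH => //; right.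
by case: l => [<- //|]; apply: lt_trans.
Qed.

Let F w : M := the (fun c => exists g, attempt g w /\ c = app g w).

Let DF s : Dt s -> Dt (fun e => F (s e)).
Proof. apply: Dt_app1; rewrite /F; dd; apply: Datt; dd. Qed.

Let F_attempt g w : w ∈ W -> attempt g w -> F w = app g w.
Proof.
move=> Hw A; apply: the_eq; first by exists g.
by move=> c [g' [A' ->]]; apply: attempt_uniq.
Qed.

(** Attempts at smaller points agree where both are determined, so they glue to [F]; only the value
    at [w] has to be added. *)
Let attempt_ex w : w ∈ W -> exists g, attempt g w.
Proof.
move: w; apply: lt_ind; first by dd; apply: Datt; dd.
move=> w Hw IH.
have D : Dt (fun e => ite (e 0 = w) (nxt (lam W F) w) (F (e 0))) by dd; apply: DF; dd.
have DF0 : Dt (fun e => F (e 0)) by apply: DF; dd.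
exists (lam W (fun v => ite (v = w) (nxt (lam W F) w) (F v))) => v Hv l.
have E u : u ∈ W -> lt u w -> app (lam W (fun v => ite (v = w) (nxt (lam W F) w) (F v))) u = F u.
  by move=> Hu lu; rewrite app_lam // ite_false // => H; subst u; apply: (lt_irr w).
case: l => [->|l].
- rewrite app_lam // ite_true //; apply: nxt_ext => u Hu lu.
  by rewrite E // app_lam.
- rewrite E //; case: (IH _ Hv l) => g A; rewrite (F_attempt g) // A //; last by left.
  apply: nxt_ext => u Hu lu; rewrite E //; last exact: lt_trans l.
  by symmetry; apply: F_attempt => //; apply: (attempt_le g v) => //; right.
Qed.

Let F_spec w : w ∈ W -> F w ∈ L /\ forall v, v ∈ W -> lt v w -> F v <> F w.
Proof.
move: w; apply: lt_ind; first by dd; apply: DF; dd.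
move=> w Hw IH.
have DF0 : Dt (fun e => F (e 0)) by apply: DF; dd.
case: (attempt_ex _ Hw) => g A.
have EF v : v ∈ W -> v = w \/ lt v w -> app g v = F v.
  by move=> Hv l; symmetry; apply: F_attempt => //; apply: attempt_le l.
have Ew : F w = nxt g w by rewrite -EF; auto.
(* If all of [L] were used up below [w], sending each element to the point that used it would embed
   [L] in the segment below [w], hence in [K]. *)
have [c [Hc Fc]] : exists c, c ∈ L /\ fresh g w c.
{ apply: NNPP => N.
  have Sg v : v ∈ sep W (fun w' => lt w' w) <-> v ∈ W /\ lt v w by apply: in_sep.
  have J v v' : v ∈ W -> v' ∈ W -> lt v w -> lt v' w -> F v = F v' -> v = v'.
  { move=> Hv Hv' l l' E; case: (lt_total _ _ Hv Hv') => [//|[K1|K1]].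
    - by case: (IH _ Hv' l') => _ /(_ _ Hv K1).
    - by case: (IH _ Hv l) => _ /(_ _ Hv' K1) []. }
  have T c : c ∈ L -> let v := the (fun v => v ∈ W /\ lt v w /\ F v = c) in v ∈ W /\ lt v w /\ F v = c.
  { move=> Hc; apply: (the_spec (fun v => v ∈ W /\ lt v w /\ F v = c)).
    have [v [Hv [l E]]] : exists v, v ∈ W /\ lt v w /\ F v = c.
    { apply: NNPP => N'; apply: N; exists c; split=> // v Hv l E; apply: N'; exists v.
      by rewrite -EF; auto. }
    by exists v; split=> // v' [Hv' [l' E']]; apply: J => //; rewrite E. }
  apply: NLK; apply: (inj_trans _ (sep W (fun w' => lt w' w))); last exact: lt_seg.
  apply: (inj_intro _ _ (fun c => the (fun v => v ∈ W /\ lt v w /\ F v = c))).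
  - by dd; apply: DF; dd.
  - by move=> d /T [? [? _]]; apply/Sg.
  - by move=> d d' /T [_ [_ E]] /T [_ [_ E']] Q; rewrite -E Q. }
have [a [Ha [Fa Min]]] : exists a, a ∈ L /\ fresh g w a /\ forall b, b ∈ L -> fresh g w b -> a = b \/ a ∈ b.
  apply: (ordinal_least _ OL); last by exists c.
  by apply: Dfresh; dd.
have En : nxt g w = a.
{ apply: the_eq => // d [Hd [Fd Min']].
  case: (Min' _ Ha Fa) => // K1; case: (Min _ Hd Fd) => // K2.
  by case: OL => _ [I [T _]]; case: (I _ Ha); apply: (T _ d). }
rewrite Ew En; split=> // v Hv l E; apply: (Fa v) => //; by rewrite EF; auto.
Qed.

Lemma greedy_inj : inj W L.
Proof.
apply: (inj_intro _ _ F); first by apply: DF; dd.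
- by move=> w /F_spec [].
- move=> w w' Hw Hw' E; case: (lt_total _ _ Hw Hw') => [//|[l|l]].
  + by case: (F_spec _ Hw') => _ /(_ _ Hw l).
  + by case: (F_spec _ Hw) => _ /(_ _ Hw' l) [].
Qed.

End Greedy.

(** * Arithmetic of a true successor cardinal *)

Section Lambda.
Context {M : set_structure} {HM : Model M}.
Variables (lambda mu : M).
Hypothesis hsucc : succ_cardinal lambda mu.
Hypothesis htrue : true_succ_cardinal lambda.
Hypothesis hpow : eq_pow_aleph0 mu.
Implicit Types (a b c x y : M).

Let OL : ordinal lambda. Proof. by case: hsucc => _ [[]]. Qed.
Let mul : mu ∈ lambda. Proof. by case: hsucc => _ [_ []]. Qed.
Let l_trans a b : a ∈ lambda -> b ∈ a -> b ∈ lambda.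
Proof. by move=> Ha Hb; apply: (proj1 OL _ Ha). Qed.
Let l_trans3 a b c : a ∈ lambda -> b ∈ a -> c ∈ b -> c ∈ a.
Proof.
move=> Ha Hb Hc; case: OL => _ [_ [T _]].
by have Hb' := l_trans _ _ Ha Hb; have Hc' := l_trans _ _ Hb' Hc; apply: (T c b a).
Qed.
Let l_irr a : a ∈ lambda -> ~ a ∈ a. Proof. by case: OL => _ [I _]; apply: I. Qed.
Let l_total a b : a ∈ lambda -> b ∈ lambda -> a ∈ b \/ a = b \/ b ∈ a.
Proof. by case: OL => _ [_ [_ [T _]]]; apply: T. Qed.

Lemma omega_sub_mu : subset omega mu.
Proof. by case: hsucc => -[_ [[w [/is_omega_eq -> //]]]]. Qed.

Let mu_sub : subset mu lambda. Proof. by move=> x; apply: l_trans. Qed.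

Lemma omega_sub_lambda : subset omega lambda.
Proof. by move=> x /omega_sub_mu /mu_sub. Qed.

Let no_inj : ~ inj lambda mu.
Proof.
move=> H; have E : equipotent mu lambda by apply: bernstein => //; apply: inj_subset.
case: hsucc => _ [[_ [_ N]] _]; exact: (N mu mul E).
Qed.

(** [true_succ_cardinal] names a predecessor of its own, to be identified with [mu]. *)
Let pred_unique m : succ_cardinal lambda m -> m = mu.
Proof.
move=> [Cm [_ [Hm Lm]]]; case: hsucc => Cmu [_ [Hmu Lmu]].
case: (l_total _ _ Hm Hmu) => [H|[//|H]].
- by case: (l_irr mu) => //; apply: Lm.
- by case: (l_irr m) => //; apply: Lmu.
Qed.

(** This is what a true successor offers: one set holds embeddings of all ordinals in [[mu, lambda)]
    simultaneously, so [fe a] depends definably on [a]. *)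
Let embeddings : exists fe : M -> M -> M, Dt (fun e => fe (e 0) (e 1)) /\
  (forall a x, a ∈ lambda -> subset mu a -> x ∈ a -> fe a x ∈ mu) /\
  (forall a x y, a ∈ lambda -> subset mu a -> x ∈ a -> y ∈ a -> fe a x = fe a y -> x = y).
Proof.
case: htrue => m [/pred_unique -> [I [F [C [HI [HF Hf]]]]]].
have K a : a ∈ lambda -> subset mu a -> is_inj (app F a) a mu.
  by move=> Ha Sa; apply: Hf; apply/(rel_app _ _ _ _ _ HF); split=> //; apply/HI.
exists (fun a x => app (app F a) x); split=> //; split.
- by move=> a x Ha Sa; case/is_inj_elim: (K _ Ha Sa) => + _; apply.
- by move=> a x y Ha Sa; case/is_inj_elim: (K _ Ha Sa) => _; apply.
Qed.

Let seq_inj_mu : inj (funs omega mu) mu.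
Proof.
case: hpow => w [P [/is_omega_eq -> [HP /equipotent_sym]]].
have -> // : P = funs omega mu by apply: ext => f; rewrite (HP f) in_funs.
Qed.

Let emp_mu : emp ∈ mu. Proof. exact/omega_sub_mu. Qed.
Let none_mu : none ∈ mu. Proof. exact/omega_sub_mu. Qed.

Let none_emp : none <> emp. Proof. exact: sc_not_emp. Qed.

(** The pair [(x, y)] is coded by the sequence [x, y, y, ...], an element of [mu^omega]. *)
Let prod_mu : inj (prod mu mu) mu.
Proof.
apply: inj_trans seq_inj_mu.
set F := fun q => lam omega (fun n => ite (n = emp) (pr1 q) (pr2 q)).
have A q n : n ∈ omega -> app (F q) n = ite (n = emp) (pr1 q) (pr2 q) by move=> Hn; rewrite app_lam.
apply: (inj_intro _ _ F); first by rewrite /F; dd.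
- move=> q /in_prod [x [y [Hx [Hy ->]]]]; apply: lam_funs => // n Hn.
  by rewrite pr1_opair pr2_opair /ite; case: (decide _).
- move=> p q /in_prod [x [y [Hx [Hy Ep]]]] /in_prod [x' [y' [Hx' [Hy' Eq]]]] E.
  have := A p emp omega_emp; have := A p none none_in; rewrite E !A // !(ite_true (emp = emp)) //.
  rewrite !(ite_false (none = emp)) // Ep Eq !pr1_opair !pr2_opair => -> -> //.
Qed.

Lemma pow_omega_inj : inj (pow omega) lambda.
Proof.
apply: (inj_trans _ _ _ _ (inj_subset _ _ mu_sub)); apply: inj_trans seq_inj_mu.
set F := fun b => lam omega (fun n => ite (n ∈ b) none emp).
have A q n : n ∈ omega -> app (F q) n = ite (n ∈ q) none emp by move=> Hn; rewrite app_lam.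
apply: (inj_intro _ _ F); first by rewrite /F; dd.
- by move=> b Hb; apply: lam_funs => // n Hn; rewrite /ite; case: (decide _).
- move=> b c /in_pow Hb /in_pow Hc E; apply: ext => n.
  have H : n ∈ omega -> (n ∈ b <-> n ∈ c).
    move=> Hn; have := A b n Hn; rewrite E A // /ite.
    by case: (decide _) => K1; case: (decide _) => K2 K; try tauto; case: none_emp; congruence.
  by split=> K; apply/(H _); auto.
Qed.

Lemma seq_ZZ_inj : inj (funs omega ZZ) lambda.
Proof.
apply: (inj_trans _ _ _ _ (inj_subset _ _ mu_sub)); apply: inj_trans seq_inj_mu.
case: inj_ZZ_omega => f /is_inj_elim [f1 f2].
set F := fun c => lam omega (fun n => app f (app c n)).
have A q n : n ∈ omega -> app (F q) n = app f (app q n) by move=> Hn; rewrite app_lam.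
apply: (inj_intro _ _ F); first by rewrite /F; dd.
- move=> c Hc; apply: lam_funs => // n Hn; apply/omega_sub_mu/f1; exact: app_funs Hc Hn.
- move=> c d Hc Hd E; apply: (funs_ext _ _ _ _ _ Hc Hd) => n Hn; apply: f2; [exact: app_funs Hc Hn|exact: app_funs Hd Hn|].
  by rewrite -!A // E.
Qed.

Let prod_inj A B A' B' : inj A A' -> inj B B' -> inj (prod A B) (prod A' B').
Proof.
move=> [f /is_inj_elim [f1 f2]] [g /is_inj_elim [g1 g2]].
apply: (inj_intro _ _ (fun q => opair (app f (pr1 q)) (app g (pr2 q)))) => //.
- by move=> q /in_prod [x [y [Hx [Hy ->]]]]; rewrite in_prod_opair pr1_opair pr2_opair; auto.
- move=> p q /in_prod [x [y [Hx [Hy ->]]]] /in_prod [x' [y' [Hx' [Hy' ->]]]].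
  by rewrite !pr1_opair !pr2_opair => /opair_inj [/f2 -> // /g2 -> //].
Qed.

(** Otherwise [lambda] would be [a] with one more point on top. Since [a] embeds in [mu], tagging
    the extra point with [none] and the rest with [emp] would embed [lambda] in [mu x mu], hence in
    [mu]. *)
Let up a : a ∈ lambda -> exists c, c ∈ lambda /\ a ∈ c /\ subset mu c.
Proof.
move=> Ha; apply: NNPP => N; apply: no_inj.
have Sa : subset mu a.
  case: (l_total _ _ Ha mul) => [H|[<- //|H]]; first by case: N; exists mu; do 2 split=> //; move=> x.
  by move=> x; apply: l_trans3.
have K b : b ∈ lambda -> b <> a -> b ∈ a.
  move=> Hb E; case: (l_total _ _ Hb Ha) => [//|[//|H]]; case: N; exists b; do 2 split=> //.
  by move=> x /Sa; apply: l_trans3 H.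
case: embeddings => fe [Df [f1 f2]]; apply: inj_trans prod_mu.
apply: (inj_intro _ _ (fun b => ite (b = a) (opair none none) (opair emp (fe a b)))).
- by dd.
- move=> b Hb; rewrite /ite; case: (decide _) => E; apply/in_prod_opair; auto.
- move=> b c Hb Hc; rewrite /ite; case: (decide _) => E1; case: (decide _) => E2; try congruence.
  + by move=> /opair_inj [/none_emp].
  + by move=> /opair_inj [H _]; case: none_emp.
  + by move=> /opair_inj [_]; apply: f2; auto.
Qed.

(** In the lexicographic order the segment below [(x, y)] lies in [c x mu] for some [c] above [x],
    and [fe c] carries it into [mu x mu]; so the greedy embedding applies. On [lambda x lambda]
    lexicographic segments can be as large as [lambda], hence the detour taken by [prod_lambda]. *)
Let lex_inj : inj (prod lambda mu) lambda.
Proof.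
(* Membership of the coordinates is built in because [greedy_inj] asks for irreflexivity and
   transitivity on all of [M]. *)
set lt := fun p q => pr1 p ∈ lambda /\ pr2 p ∈ mu /\ pr1 q ∈ lambda /\ pr2 q ∈ mu /\
  (pr1 p ∈ pr1 q \/ (pr1 p = pr1 q /\ pr2 p ∈ pr2 q)).
have Dlt : Dp (fun e => lt (e 0) (e 1)) by rewrite /lt; dd.
apply: (greedy_inj lambda mu (prod lambda mu) lt OL no_inj) => //.
- move=> w [H1 [H2 [_ [_ [H|[_ H]]]]]]; [exact: (l_irr _ H1)|exact: (l_irr _ (mu_sub _ H2))].
- move=> u v w [H1 [H2 [H3 [H4 H]]]] [_ [_ [K3 [K4 K]]]]; do 4 split=> //.
  case: H K => [H|[E H]] [K|[F K]].
  + by left; apply: l_trans3 K H.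
  + by left; rewrite -F.
  + by left; rewrite E.
  + by right; split; [rewrite E|apply: l_trans3 K H; apply: mu_sub].
- move=> p q /in_prod [x [y [Hx [Hy ->]]]] /in_prod [x' [y' [Hx' [Hy' ->]]]].
  rewrite /lt !pr1_opair !pr2_opair.
  case: (l_total _ _ Hx Hx') => [H|[<-|H]]; [by right; left; do 4 split=> //; left| |by right; right; do 4 split=> //; left].
  case: (l_total _ _ (mu_sub _ Hy) (mu_sub _ Hy')) => [H|[<-|H]]; [|by left|].
  + by right; left; do 4 split=> //; right.
  + by right; right; do 4 split=> //; right.
- move=> P DP IH w Hw; apply: NNPP => N.
  have W : least_principle lambda by exact: ordinal_least.
  case/in_prod: Hw N => [x0 [y0 [Hx0 [Hy0 ->]]]] N0.
  case: (W (fun x => exists y, y ∈ mu /\ ~ P (opair x y))); first by dd.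
    by exists x0; split=> //; exists y0.
  move=> x [Hx [[y1 [Hy1 N1]] Min]].
  case: (W (fun y => y ∈ mu /\ ~ P (opair x y))); first by dd.
    by exists y1; split=> //; apply: mu_sub.
  move=> y [Hy' [[Hy N] Min']]; apply: N; apply: IH; first by apply/in_prod_opair.
  move=> q /in_prod [x' [y' [Hx' [Hy'2 ->]]]]; rewrite /lt !pr1_opair !pr2_opair.
  move=> [_ [_ [_ [_ H]]]]; apply: NNPP => N.
  case: H => [H|[E H]].
  + case: (Min _ Hx'); first by exists y'.
    * by move=> E; subst x'; apply: (l_irr x).
    * by move=> K; apply: (l_irr x) => //; apply: l_trans3 H K.
  + subst x'; case: (Min' _ (mu_sub _ Hy'2)) => //.
    * by move=> E; subst y'; apply: (l_irr y).
    * by move=> K; apply: (l_irr y) => //; apply: l_trans3 H K.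
- move=> w /in_prod [x [y [Hx [Hy ->]]]].
  case: (up _ Hx) => c [Hc [xc Sc]]; case: embeddings => fe [Df [f1 f2]].
  have S q : q ∈ sep (prod lambda mu) (fun q => lt q (opair x y)) <->
             q ∈ prod lambda mu /\ lt q (opair x y) by apply: in_sep.
  have C q : q ∈ sep (prod lambda mu) (fun q => lt q (opair x y)) ->
     exists a b, q = opair a b /\ a ∈ c /\ b ∈ mu.
  { move=> /S [/in_prod [a [b [Ha [Hb ->]]]]]; rewrite /lt !pr1_opair !pr2_opair.
    move=> [_ [_ [_ [_ H]]]]; exists a, b; do 2 split=> //.
    by case: H => [H|[-> _]] //; apply: l_trans3 xc H. }
  apply: inj_trans prod_mu.
  apply: (inj_intro _ _ (fun q => opair (fe c (pr1 q)) (pr2 q))); first by dd.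
  + move=> q /C [a [b [-> [Ha Hb]]]]; rewrite pr1_opair pr2_opair in_prod_opair; auto.
  + move=> p q /C [a [b [-> [Ha Hb]]]] /C [a' [b' [-> [Ha' Hb']]]].
    by rewrite !pr1_opair !pr2_opair => /opair_inj [/f2 -> // ->].
Qed.

(** A pair is coded by the least [c] above both components that includes [mu], together with their
    images under the embedding of [c] in [mu]. The code lies in [lambda x (mu x mu)]. *)
Lemma prod_lambda : inj (prod lambda lambda) lambda.
Proof.
case: embeddings => fe [Df [f1 f2]]; have W : least_principle lambda by exact: ordinal_least.
have U a b : a ∈ lambda -> b ∈ lambda -> exists c, c ∈ lambda /\ (a ∈ c /\ b ∈ c /\ subset mu c) /\
    forall d, d ∈ lambda -> (a ∈ d /\ b ∈ d /\ subset mu d) -> c = d \/ c ∈ d.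
{ move=> Ha Hb; apply: W; first by dd.
  case: (l_total _ _ Ha Hb) => [H|[<-|H]].
  - case: (up _ Hb) => c [Hc [K S]]; exists c; do 2 split=> //; exact: l_trans3 K H.
  - by case: (up _ Ha) => c [Hc [K S]]; exists c.
  - case: (up _ Ha) => c [Hc [K S]]; exists c; do 3 split=> //; exact: l_trans3 K H. }
set g := fun a b => the (fun c => c ∈ lambda /\ (a ∈ c /\ b ∈ c /\ subset mu c) /\
    forall d, d ∈ lambda -> (a ∈ d /\ b ∈ d /\ subset mu d) -> c = d \/ c ∈ d).
have Dg : Dt (fun e => g (e 0) (e 1)) by rewrite /g; dd.
have G a b : a ∈ lambda -> b ∈ lambda -> g a b ∈ lambda /\ a ∈ g a b /\ b ∈ g a b /\ subset mu (g a b).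
{ move=> Ha Hb; case: (U _ _ Ha Hb) => c [Hc [K Min]].
  have -> : g a b = c; last by tauto.
  apply: the_eq => // d [Hd [K' Min']].
  case: (Min _ Hd K') => // H1; case: (Min' _ Hc K) => // H2.
  by case: (l_irr c) => //; apply: l_trans3 H2 H1. }
apply: (inj_trans _ (prod lambda (prod mu mu))).
- apply: (inj_intro _ _ (fun q => opair (g (pr1 q) (pr2 q))
    (opair (fe (g (pr1 q) (pr2 q)) (pr1 q)) (fe (g (pr1 q) (pr2 q)) (pr2 q))))); first by dd.
  + move=> q /in_prod [a [b [Ha [Hb ->]]]]; rewrite pr1_opair pr2_opair !in_prod_opair.
    by case: (G _ _ Ha Hb) => G1 [G2 [G3 G4]]; auto.
  + move=> p q /in_prod [a [b [Ha [Hb ->]]]] /in_prod [a' [b' [Ha' [Hb' ->]]]].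
    rewrite !pr1_opair !pr2_opair => /opair_inj [Eg /opair_inj []].
    case: (G _ _ Ha Hb) => G1 [G2 [G3 G4]]; case: (G _ _ Ha' Hb') => _ [G2' [G3' _]].
    rewrite -Eg in G2' G3' *; move=> E1 E2.
    by rewrite (f2 _ _ _ G1 G4 G2 G2' E1) (f2 _ _ _ G1 G4 G3 G3' E2).
- apply: inj_trans lex_inj; apply: prod_inj prod_mu; exact: inj_subset.
Qed.

Lemma inj_prod_lambda A B : inj A lambda -> inj B lambda -> inj (prod A B) lambda.
Proof. by move=> HA HB; apply: inj_trans prod_lambda; apply: prod_inj. Qed.

End Lambda.

(** * Countable free groups *)

Section Finite.
Context {M : set_structure} {HM : Model M}.
Implicit Types (x y z k n N X f : M).

Lemma Dp_equipotent s t : Dt s -> Dt t -> Dp (fun e : nat -> M => equipotent (s e) (t e)).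
Proof.
apply: Dp_app2; rewrite /equipotent /is_bij /is_inj; dd.
Qed.

Lemma equipotent_intro A B (F : M -> M) : Dt (fun e => F (e 0)) -> (forall x, x ∈ A -> F x ∈ B) ->
  (forall x y, x ∈ A -> y ∈ A -> F x = F y -> x = y) ->
  (forall y, y ∈ B -> exists x, x ∈ A /\ F x = y) -> equipotent A B.
Proof. by move=> D H1 H2 H3; exists (lam A F); apply: bij_intro. Qed.

Lemma equipotent_elim A B : equipotent A B -> exists F : M -> M, Dt (fun e => F (e 0)) /\
  (forall x, x ∈ A -> F x ∈ B) /\ (forall x y, x ∈ A -> y ∈ A -> F x = F y -> x = y) /\
  (forall y, y ∈ B -> exists x, x ∈ A /\ F x = y).
Proof.
move=> [f [/[dup] [[Hf _]] /is_inj_elim [f1 f2] f3]]; exists (app f); do 3 split=> //.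
by move=> b /f3 [a /(rel_app _ _ _ _ _ Hf) [Ha ->]]; exists a.
Qed.

Lemma finite_iff X : finite X <-> exists n, n ∈ omega /\ equipotent X n.
Proof.
split=> [[w [n [/is_omega_eq -> [Hn E]]]]|[n [Hn E]]]; first by exists n.
by exists omega, n; rewrite is_omega_eq.
Qed.

Lemma bounded_finite N : N ∈ omega -> forall X, subset X N -> finite X.
Proof.
enough (H : forall N, N ∈ omega -> forall X, subset X N -> exists n, n ∈ omega /\ equipotent X n).
{ by move=> HN X S; apply/finite_iff; apply: (H N). }
clear N; apply: omega_ind; first by dd; apply: Dp_equipotent; dd.
- move=> X S; exists emp; split=> //; apply: (equipotent_intro _ _ (fun x => x)) => //.
  by move=> y /in_emp.
- move=> N HN IH X S.
  have Sx x : x ∈ sep X (fun x => x <> N) <-> x ∈ X /\ x <> N by apply: in_sep.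
  case: (IH (sep X (fun x => x <> N))) => [x /Sx [Hx E]|n [Hn]].
    by case/in_sc: (S _ Hx).
  move=> /equipotent_elim [F [DF [F1 [F2 F3]]]].
  case: (classic (N ∈ X)) => K.
  + exists (sc n); split; first exact: omega_sc.
    have F1' x : x ∈ X -> x <> N -> F x ∈ n by move=> Hx E; apply: F1; apply/Sx.
    apply: (equipotent_intro _ _ (fun x => ite (x = N) n (F x))); first by dd.
    * move=> x Hx; apply/in_sc; rewrite /ite; case: (decide _) => E; [by right|left; auto].
    * move=> x y Hx Hy; rewrite /ite; case: (decide _) => E1; case: (decide _) => E2 E.
      -- by rewrite E1 E2.
      -- by case: (nat_irrefl _ Hn); rewrite {1}E; apply: F1'.
      -- by case: (nat_irrefl _ Hn); rewrite -{1}E; apply: F1'.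
      -- by apply: F2 => //; apply/Sx.
    * move=> y /in_sc [Hy|->]; last by exists N; rewrite ite_true.
      by case: (F3 _ Hy) => x [/Sx [Hx E] <-]; exists x; rewrite ite_false.
  + exists n; split=> //; apply: (equipotent_intro _ _ F) => //.
    * by move=> x Hx; apply: F1; apply/Sx; split=> // E; apply: K; rewrite -E.
    * by move=> x y Hx Hy; apply: F2; apply/Sx; split=> // E; apply: K; rewrite -E.
    * by move=> y /F3 [x [/Sx [Hx _] E]]; exists x.
Qed.

(** With its converse this turns finite supports into bounded ones, so that sums over a support run
    over an initial segment of [omega]. *)
Lemma finite_bounded X : subset X omega -> finite X -> exists N, N ∈ omega /\ subset X N.
Proof.
move=> S /finite_iff [n [Hn /equipotent_elim [F [DF [F1 [F2 F3]]]]]].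
set G := fun k => the (fun x => x ∈ X /\ F x = k).
have DG : Dt (fun e => G (e 0)) by rewrite /G; dd.
have H : forall m, m ∈ omega -> exists N, N ∈ omega /\ forall k, k ∈ m -> G k ∈ omega -> G k ∈ N.
{ apply: omega_ind; first by dd.
  - by exists emp; split=> // k /in_emp.
  - move=> m Hm [N [HN K]]; case: (classic (G m ∈ omega)) => L.
    + case: (nat_max _ _ HN (omega_sc _ L)) => N' [HN' [S1 S2]]; exists N'; split=> // k.
      move=> /in_sc [Hk Gk|-> _]; first by apply: S1; apply: K.
      by apply: S2; apply/in_sc; right.
    + by exists N; split=> // k /in_sc [Hk Gk|-> //]; apply: K. }
case: (H _ Hn) => N [HN K]; exists N; split=> // x Hx.
have E : G (F x) = x by apply: the_eq => // y [Hy E]; apply: F2.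
by rewrite -E; apply: K; [exact: F1|rewrite E; apply: S].
Qed.

End Finite.

(* Gaussian elimination along an enumeration [hn] of H gives subgroups
   [D 0 <= D 1 <= ...] with union H and homomorphisms [lead n : D (n+1) -> Z]
   with kernel [D n]. *)
Section FreeCriterion.
Context {M : set_structure} {HM : Model M}.
Variables (L H pH I ci phi : M) (ev : M -> M -> M).
Hypotheses (OL : ordinal L) (oL : subset omega L).
Hypotheses (HG : abelian_group H pH) (Hci : is_inj ci I L) (Hphi : is_inj phi H omega).
Hypothesis Dev : Dt (fun e => ev (e 0) (e 1)).
Hypothesis ev_in : forall g i, g ∈ H -> i ∈ I -> ev g i ∈ ZZ.
Hypothesis ev_add : forall x y z i, x ∈ H -> y ∈ H -> i ∈ I -> app2 pH x y z ->
  ev z i = zadd (ev x i) (ev y i).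
Hypothesis ev_sep : forall x y, x ∈ H -> y ∈ H -> (forall i, i ∈ I -> ev x i = ev y i) -> x = y.
Implicit Types (a b f g i j k n N : M).

Add Ring int_ring : (@int_ring M HM) (setoid (@eqZ_equiv M HM) (@int_ring_ext M HM)).

Let add_ex x y : x ∈ H -> y ∈ H -> exists z, z ∈ H /\ app2 pH x y z.
Proof.
move=> Hx Hy; case: HG => /is_binop_iff Hf _.
have Hp : opair x y ∈ prod H H by apply/in_prod_opair.
exists (app pH (opair x y)); split; first exact: (app_in _ _ _ _ Hf).
by apply/app2_rel/(rel_app _ _ _ _ _ Hf).
Qed.

Let zero_ex : exists o, o ∈ H /\ forall i, i ∈ I -> ev o i = z0.
Proof.
case: HG => _ [_ [_ [o [[Ho Hz] _]]]]; exists o; split=> // i Hi.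
have E := ev_add _ _ _ _ Ho Ho Hi (Hz _ Ho).
have K := ev_in _ _ Ho Hi.
have -> : ev o i = zsub (zadd (ev o i) (ev o i)) (ev o i) by zring.
by rewrite -E; zring.
Qed.

Let neg_ex x : x ∈ H -> exists y, y ∈ H /\ forall i, i ∈ I -> ev y i = zneg (ev x i).
Proof.
case: HG => _ [_ [_ [o [[Ho Hz] Hn]]]] Hx; case: (Hn _ Hx) => y [Hy E]; exists y; split=> // i Hi.
have E1 := ev_add _ _ _ _ Hx Hy Hi E; have E2 := ev_add _ _ _ _ Ho Ho Hi (Hz _ Ho).
have K1 := ev_in _ _ Hx Hi; have K2 := ev_in _ _ Hy Hi; have K3 := ev_in _ _ Ho Hi.
have E3 : ev o i = z0.
{ have -> : ev o i = zsub (zadd (ev o i) (ev o i)) (ev o i) by zring.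
  by rewrite -E2; zring. }
have -> : ev y i = zsub (zadd (ev x i) (ev y i)) (ev x i) by zring.
by rewrite -E1 E3; zring.
Qed.

(** [H] comes with an addition alone; integer multiples are built by induction and described through
    their coordinates. *)
Let scal_ex a : a ∈ ZZ -> forall g, g ∈ H ->
  exists g', g' ∈ H /\ forall i, i ∈ I -> ev g' i = zmul a (ev g i).
Proof.
move: a; apply: int_ind; first by dd.
- move=> g Hg; case: zero_ex => o [Ho E]; exists o; split=> // i Hi; rewrite E //; zring.
- move=> a Ha IH g Hg; case: (IH g Hg) => g' [Hg' E]; case: (add_ex _ _ Hg' Hg) => z [Hz K].
  exists z; split=> // i Hi; rewrite (ev_add _ _ _ _ Hg' Hg Hi K) E //; zring.
- move=> a Ha IH g Hg; case: (IH g Hg) => g' [Hg' E]; case: (neg_ex _ Hg) => m [Hm Em].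
  case: (add_ex _ _ Hg' Hm) => z [Hz K].
  exists z; split=> // i Hi; rewrite (ev_add _ _ _ _ Hg' Hm Hi K) E // Em //; zring.
Qed.

Let lin a b g g' g'' : Prop :=
  forall i, i ∈ I -> ev g'' i = zadd (zmul a (ev g i)) (zmul b (ev g' i)).

Let lin_ex a b g g' : a ∈ ZZ -> b ∈ ZZ -> g ∈ H -> g' ∈ H -> exists g'', g'' ∈ H /\ lin a b g g' g''.
Proof.
move=> Ha Hb Hg Hg'; case: (scal_ex a Ha g Hg) => x [Hx Ex]; case: (scal_ex b Hb g' Hg') => y [Hy Ey].
case: (add_ex _ _ Hx Hy) => z [Hz K]; exists z; split=> // i Hi.
by rewrite (ev_add _ _ _ _ Hx Hy Hi K) Ex // Ey.
Qed.

(** The inverse of [phi], made total: at an [n] that is not a value every element of [H] qualifies,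
    so that [hn n] always lies in [H]. *)
Let hn n : M := pick phi H (fun g => app phi g = n \/ ~ exists g', g' ∈ H /\ app phi g' = n).

Let Dhn : Dt (fun e => hn (e 0)).
Proof. by rewrite /hn; apply: (Dt_pick _ _ (fun e g => app phi g = e 0 \/ ~ exists g', g' ∈ H /\ app phi g' = e 0)); dd. Qed.

Let Hphi' : is_inj phi H L.
Proof.
case: Hphi => Hf Hi; split=> //; case: Hf => F1 F2; split=> // p /F1 [x [y [Hx [Hy E]]]].
by exists x, y; auto.
Qed.

Let hn_spec n : hn n ∈ H /\ (app phi (hn n) = n \/ ~ exists g', g' ∈ H /\ app phi g' = n).
Proof.
apply: (pick_spec phi H L (fun g => app phi g = n \/ ~ exists g', g' ∈ H /\ app phi g' = n)) => //.
case: (classic (exists g', g' ∈ H /\ app phi g' = n)) => [[g [Hg E]]|N]; first by exists g; auto.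
by case: zero_ex => o [Ho _]; exists o; auto.
Qed.

Let hn_in n : hn n ∈ H. Proof. by case: (hn_spec n). Qed.

Let hn_surj g : g ∈ H -> app phi g ∈ omega /\ hn (app phi g) = g.
Proof.
move=> Hg; case/is_inj_elim: Hphi => p1 p2; split; first exact: p1.
by apply: p2 => //; case: (hn_spec (app phi g)) => _ [//|[]]; exists g.
Qed.

Let live n E : Prop := exists i, i ∈ I /\ app E (opair (hn n) i) <> z0.
Let pvt n E : M := pick ci I (fun i => app E (opair (hn n) i) <> z0).
(** Elimination without fractions: with [p] the entry of row [hn n] in the pivot column, row [g]
    becomes [p] times itself minus its own pivot entry times row [hn n]. Entries stay integral and
    row [hn n] becomes zero. A row that is already zero gives no pivot and changes nothing. *)
Let step n E : M := ite (live n E)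
  (lam (prod H I) (fun q => zsub (zmul (app E (opair (hn n) (pvt n E))) (app E q))
                                 (zmul (app E (opair (pr1 q) (pvt n E))) (app E (opair (hn n) (pr2 q))))))
  E.

Let Dlive : Dp (fun e => live (e 0) (e 1)).
Proof. rewrite /live; dd. Qed.

Let Dpvt : Dt (fun e => pvt (e 0) (e 1)).
Proof. by rewrite /pvt; apply: (Dt_pick _ _ (fun e i => app (e 1) (opair (hn (e 0)) i) <> z0)); dd. Qed.

Let Dstep : Dt (fun e => step (e 0) (e 1)).
Proof. rewrite /step; dd. Qed.

Let En n : M := nrec (lam (prod H I) (fun q => ev (pr1 q) (pr2 q))) step n.
Let ee n g i : M := app (En n) (opair g i).

Let DEn : Dt (fun e => En (e 0)).
Proof. rewrite /En; dd. Qed.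

Let Dee : Dt (fun e => ee (e 0) (e 1) (e 2)).
Proof. rewrite /ee; dd. Qed.

Let ee_0 g i : g ∈ H -> i ∈ I -> ee emp g i = ev g i.
Proof.
move=> Hg Hi; rewrite /ee /En nrec_0 // app_lam; try by dd.
- by rewrite pr1_opair pr2_opair.
- by apply/in_prod_opair.
Qed.

Let ee_S n : n ∈ omega ->
  (live n (En n) /\ pvt n (En n) ∈ I /\ ee n (hn n) (pvt n (En n)) <> z0 /\
   forall g i, g ∈ H -> i ∈ I -> ee (sc n) g i =
     zsub (zmul (ee n (hn n) (pvt n (En n))) (ee n g i))
          (zmul (ee n g (pvt n (En n))) (ee n (hn n) i))) \/
  (~ live n (En n) /\ (forall i, i ∈ I -> ee n (hn n) i = z0) /\
   forall g i, ee (sc n) g i = ee n g i).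
Proof.
move=> Hn; have E : En (sc n) = step n (En n) by rewrite /En nrec_S.
case: (classic (live n (En n))) => K.
- left; split=> //.
  have [P1 P2] : pvt n (En n) ∈ I /\ app (En n) (opair (hn n) (pvt n (En n))) <> z0.
    by apply: (pick_spec ci I L (fun i => app (En n) (opair (hn n) i) <> z0)) => //; dd.
  do 2 split=> //; move=> g i Hg Hi; rewrite {1}/ee E /step ite_true // app_lam; try by dd.
  + by rewrite pr1_opair pr2_opair.
  + by apply/in_prod_opair.
- right; split=> //; split=> [i Hi|g i]; last by rewrite /ee E /step ite_false.
  by apply: NNPP => N; apply: K; exists i.
Qed.

Let ee_in n : n ∈ omega -> forall g i, g ∈ H -> i ∈ I -> ee n g i ∈ ZZ.
Proof.
move: n; apply: omega_ind; first by dd.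
- by move=> g i Hg Hi; rewrite ee_0 //; apply: ev_in.
- move=> n Hn IH g i Hg Hi; case: (ee_S n Hn) => [[_ [_ [_ E]]]|[_ [_ E]]]; rewrite E //.
  exact: IH.
Qed.

Let ee_lin a b g g' g'' : g ∈ H -> g' ∈ H -> g'' ∈ H -> lin a b g g' g'' ->
  forall n, n ∈ omega -> forall i, i ∈ I ->
  ee n g'' i = zadd (zmul a (ee n g i)) (zmul b (ee n g' i)).
Proof.
move=> Hg Hg' Hg'' E; apply: omega_ind; first by dd.
- by move=> i Hi; rewrite !ee_0 // E.
- move=> n Hn IH i Hi; case: (ee_S n Hn) => [[_ [Hp [_ K]]]|[_ [_ K]]]; rewrite !K // !IH //.
  zring.
Qed.

(** Over the rationals, these are the elements of [H] in the span of [hn 0, ..., hn (n-1)]. *)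
Let D n g : Prop := forall i, i ∈ I -> ee n g i = z0.
Let lead n g : M := ite (live n (En n)) (ee n g (pvt n (En n))) z0.

Let DD : Dp (fun e => D (e 0) (e 1)).
Proof. rewrite /D; dd. Qed.

Let Dlead : Dt (fun e => lead (e 0) (e 1)).
Proof. rewrite /lead; dd. Qed.

Let lead_in n g : n ∈ omega -> g ∈ H -> lead n g ∈ ZZ.
Proof.
move=> Hn Hg; rewrite /lead; case: (ee_S n Hn) => [[K [Hp _]]|[K _]]; first by rewrite ite_true //; apply: ee_in.
by rewrite ite_false.
Qed.

Let lead_lin a b g g' g'' n : n ∈ omega -> g ∈ H -> g' ∈ H -> g'' ∈ H -> lin a b g g' g'' ->
  lead n g'' = zadd (zmul a (lead n g)) (zmul b (lead n g')).
Proof.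
move=> Hn Hg Hg' Hg'' E; rewrite /lead; case: (ee_S n Hn) => [[K [Hp _]]|[K _]].
- by rewrite !ite_true //; apply: ee_lin.
- by rewrite !ite_false //; zring.
Qed.

Let D_lin a b g g' g'' n : n ∈ omega -> g ∈ H -> g' ∈ H -> g'' ∈ H -> lin a b g g' g'' ->
  D n g -> D n g' -> D n g''.
Proof.
move=> Hn Hg Hg' Hg'' E K K' i Hi; rewrite (ee_lin a b g g' g'') // K // K' //; zring.
Qed.

Let D_S n g : n ∈ omega -> g ∈ H -> D n g -> D (sc n) g.
Proof.
move=> Hn Hg K i Hi; case: (ee_S n Hn) => [[_ [Hp [_ E]]]|[_ [_ E]]]; rewrite E // !K //; zring.
Qed.

Let D_lead n g : n ∈ omega -> D n g -> lead n g = z0.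
Proof.
move=> Hn K; rewrite /lead; case: (ee_S n Hn) => [[L' [Hp _]]|[L' _]]; first by rewrite ite_true // K.
by rewrite ite_false.
Qed.

(** When [g] has pivot entry 0, its new row is the nonzero pivot times the old one, and the integers
    have no zero divisors. *)
Let D_back n g : n ∈ omega -> g ∈ H -> D (sc n) g -> lead n g = z0 -> D n g.
Proof.
move=> Hn Hg K; rewrite /lead; case: (ee_S n Hn) => [[L' [Hp [N E]]]|[L' [_ E]]].
- rewrite ite_true // => Z i Hi; have := K i Hi; rewrite E // Z => Q.
  have K1 := ee_in n Hn (hn n) _ (hn_in n) Hp; have K2 := ee_in n Hn g i Hg Hi.
  case: (zmul_eq0 (ee n (hn n) (pvt n (En n))) (ee n g i)) => //.
  by rewrite -Q; zring.
- by move=> _ i Hi; rewrite -E; apply: K.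
Qed.

Let D_h n : n ∈ omega -> D (sc n) (hn n).
Proof.
move=> Hn i Hi; case: (ee_S n Hn) => [[_ [Hp [_ E]]]|[_ [Z E]]]; rewrite E //; last exact: Z.
zring.
Qed.

Let D_ex g : g ∈ H -> exists n, n ∈ omega /\ D n g.
Proof.
move=> Hg; case: (hn_surj _ Hg) => Hn E; exists (sc (app phi g)); split; first exact: omega_sc.
by rewrite -{2}E; apply: D_h.
Qed.

(** The steps at which [D] strictly grows; each contributes one basis element. *)
Let B : M := sep omega (fun n => exists g, g ∈ H /\ D (sc n) g /\ lead n g <> z0).

Let in_B n : n ∈ B <-> n ∈ omega /\ exists g, g ∈ H /\ D (sc n) g /\ lead n g <> z0.
Proof. by apply: in_sep; dd. Qed.

Let genP n g : Prop := D (sc n) g /\ lead n g <> z0 /\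
  forall g', g' ∈ H -> D (sc n) g' -> exists z, z ∈ ZZ /\ lead n g' = zmul z (lead n g).
Let bas n : M := pick phi H (genP n).

Let DgenP : Dp (fun e => genP (e 0) (e 1)).
Proof. rewrite /genP; dd. Qed.

Let Dbas : Dt (fun e => bas (e 0)).
Proof. by rewrite /bas; apply: (Dt_pick _ _ (fun e g => genP (e 0) g)); dd. Qed.

(** The values of [lead n] on [D (n+1)] form a nonzero ideal of the integers. It is principal, and
    any element whose lead is a generator will do. *)
Let bas_spec n : n ∈ B -> bas n ∈ H /\ genP n (bas n).
Proof.
move=> /in_B [Hn [g [Hg [Dg Ng]]]]; apply: (pick_spec phi H L (genP n)) => //.
case: (int_principal (fun x => exists g, g ∈ H /\ D (sc n) g /\ x = lead n g)); first by dd.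
- move=> a b x y Ha Hb _ _ [u [Hu [Du ->]]] [v [Hv [Dv ->]]].
  case: (lin_ex a b u v Ha Hb Hu Hv) => w [Hw E]; exists w; split=> //.
  by split; [apply: (D_lin a b u v) => //; apply: omega_sc|rewrite (lead_lin a b u v w)].
- by exists (lead n g); split; [exact: lead_in|split=> //; exists g].
- move=> d [Hd [[u [Hu [Du Ed]]] [Nd Min]]]; exists u; split=> //; split=> //; rewrite -Ed; split=> //.
  by move=> g' Hg' Dg'; apply: Min; [exact: lead_in|exists g'].
Qed.

Let term f i k : M := ite (k ∈ B) (zmul (app f k) (ev (bas k) i)) z0.
Let S f N i : M := zsum (lam omega (term f i)) N.

Let Dterm : Dt (fun e => term (e 0) (e 1) (e 2)).
Proof. rewrite /term; dd. Qed.

Let DS : Dt (fun e => S (e 0) (e 1) (e 2)).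
Proof. rewrite /S; dd. Qed.

Let app_term f i k : k ∈ omega -> app (lam omega (term f i)) k = term f i k.
Proof. by move=> Hk; rewrite app_lam //; dd. Qed.

Let S_S f N i : N ∈ omega -> S f (sc N) i = zadd (S f N i) (term f i N).
Proof. by move=> HN; rewrite /S zsum_S // app_term. Qed.

Let S_in f N i : N ∈ omega -> S f N i ∈ ZZ.
Proof. exact: zsum_in. Qed.

Let S_ext f f' N i : N ∈ omega -> (forall k, k ∈ B -> k ∈ N -> app f k = app f' k) ->
  S f N i = S f' N i.
Proof.
move=> HN E; apply: zsum_ext => // k Hk; have Hk' := omega_trans _ HN _ Hk.
rewrite !app_term // /term; case: (classic (k ∈ B)) => K; last by rewrite !ite_false.
by rewrite !ite_true // E.
Qed.

Let S_lin a b f f' f'' N i : N ∈ omega ->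
  (forall k, k ∈ B -> app f'' k = zadd (zmul a (app f k)) (zmul b (app f' k))) ->
  S f'' N i = zadd (zmul a (S f N i)) (zmul b (S f' N i)).
Proof.
move=> HN E; apply: zsum_linear => // k Hk; have Hk' := omega_trans _ HN _ Hk.
rewrite !app_term // /term; case: (classic (k ∈ B)) => K; last by rewrite !ite_false //; zring.
by rewrite !ite_true // E //; zring.
Qed.

Let supp f N : Prop := forall k, k ∈ B -> ~ k ∈ N -> app f k = z0.
Let Rep f N g : Prop := forall i, i ∈ I -> ev g i = S f N i.

Let S_stable f n m i : n ∈ omega -> m ∈ omega -> subset n m -> supp f n -> S f m i = S f n i.
Proof.
move=> Hn Hm Sub Z; apply: zsum_stable => // k Hk Nk; have Hk' := omega_trans _ Hm _ Hk.
rewrite app_term // /term; case: (classic (k ∈ B)) => K; last by rewrite ite_false.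
by rewrite ite_true // Z //; zring.
Qed.

Let Dsupp : Dp (fun e => supp (e 0) (e 1)).
Proof. rewrite /supp; dd. Qed.

Let DRep : Dp (fun e => Rep (e 0) (e 1) (e 2)).
Proof. rewrite /Rep; dd. Qed.

Let sum_ex N : N ∈ omega -> forall f, f ∈ funs B ZZ -> exists g, g ∈ H /\ D N g /\ Rep f N g.
Proof.
move: N; apply: omega_ind; first by dd.
- move=> f Hf; case: zero_ex => o [Ho Z]; exists o; split=> //; split=> i Hi; first by rewrite ee_0 // Z.
  by rewrite Z // /S zsum_0.
- move=> N HN IH f Hf; case: (IH f Hf) => g [Hg [Dg Rg]]; case: (classic (N ∈ B)) => K.
  + case: (bas_spec _ K) => Hb [Db _].
    case: (lin_ex z1 (app f N) g (bas N)) => //; first exact: app_funs Hf K.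
    move=> w [Hw E]; exists w; split=> //; split.
      by apply: (D_lin z1 (app f N) g (bas N)); auto.
    move=> i Hi; have Kw := ev_in _ _ Hg Hi; have Kb := ev_in _ _ Hb Hi.
    by rewrite E // S_S // /term ite_true // -Rg //; zring.
  + exists g; split=> //; split; first exact: D_S.
    move=> i Hi; have Kw := ev_in _ _ Hg Hi.
    by rewrite S_S // /term ite_false // -Rg //; zring.
Qed.

Let coord_ex N : N ∈ omega -> forall g, g ∈ H -> D N g ->
  exists f, f ∈ funs B ZZ /\ supp f N /\ Rep f N g.
Proof.
move: N; apply: omega_ind; first by dd.
- move=> g Hg Dg; exists (lam B (fun _ => z0)); split; first by apply: lam_funs.
  split=> [k Hk _|i Hi]; first by rewrite app_lam.
  by rewrite -ee_0 // Dg // /S zsum_0.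
- move=> N HN IH g Hg Dg; case: (classic (N ∈ B)) => K.
  + case: (bas_spec _ K) => Hb [Db [Nb Gb]].
    case: (Gb _ Hg Dg) => z [Hz Ez].
    (* [w = g - z bas N], with [z] the quotient of the leads, has lead 0 and so falls into [D N]. *)
    case: (lin_ex z1 (zneg z) g (bas N)) => // w [Hw E].
    have Dw : D (sc N) w by apply: (D_lin z1 (zneg z) g (bas N)); auto.
    have Zw : lead N w = z0.
      by rewrite (lead_lin z1 (zneg z) g (bas N)) // Ez; zring.
    case: (IH w Hw (D_back _ _ HN Hw Dw Zw)) => f [Hf [Zf Rf]].
    have Af k : k ∈ B -> app (lam B (fun k => ite (k = N) z (app f k))) k = ite (k = N) z (app f k).
      by move=> Hk; rewrite app_lam.
    exists (lam B (fun k => ite (k = N) z (app f k))); split.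
      by apply: lam_funs => // k Hk; rewrite /ite; case: (decide _) => // _; apply: app_funs Hf Hk.
    split.
    * move=> k Hk Nk; rewrite Af // ite_false; first by apply: Zf => // L'; apply: Nk; apply/in_sc; left.
      by move=> L'; apply: Nk; apply/in_sc; right.
    * move=> i Hi; have Kg := ev_in _ _ Hg Hi; have Kb := ev_in _ _ Hb Hi.
      rewrite S_S // /term ite_true // Af // ite_true //.
      rewrite (S_ext _ f) //; first by rewrite -Rf // E //; zring.
      move=> k Hk HkN; rewrite Af // ite_false // => L'; subst k; exact: (nat_irrefl N).
  + have Zg : lead N g = z0 by apply: NNPP => Ng; apply: K; apply/in_B; split=> //; exists g.
    case: (IH g Hg (D_back _ _ HN Hg Dg Zg)) => f [Hf [Zf Rf]]; exists f; split=> //; split.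
    * by move=> k Hk Nk; apply: Zf => // L'; apply: Nk; apply/in_sc; left.
    * move=> i Hi; have Kg := ev_in _ _ Hg Hi; rewrite S_S // /term ite_false // -Rf //; zring.
Qed.

Let indep N : N ∈ omega -> forall f, f ∈ funs B ZZ -> (forall i, i ∈ I -> S f N i = z0) ->
  forall k, k ∈ B -> k ∈ N -> app f k = z0.
Proof.
move: N; apply: omega_ind; first by dd.
- by move=> f Hf _ k _ /in_emp.
- move=> N HN IH f Hf Z; case: (classic (N ∈ B)) => K.
  + case: (bas_spec _ K) => Hb [Db [Nb _]]; have Hfn := app_funs _ _ _ _ Hf K.
    case: (sum_ex N HN f Hf) => g [Hg [Dg Rg]].
    case: zero_ex => o [Ho Zo].
    (* Zero is written as [f(N) bas N + g] with [g] in [D N]. Applying [lead N], which vanishes on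
       [D N], leaves [f(N)] times the nonzero lead of [bas N]. *)
    have El : lin (app f N) z1 (bas N) g o.
    { move=> i Hi; have Kg := ev_in _ _ Hg Hi; have Kb := ev_in _ _ Hb Hi.
      by rewrite Zo // Rg // -(Z i Hi) S_S // /term ite_true //; zring. }
    have Do : D N o.
    { move=> i Hi.
      (* [o] is known to vanish only in its original coordinates; the relation [o = 0 o + 0 o]
         carries this over to the reduced row. *)
      have Eo : lin z0 z0 o o o by move=> j Hj; rewrite Zo //; zring.
      by rewrite (ee_lin z0 z0 o o o) //; zring. }
    have El' := lead_lin _ _ _ _ _ _ HN Hb Hg Ho El.
    have Fz : app f N = z0.
    { have Kb := lead_in _ _ HN Hb.
      case: (zmul_eq0 (app f N) (lead N (bas N))) => //.
      rewrite (D_lead _ _ HN Do) (D_lead _ _ HN Dg) in El'.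
      by rewrite El'; zring. }
    move=> k Hk /in_sc [HkN|-> //]; apply: (IH f) => // i Hi.
    have Ks := S_in f N i HN.
    have := Z i Hi; rewrite S_S // /term ite_true // Fz => <-; zring.
  + move=> k Hk /in_sc [HkN|E]; last by subst k.
    apply: (IH f) => // i Hi; have Ks := S_in f N i HN.
    have := Z i Hi; rewrite S_S // /term ite_false // => <-; zring.
Qed.

Let finite_support_iff f : f ∈ funs B ZZ ->
  finite_support ZZ pZZ B f <-> exists N, N ∈ omega /\ supp f N.
Proof.
move=> Hf; have Hf' : is_fun f B ZZ by apply/in_funs.
have Q b : (exists z, rel f b z /\ ~ is_zero ZZ pZZ z) <-> b ∈ B /\ app f b <> z0.
{ split=> [[z [/(rel_app _ _ _ _ _ Hf') [Hb ->]]]|[Hb N]]; first by rewrite is_zero_ZZ.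
  by exists (app f b); rewrite is_zero_ZZ (rel_app _ _ _ _ _ Hf'). }
split.
- move=> [X [HX FX]]; case: (finite_bounded X) => //.
    by move=> b /HX [/in_B []].
  move=> N [HN SX]; exists N; split=> // k Hk Nk; apply: NNPP => E; apply/Nk/SX/HX; split=> //.
  by apply/Q.
- move=> [N [HN Z]].
  have Sx b : b ∈ sep B (fun b => app f b <> z0) <-> b ∈ B /\ app f b <> z0 by apply: in_sep; dd.
  exists (sep B (fun b => app f b <> z0)); split.
    by move=> b; rewrite Sx Q; tauto.
  apply: (bounded_finite N) => // b /Sx [Hb Nb]; apply: NNPP => K; apply: Nb; exact: Z.
Qed.

Let DSet : M := sep (funs B ZZ) (fun f => exists N, N ∈ omega /\ supp f N).
Let dadd f f' : M := lam B (fun k => zadd (app f k) (app f' k)).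

Let Ddadd : Dt (fun e => dadd (e 0) (e 1)).
Proof. rewrite /dadd; dd. Qed.

Let in_DSet f : f ∈ DSet <-> f ∈ funs B ZZ /\ exists N, N ∈ omega /\ supp f N.
Proof. by apply: in_sep; dd. Qed.

Let app_dadd f f' k : k ∈ B -> app (dadd f f') k = zadd (app f k) (app f' k).
Proof. by move=> Hk; rewrite app_lam. Qed.

Let dadd_in f f' : f ∈ DSet -> f' ∈ DSet -> dadd f f' ∈ DSet.
Proof.
move=> /in_DSet [Hf [N [HN Z]]] /in_DSet [Hf' [N' [HN' Z']]]; apply/in_DSet; split.
  by apply: lam_funs => // k Hk.
case: (nat_max _ _ HN HN') => m [Hm [S1 S2]]; exists m; split=> // k Hk Nk.
rewrite app_dadd // Z ?Z' //; [zring|by move=> K; apply: Nk; apply: S2|by move=> K; apply: Nk; apply: S1].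
Qed.

Let Repr f g : Prop := exists N, N ∈ omega /\ supp f N /\ Rep f N g.

Let DRepr : Dp (fun e => Repr (e 0) (e 1)).
Proof. rewrite /Repr; dd. Qed.

Let Repr_uniq f f' g : f ∈ DSet -> f' ∈ DSet -> Repr f g -> Repr f' g -> f = f'.
Proof.
move=> /in_DSet [Hf _] /in_DSet [Hf' _] [N [HN [Z R]]] [N' [HN' [Z' R']]].
case: (nat_max _ _ HN HN') => m [Hm [S1 S2]].
(* Below the common bound [m] the difference represents zero and [indep] applies; from [m] on both
   families vanish. *)
set d := lam B (fun k => zadd (zmul z1 (app f k)) (zmul (zneg z1) (app f' k))).
have Ad k : k ∈ B -> app d k = zadd (zmul z1 (app f k)) (zmul (zneg z1) (app f' k)).
  by move=> Hk; rewrite /d app_lam.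
have Hd : d ∈ funs B ZZ by apply: lam_funs.
have Zd i : i ∈ I -> S d m i = z0.
{ move=> Hi; rewrite (S_lin _ _ _ _ _ _ _ Hm Ad).
  rewrite (S_stable f N m) // (S_stable f' N' m) // -R // -R' //; zring. }
apply: (funs_ext _ _ _ _ _ Hf Hf') => k Hk.
have K1 := app_funs _ _ _ _ Hf Hk; have K2 := app_funs _ _ _ _ Hf' Hk.
case: (classic (k ∈ m)) => Km.
- apply: zsub_eq0 => //; rewrite -(indep m Hm d Hd Zd k Hk Km) Ad //; zring.
- by rewrite Z ?Z' // => K; apply: Km; auto.
Qed.

Let co g : M := the (fun f => f ∈ DSet /\ Repr f g).

Let Dco : Dt (fun e => co (e 0)).
Proof. rewrite /co; dd. Qed.

Let co_eq f g : f ∈ DSet -> Repr f g -> co g = f.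
Proof. by move=> Hf R; apply: the_eq => // f' [Hf' R']; apply: (Repr_uniq _ _ g). Qed.

Let co_spec g : g ∈ H -> co g ∈ DSet /\ Repr (co g) g.
Proof.
move=> Hg; case: (D_ex _ Hg) => N [HN Dg]; case: (coord_ex N HN g Hg Dg) => f [Hf [Z R]].
have Df : f ∈ DSet by apply/in_DSet; split=> //; exists N.
have R' : Repr f g by exists N.
by rewrite (co_eq f).
Qed.

Let co_add x y z : x ∈ H -> y ∈ H -> app2 pH x y z -> co z = dadd (co x) (co y).
Proof.
move=> Hx Hy E; case: (co_spec _ Hx) => Dx [N [HN [Zx Rx]]]; case: (co_spec _ Hy) => Dy [N' [HN' [Zy Ry]]].
apply: co_eq; first exact: dadd_in.
case: (nat_max _ _ HN HN') => m [Hm [S1 S2]]; exists m; split=> //; split.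
- move=> k Hk Nk; rewrite app_dadd // Zx ?Zy //; [zring|by move=> K; apply: Nk; apply: S2|by move=> K; apply: Nk; apply: S1].
- move=> i Hi; rewrite (ev_add _ _ _ _ Hx Hy Hi E) (S_lin z1 z1 (co x) (co y)) //.
  + rewrite (S_stable (co x) N m) // (S_stable (co y) N' m) // -Rx // -Ry //.
    have K1 := ev_in _ _ Hx Hi; have K2 := ev_in _ _ Hy Hi; zring.
  + move=> k Hk; rewrite app_dadd //; zring.
Qed.

Lemma free_criterion : is_free H pH.
Proof.
exists ZZ, pZZ, B, DSet, (mkop DSet dadd), (lam H co).
split; first exact: integers_ZZ.
split; [split; [|split]|split; [split|]].
- move=> f; rewrite in_DSet in_funs; split=> -[Hf K]; split=> //; exact/finite_support_iff/K/in_funs.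
- by apply: is_binop_mkop.
- move=> f g h b x y z Hf Hg; rewrite app2_mkop // => -[_ [_ ->]] Hb.
  have Hs := dadd_in _ _ Hf Hg; move: Hf Hg Hs.
  move=> /in_DSet [/in_funs Hf _] /in_DSet [/in_funs Hg _] /in_DSet [/in_funs Hs _].
  rewrite (rel_app _ _ _ _ _ Hf) (rel_app _ _ _ _ _ Hg) (rel_app _ _ _ _ _ Hs).
  move=> [_ ->] [_ ->] [_ ->]; rewrite app2_pZZ app_dadd //; do !split=> //; exact: app_in Hb.
- by apply: is_fun_lam => // g /co_spec [].
- move=> x y z x' y' z' Hx Hy E; rewrite !rel_lam // => -[_ ->] [_ ->] [_ ->]; rewrite app2_mkop //.
  by case: (co_spec _ Hx) => ? _; case: (co_spec _ Hy) => ? _; do 2 split=> //; apply: co_add.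
- apply: bij_intro => //.
  + by move=> g /co_spec [].
  + move=> x y Hx Hy E; case: (co_spec _ Hx) => _ [N [HN [Zx Rx]]]; case: (co_spec _ Hy) => _ [N' [HN' [Zy Ry]]].
    case: (nat_max _ _ HN HN') => m [Hm [S1 S2]]; apply: ev_sep => // i Hi.
    by rewrite Rx // Ry // -(S_stable (co x) N m) // -(S_stable (co y) N' m) // E.
  + move=> f /[dup] Df /in_DSet [Hf [N [HN Z]]]; case: (sum_ex N HN f Hf) => g [Hg [_ R]].
    by exists g; split=> //; apply: co_eq => //; exists N.
Qed.

End FreeCriterion.

(** * Slenderness of the integers *)

Section Slender.
Context {M : set_structure} {HM : Model M}.
Implicit Types (a b c i k n x y z : M).

Add Ring int_ring : (@int_ring M HM) (setoid (@eqZ_equiv M HM) (@int_ring_ext M HM)).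

Lemma cantor_omega : ~ inj (pow omega) omega.
Proof.
move=> [f /is_inj_elim [f1 f2]].
set Q := fun n => exists x, x ∈ pow omega /\ app f x = n /\ ~ n ∈ x.
have S n : n ∈ sep omega Q <-> n ∈ omega /\ Q n by apply: in_sep; rewrite /Q; dd.
have HD : sep omega Q ∈ pow omega by apply/in_pow => n /S [].
case: (classic (app f (sep omega Q) ∈ sep omega Q)) => K.
- case/S: (K) => _ [x [Hx [E N]]]; apply: N; by rewrite (f2 _ _ Hx HD E).
- by apply: (K); apply/S; split; [exact: f1|exists (sep omega Q)].
Qed.

Definition agree k x y : Prop := forall i, i ∈ k -> (i ∈ x <-> i ∈ y).
Definition differ_at n x y : Prop := agree n x y /\ ~ (n ∈ x <-> n ∈ y).

Lemma Dp_agree s t u : Dt s -> Dt t -> Dt u -> Dp (fun e : nat -> M => agree (s e) (t e) (u e)).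
Proof. apply: Dp_app3; rewrite /agree; dd. Qed.

Lemma Dp_differ_at s t u : Dt s -> Dt t -> Dt u -> Dp (fun e : nat -> M => differ_at (s e) (t e) (u e)).
Proof. apply: Dp_app3; rewrite /differ_at /agree; dd. Qed.

Lemma differ_ex x y : subset x omega -> subset y omega -> x <> y ->
  exists n, n ∈ omega /\ differ_at n x y.
Proof.
move=> Sx Sy N; case: (nat_least (fun n => ~ (n ∈ x <-> n ∈ y))) => //.
- apply: NNPP => K; apply: N; apply: ext => z; split=> Hz; apply: NNPP => K';
    apply: K; exists z; (split; [auto|tauto]).
- by move=> n [Hn [K Min]]; exists n; split=> //; split=> // i Hi; apply: NNPP; apply: Min.
Qed.

Lemma differ_uniq n m x y : n ∈ omega -> m ∈ omega -> differ_at n x y -> differ_at m x y -> n = m.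
Proof.
move=> Hn Hm [A1 N1] [A2 N2]; case: (nat_total _ Hm _ Hn) => [H|[//|H]].
- by case: N1; apply: A2.
- by case: N2; apply: A1.
Qed.

Definition cadd (c d : M) : M := lam omega (fun n => zadd (app c n) (app d n)).
Definition uu k : M := lam omega (fun n => ite (n ∈ k) z0 z1).

Lemma cadd_in c d : cadd c d ∈ funs omega ZZ.
Proof. by apply: lam_funs. Qed.

Lemma app_cadd c d n : n ∈ omega -> app (cadd c d) n = zadd (app c n) (app d n).
Proof. by move=> Hn; rewrite app_lam. Qed.

Lemma uu_in k : uu k ∈ funs omega ZZ.
Proof. by apply: lam_funs => // n Hn; rewrite /ite; case: (decide _). Qed.

Lemma app_uu k n : n ∈ omega -> app (uu k) n = ite (n ∈ k) z0 z1.
Proof. by move=> Hn; rewrite app_lam. Qed.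

Variable A : M -> M.
Hypothesis DA : Dt (fun e => A (e 0)).
Hypothesis A_in : forall c, c ∈ funs omega ZZ -> A c ∈ ZZ.
Hypothesis A_add : forall c d, c ∈ funs omega ZZ -> d ∈ funs omega ZZ ->
  A (cadd c d) = zadd (A c) (A d).
Hypothesis A_uu : forall k, k ∈ omega -> A (uu k) <> z0.

Let csc z c : M := lam omega (fun n => zmul z (app c n)).

Let Dcsc : Dt (fun e => csc (e 0) (e 1)).
Proof. rewrite /csc; dd. Qed.

Let csc_in z c : csc z c ∈ funs omega ZZ.
Proof. by apply: lam_funs. Qed.

Let app_csc z c n : n ∈ omega -> app (csc z c) n = zmul z (app c n).
Proof. by move=> Hn; rewrite app_lam. Qed.

Let c_ext c d : c ∈ funs omega ZZ -> d ∈ funs omega ZZ ->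
  (forall n, n ∈ omega -> app c n = app d n) -> c = d.
Proof. exact: funs_ext. Qed.

Let A_csc c : c ∈ funs omega ZZ -> forall z, z ∈ ZZ -> A (csc z c) = zmul z (A c).
Proof.
move=> Hc; have KA := A_in _ Hc.
have Kc n : n ∈ omega -> app c n ∈ ZZ by move=> Hn; apply: app_funs Hn.
apply: int_ind; first by dd.
- have K0 := A_in _ (csc_in z0 c).
  have E : A (cadd (csc z0 c) (csc z0 c)) = A (csc z0 c).
  { congr A; apply: c_ext; [exact: cadd_in|exact: csc_in|move=> n Hn].
    by rewrite app_cadd // app_csc //; zring. }
  have -> : A (csc z0 c) = zsub (zadd (A (csc z0 c)) (A (csc z0 c))) (A (csc z0 c)) by zring.
  by rewrite -A_add // E; zring.
- move=> z Hz IH; have -> : csc (zadd z z1) c = cadd (csc z c) c.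
  { apply: c_ext; [exact: csc_in|exact: cadd_in|move=> n Hn].
    by rewrite app_cadd // !app_csc //; have := Kc n Hn => ?; zring. }
  by rewrite A_add // IH; zring.
- move=> z Hz IH.
  have E : csc z c = cadd (csc (zsub z z1) c) c.
  { apply: c_ext; [exact: csc_in|exact: cadd_in|move=> n Hn].
    by rewrite app_cadd // !app_csc //; have := Kc n Hn => ?; zring. }
  have K1 := A_in _ (csc_in (zsub z z1) c).
  have -> : A (csc (zsub z z1) c) = zsub (zadd (A (csc (zsub z z1) c)) (A c)) (A c) by zring.
  by rewrite -A_add // -E IH; zring.
Qed.

Let Duu : Dt (fun e : nat -> M => uu (e 0)).
Proof. rewrite /uu; dd. Qed.

(* The factor 2 A(u_n) makes w_n A(u_n) not divisible by w_(n+1). *)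
Let ww n : M := nrec z1 (fun k v => zmul (zadd (A (uu k)) (A (uu k))) v) n.

Let Dww : Dt (fun e : nat -> M => ww (e 0)).
Proof. rewrite /ww; dd. Qed.

Let ww_S n : n ∈ omega -> ww (sc n) = zmul (zadd (A (uu n)) (A (uu n))) (ww n).
Proof. by move=> Hn; rewrite /ww nrec_S //; dd. Qed.

Let z1_neq0 : (z1 : M) <> z0.
Proof.
rewrite /z1 /z0 => /(proj1 (cl_eq _ _ _ _ none_in omega_emp omega_emp omega_emp)).
by rewrite !nadd_0 !nn_id //; apply: sc_not_emp.
Qed.

Let ww_in n : n ∈ omega -> ww n ∈ ZZ.
Proof.
move=> /omega_case [->|[k [Hk ->]]]; last by rewrite ww_S.
by rewrite /ww nrec_0 //; dd.
Qed.

Let double_neq0 x : x ∈ ZZ -> x <> z0 -> zadd x x <> z0.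
Proof.
move=> Hx N E; case: (zmul_eq0 x (zadd z1 z1)) => //.
- by rewrite -E; zring.
- rewrite /z1 zadd_cl // nadd_0 (nn_id emp) // => /(cl_eq0 _ (nadd_in _ _)).
  by rewrite /none nadd_S //; apply: sc_not_emp.
Qed.

Let ww_neq0 n : n ∈ omega -> ww n <> z0.
Proof.
move: n; apply: omega_ind; first by dd.
- by rewrite /ww nrec_0 //; dd.
- move=> n Hn IH; rewrite ww_S // => E; case: (zmul_eq0 _ _ _ _ E) => //; first exact: ww_in.
  by apply: double_neq0; [apply: A_in; apply: uu_in|apply: A_uu].
Qed.

Let ww_dvd n : n ∈ omega -> forall k, k ∈ omega -> n ∈ k ->
  exists z, z ∈ ZZ /\ ww k = zmul (ww (sc n)) z.
Proof.
move=> Hn; apply: omega_ind; first by dd.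
- by move=> /in_emp.
- move=> k Hk IH /in_sc [H|->].
  + case: (IH H) => z [Hz E]; exists (zmul (zadd (A (uu k)) (A (uu k))) z); split=> //.
    by rewrite ww_S // E; zring.
  + by exists z1; split=> //; have := ww_in _ (omega_sc _ Hk) => ?; zring.
Qed.

(** [cc e] is the pointwise sum of [w_n u_n] over [n] in [e]: since [u_n] vanishes below [n],
    coordinate [k] receives only the weights with [n <= k], hence the partial sum up to [sc k]. *)
Let ps (e : M) : M := lam omega (fun n => ite (n ∈ e) (ww n) z0).
Let cc (e : M) : M := lam omega (fun k => zsum (ps e) (sc k)).

Let Dps : Dt (fun e : nat -> M => ps (e 0)).
Proof. rewrite /ps; dd. Qed.

Let Dcc : Dt (fun e : nat -> M => cc (e 0)).
Proof. rewrite /cc; dd. Qed.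

Let app_ps e n : n ∈ omega -> app (ps e) n = ite (n ∈ e) (ww n) z0.
Proof. by move=> Hn; rewrite app_lam //; dd. Qed.

Let cc_in e : cc e ∈ funs omega ZZ.
Proof. by apply: lam_funs; [dd|move=> k Hk; apply: zsum_in; apply: omega_sc]. Qed.

Let app_cc e k : k ∈ omega -> app (cc e) k = zsum (ps e) (sc k).
Proof. by move=> Hk; rewrite app_lam //; dd. Qed.

(** Terms below [n] coincide, the term at [n] accounts for [w_n], and every later weight is a
    multiple of [w_(n+1)]. *)
Let partial_diff e e' n : n ∈ omega -> agree n e e' -> n ∈ e -> ~ n ∈ e' ->
  forall K, K ∈ omega -> exists d, d ∈ ZZ /\
    zsum (ps e) K = zadd (zadd (zsum (ps e') K) (ite (n ∈ K) (ww n) z0)) (zmul (ww (sc n)) d).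
Proof.
move=> Hn Ag Ne Ne'; apply: omega_ind; first by dd.
- exists z0; split=> //; rewrite !zsum_0 ite_false; first zring.
  exact: in_emp.
- move=> K HK [d [Hd E]].
  have S1 := zsum_in (ps e) K HK; have S2 := zsum_in (ps e') K HK.
  have W1 := ww_in _ Hn; have W2 := ww_in _ HK; have W3 := ww_in _ (omega_sc _ Hn).
  rewrite !zsum_S // E !app_ps //; case: (nat_total _ Hn _ HK) => [H|[H|H]].
  + exists d; split=> //.
    have -> : ite (K ∈ e) (ww K) z0 = ite (K ∈ e') (ww K) z0.
      rewrite /ite; have := Ag _ H; case: (decide _); case: (decide _); tauto.
    have N1 : ~ n ∈ K by move=> H'; apply: (nat_irrefl _ Hn); apply: (nat_trans _ Hn K).
    have N2 : ~ n ∈ sc K by move=> /in_sc [//|E']; subst K; apply: (nat_irrefl _ Hn).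
    have W4 : ite (K ∈ e') (ww K) z0 ∈ ZZ by rewrite /ite; case: (decide _).
    rewrite !(ite_false (n ∈ _)) //; zring.
  + subst K; exists d; split=> //.
    rewrite (ite_true (n ∈ e)) // (ite_false (n ∈ e')) // (ite_false (n ∈ n)); last exact: nat_irrefl.
    rewrite (ite_true (n ∈ sc n)); [zring|by apply/in_sc; right].
  + case: (ww_dvd n Hn K HK H) => z [Hz Ez].
    rewrite !(ite_true (n ∈ _)) //; last by apply/in_sc; left.
    rewrite Ez /ite; case: (decide _) => K1; case: (decide _) => K2.
    * exists d; split=> //; zring.
    * exists (zadd d z); split=> //; zring.
    * exists (zsub d z); split=> //; zring.
    * exists d; split=> //; zring.
Qed.

Let A_cc_neq e e' n : n ∈ omega -> agree n e e' -> n ∈ e -> ~ n ∈ e' -> A (cc e) <> A (cc e').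
Proof.
move=> Hn Ag Ne Ne' E.
have W1 := ww_in _ Hn; have W3 := ww_in _ (omega_sc _ Hn).
have N3 := ww_neq0 _ (omega_sc _ Hn).
set dq := fun k d => d ∈ ZZ /\
  zsum (ps e) (sc k) = zadd (zadd (zsum (ps e') (sc k)) (ite (n ∈ sc k) (ww n) z0)) (zmul (ww (sc n)) d).
have Ddq : Dp (fun v => dq (v 0) (v 1)) by rewrite /dq; dd.
(* The quotient is unique because [w_(n+1)] is nonzero, so the sequence [c2] of quotients is
   obtained without choice. *)
have T k : k ∈ omega -> dq k (the (dq k)).
{ move=> Hk; case: (partial_diff e e' n Hn Ag Ne Ne' (sc k) (omega_sc _ Hk)) => d [Hd Ed].
  apply: the_spec; exists d; split=> // d' [Hd' Ed'].
  rewrite Ed' in Ed; apply: zsub_eq0 => //.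
  case: (zmul_eq0 (ww (sc n)) (zsub d d')) => //.
  have -> : zmul (ww (sc n)) (zsub d d') =
    zsub (zadd (zadd (zsum (ps e') (sc k)) (ite (n ∈ sc k) (ww n) z0)) (zmul (ww (sc n)) d))
         (zadd (zadd (zsum (ps e') (sc k)) (ite (n ∈ sc k) (ww n) z0)) (zmul (ww (sc n)) d')) by zring.
  by rewrite Ed; zring. }
set c2 := lam omega (fun k => the (dq k)).
have H2 : c2 ∈ funs omega ZZ by apply: lam_funs; [dd|move=> k /T []].
have Dec : cc e = cadd (cadd (cc e') (csc (ww n) (uu n))) (csc (ww (sc n)) c2).
{ apply: c_ext; [exact: cc_in|exact: cadd_in|move=> k Hk].
  rewrite !app_cadd // !app_cc // !app_csc // app_uu // /c2 app_lam //.
  case: (T _ Hk) => Hd ->; congr zadd; congr zadd.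
  have Q : n ∈ sc k <-> ~ k ∈ n.
  { rewrite in_sc; split.
    - move=> [H|->]; last exact: nat_irrefl.
      by move=> H'; apply: (nat_irrefl _ Hn); apply: (nat_trans _ Hn k).
    - by move=> H; case: (nat_total _ Hn _ Hk) => [//|[->|]]; auto. }
  rewrite /ite; case: (decide (n ∈ sc k)) => K1; case: (decide (k ∈ n)) => K2; try tauto; zring. }
have Ku := A_in _ (uu_in n); have K2 := A_in _ H2; have Ke := A_in _ (cc_in e').
(* [A] is applied to [cc e = cc e' + w_n u_n + w_(n+1) c2]. As [w_(n+1) = 2 A(u_n) w_n], equal
   images give [w_n A(u_n) (1 + 2 A(c2)) = 0], whose last factor is odd. *)
have F : zmul (zmul (ww n) (A (uu n))) (zadd z1 (zadd (A c2) (A c2))) = z0.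
{ have -> : zmul (zmul (ww n) (A (uu n))) (zadd z1 (zadd (A c2) (A c2))) =
    zsub (zadd (zadd (A (cc e')) (zmul (ww n) (A (uu n))))
               (zmul (zmul (zadd (A (uu n)) (A (uu n))) (ww n)) (A c2))) (A (cc e')) by zring.
  rewrite -ww_S // -!A_csc //; last exact: uu_in.
  rewrite -!A_add //; try exact: cadd_in; try exact: cc_in.
  by rewrite -Dec E; zring. }
case: (zmul_eq0 _ _ _ _ F) => //.
- move=> F'; case: (zmul_eq0 _ _ _ _ F') => //; [exact: ww_neq0|exact: A_uu].
- move=> F'; apply: (z_parity (zneg (A c2))) => //.
  have -> : zadd (zneg (A c2)) (zneg (A c2)) = zsub z1 (zadd z1 (zadd (A c2) (A c2))) by zring.
  by rewrite F'; zring.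
Qed.

(** A form of Specker's theorem: [e |-> A (cc e)] would embed [P(omega)] in the countable set of
    integers. *)
Lemma slender : False.
Proof.
apply: cantor_omega; apply: inj_trans inj_ZZ_omega.
apply: (inj_intro _ _ (fun e => A (cc e))); first by dd.
- by move=> e _; apply: A_in; apply: cc_in.
- move=> e e' /in_pow He /in_pow He' E; apply: NNPP => N.
  case: (differ_ex _ _ He He' N) => n [Hn [Ag D]].
  case: (classic (n ∈ e)) => K1; case: (classic (n ∈ e')) => K2; try tauto.
  + exact: (A_cc_neq e e' n).
  + by apply: (A_cc_neq e' e n) => // i /Ag; tauto.
Qed.

End Slender.

Ltac dbase7 := fail.
Ltac dbase6 ::=
  lazymatch goal with
  | |- Dp (fun e => agree _ _ _) => apply: Dp_agree
  | |- Dp (fun e => differ_at _ _ _) => apply: Dp_differ_at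
  | _ => dbase7
  end.

(** * The group *)

Section Cylinders.
Context {M : set_structure} {HM : Model M}.
Implicit Types (a b c i k n s t x y z f g : M).

Add Ring int_ring : (@int_ring M HM) (setoid (@eqZ_equiv M HM) (@int_ring_ext M HM)).

Lemma agree_refl k x : agree k x x. Proof. by []. Qed.
Lemma agree_sym k x y : agree k x y -> agree k y x. Proof. by move=> H i Hi; rewrite H. Qed.
Lemma agree_trans k x y z : agree k x y -> agree k y z -> agree k x z.
Proof. by move=> H K i Hi; rewrite H // K. Qed.
Lemma agree_sub k k' x y : subset k k' -> agree k' x y -> agree k x y.
Proof. by move=> S H i /S; apply: H. Qed.

(* [(k, s)] stands for the cylinder of the subsets of omega agreeing with [s]
   below [k]; [refines k s k' s'] says that [(k', s')] is a smaller cylinder. *)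
Definition refines k s k' s' : Prop :=
  k' ∈ omega /\ s' ∈ pow omega /\ subset k k' /\ agree k s s'.
(** For persistent [Q] the cylinders satisfying [Q] cover a dense open set; open sets themselves are
    never formed. *)
Definition dense (Q : M -> M -> Prop) : Prop := forall k s, k ∈ omega -> s ∈ pow omega ->
  exists k' s', refines k s k' s' /\ Q k' s'.
Definition persistent (Q : M -> M -> Prop) : Prop :=
  forall k s k' s', refines k s k' s' -> Q k s -> Q k' s'.

Lemma Dp_refines (k1 s1 k2 s2 : (nat -> M) -> M) : Dt k1 -> Dt s1 -> Dt k2 -> Dt s2 ->
  Dp (fun e => refines (k1 e) (s1 e) (k2 e) (s2 e)).
Proof. move=> *; rewrite /refines; dd. Qed.

Lemma refines_refl k s : k ∈ omega -> s ∈ pow omega -> refines k s k s.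
Proof. by move=> Hk Hs; do 2 split=> //; split=> // x. Qed.

Lemma refines_trans k s k' s' k2 s2 : refines k s k' s' -> refines k' s' k2 s2 -> refines k s k2 s2.
Proof.
move=> [H1 [H2 [H3 H4]]] [K1 [K2 [K3 K4]]]; do 2 split=> //; split; first by move=> x /H3 /K3.
by apply: agree_trans H4 _; apply: agree_sub K4.
Qed.

Lemma dense_and Q R : persistent Q -> dense Q -> dense R -> dense (fun k s => Q k s /\ R k s).
Proof.
move=> P H K k s Hk Hs; case: (H k s Hk Hs) => k' [s' [E Q']].
case: (E) => Hk' [Hs' _]; case: (K k' s' Hk' Hs') => k2 [s2 [E2 R2]].
by exists k2, s2; split; [apply: refines_trans E2|split=> //; apply: P Q'].
Qed.

Lemma dense_impl Q R : (forall k s, k ∈ omega -> s ∈ pow omega -> Q k s -> R k s) -> dense Q -> dense R.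
Proof.
move=> H K k s Hk Hs; case: (K k s Hk Hs) => k' [s' [E Q']]; exists k', s'; split=> //.
by case: E => ? [? _]; apply: H.
Qed.

Definition on_cyl (P : M -> Prop) k s : Prop := forall y, y ∈ pow omega -> agree k s y -> P y.

Lemma on_cyl_persistent P : persistent (on_cyl P).
Proof.
move=> k s k' s' [_ [_ [S A]]] H y Hy Ay; apply: H => //.
by apply: agree_trans A _; apply: agree_sub Ay.
Qed.

Definition flip k s : M := sep omega (fun i => (i ∈ s /\ i <> k) \/ (i = k /\ ~ k ∈ s)).

Lemma in_flip k s i : i ∈ flip k s <-> i ∈ omega /\ ((i ∈ s /\ i <> k) \/ (i = k /\ ~ k ∈ s)).
Proof. by apply: in_sep. Qed.

Lemma flip_in k s : flip k s ∈ pow omega.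
Proof. by apply/in_pow => i /in_flip []. Qed.

Lemma agree_flip k s : k ∈ omega -> agree k s (flip k s).
Proof.
move=> Hk i Hi; rewrite in_flip; have Hi' := omega_trans _ Hk _ Hi.
have N : i <> k by move=> E; subst i; apply: (nat_irrefl _ Hk).
tauto.
Qed.

Lemma flip_differ k s : k ∈ omega -> ~ (k ∈ s <-> k ∈ flip k s).
Proof. move=> Hk; rewrite in_flip; tauto. Qed.

Lemma refine_differ k s b : k ∈ omega -> s ∈ pow omega ->
  exists s', refines k s (sc k) s' /\ ~ (k ∈ s' <-> k ∈ b).
Proof.
move=> Hk Hs; have S : subset k (sc k) by move=> x Hx; apply/in_sc; left.
case: (classic (k ∈ s <-> k ∈ b)) => H; last by exists s; split=> //; split; [exact: omega_sc|].
exists (flip k s); split; last by have := flip_differ k s Hk; tauto.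
split; first exact: omega_sc.
by split; [exact: flip_in|split=> //; apply: agree_flip].
Qed.

Lemma dense_neq b : dense (on_cyl (fun y => y <> b)).
Proof.
move=> k s Hk Hs; case: (refine_differ k s b Hk Hs) => s' [E N]; exists (sc k), s'; split=> //.
by move=> y Hy A E'; subst y; apply: N; apply: A; apply/in_sc; right.
Qed.

(* c at the first difference of x and b.  The value c(0) at x = b makes [FF b]
   map constant sequences to constant functions. *)
Definition FF b c x : M :=
  the (fun z => (x = b /\ z = app c emp) \/ exists n, n ∈ omega /\ differ_at n x b /\ z = app c n).

Lemma FF_same b c : FF b c b = app c emp.
Proof.
apply: the_eq; first by left.
by move=> z [[] //|[n [_ [[_ N] _]]]]; case: N.
Qed.

Lemma FF_differ b c x n : n ∈ omega -> differ_at n x b -> FF b c x = app c n.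
Proof.
move=> Hn D; apply: the_eq; first by right; exists n.
move=> z [[E _]|[m [Hm [D' ->]]]]; first by case: D => _ []; rewrite E.
by rewrite (differ_uniq _ _ _ _ Hm Hn D' D).
Qed.

(** The index [n] is chosen before [c]: for fixed [b] and [x] the map [c |-> FF b c x] is evaluation
    at one coordinate, hence additive. *)
Lemma FF_cases b x : b ∈ pow omega -> x ∈ pow omega ->
  exists n, n ∈ omega /\ forall c, FF b c x = app c n.
Proof.
move=> /in_pow Hb /in_pow Hx; case: (classic (x = b)) => [->|N].
- by exists emp; split=> // c; apply: FF_same.
- case: (differ_ex _ _ Hx Hb N) => n [Hn D]; exists n; split=> // c; exact: FF_differ.
Qed.

(** Once a cylinder is long enough to exclude [b], all its points first differ from [b] at the same
    place. *)
Lemma FF_locally_constant b c : b ∈ pow omega -> c ∈ funs omega ZZ ->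
  dense (fun k s => exists z, z ∈ ZZ /\ on_cyl (fun y => FF b c y = z) k s).
Proof.
move=> Hb Hc k s Hk Hs; case: (refine_differ k s b Hk Hs) => s' [E N]; exists (sc k), s'; split=> //.
case: (E) => _ [Hs' _]; have N' : s' <> b by move=> E'; apply: N; rewrite E'.
move/in_pow: (Hs') => Ss; move/in_pow: (Hb) => Sb.
case: (differ_ex _ _ Ss Sb N') => n [Hn [A D]].
exists (app c n); split; first exact: app_funs Hc Hn.
have Hns : n ∈ sc k.
{ apply: NNPP => K; have Hk' := omega_sc _ Hk; case: (nat_total _ Hk' _ Hn) => [//|K'].
  apply: N; apply: A; case: K' => [->|K']; first by apply/in_sc; right.
  by apply: (nat_trans _ Hn _ _ K'); apply/in_sc; right. }
move=> y Hy Ay; apply: FF_differ => //; split.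
- apply: agree_trans _ A; apply: agree_sym; apply: agree_sub Ay => i.
  by apply: nat_trans => //; apply: omega_sc.
- by move=> K; apply: D; rewrite -K; apply: Ay.
Qed.

(** First differing from [b] at some [n >= k] means agreeing with [b] below [k]. The point [b] is
    excluded since [FF] reads the coordinate 0 there. *)
Lemma FF_uu b k y : k ∈ omega -> b ∈ pow omega -> y ∈ pow omega -> y <> b ->
  FF b (uu k) y = ite (agree k b y) z1 z0.
Proof.
move=> Hk /in_pow Hb /in_pow Hy N; case: (differ_ex _ _ Hy Hb N) => n [Hn D].
rewrite (FF_differ _ _ _ n) // app_uu //; case: D => A D.
have Q : agree k b y <-> ~ n ∈ k.
{ split=> [K K'|K]; first by apply: D; rewrite K.
  apply: agree_sym; apply: agree_sub A; case: (nat_total _ Hn _ Hk) => [H|[->|//]] i //.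
  by apply: nat_trans. }
rewrite /ite; case: (decide (n ∈ k)) => K1; case: (decide (agree k b y)) => K2; tauto.
Qed.

End Cylinders.

Ltac dbase8 := fail.
Ltac dbase7 ::=
  lazymatch goal with
  | |- Dp (fun e => refines _ _ _ _) => apply: Dp_refines
  | |- Dt (fun e => flip _ _) => rewrite /flip; apply: Dt_sep
  | |- Dt (fun e => uu _) => rewrite /uu; apply: Dt_lam
  | |- Dt (fun e => cadd _ _) => rewrite /cadd; apply: Dt_lam
  | |- Dt (fun e => FF _ _ _) => rewrite /FF; apply: Dt_the
  | _ => dbase8
  end.

(** * The closure [S] and its size *)

Section Closure.
Context {M : set_structure} {HM : Model M}.
Variables (lambda : M).
Hypotheses (OL : ordinal lambda) (oL : subset omega lambda).
Hypothesis inj_prod : forall A B : M, inj A lambda -> inj B lambda -> inj (prod A B) lambda.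
Hypotheses (inj_pow : inj (pow omega) lambda) (inj_seq : inj (funs omega ZZ) lambda).
Implicit Types (a b c i k n s t x y z f g u v : M).

Add Ring int_ring : (@int_ring M HM) (setoid (@eqZ_equiv M HM) (@int_ring_ext M HM)).

Definition pts : M := prod lambda (pow omega).
Definition vl f a x : M := app f (opair a x).
(** A single operation keeps the codes simple. Constant sequences [c] make it yield zero, negatives
    and sums; a zero first argument makes it multiplication by [FF b c] up to sign. *)
Definition op f g b c : M :=
  lam pts (fun q => zsub (app f q) (zmul (FF b c (pr2 q)) (app g q))).
Definition gen a : M := lam pts (fun q => ite (pr1 q = a) z1 z0).
Definition cst z : M := lam omega (fun _ => z).

Let Dop (s1 s2 s3 s4 : (nat -> M) -> M) : Dt s1 -> Dt s2 -> Dt s3 -> Dt s4 ->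
  Dt (fun e => op (s1 e) (s2 e) (s3 e) (s4 e)).
Proof. move=> *; rewrite /op; dd. Qed.

Let Dvl : Dt (fun e => vl (e 0) (e 1) (e 2)).
Proof. rewrite /vl; dd. Qed.

Let Dgen : Dt (fun e => gen (e 0)).
Proof. rewrite /gen; dd. Qed.

Lemma in_pts a x : opair a x ∈ pts <-> a ∈ lambda /\ x ∈ pow omega.
Proof. exact: in_prod_opair. Qed.

Lemma vl_lam (F : M -> M) a x : Dt (fun e => F (e 0)) -> a ∈ lambda -> x ∈ pow omega ->
  vl (lam pts F) a x = F (opair a x).
Proof. by move=> D Ha Hx; rewrite /vl app_lam //; apply/in_pts. Qed.

Lemma vl_op f g b c a x : a ∈ lambda -> x ∈ pow omega ->
  vl (op f g b c) a x = zsub (vl f a x) (zmul (FF b c x) (vl g a x)).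
Proof. by move=> Ha Hx; rewrite /op vl_lam // ?pr2_opair //; dd. Qed.

Lemma vl_in f a x : f ∈ funs pts ZZ -> a ∈ lambda -> x ∈ pow omega -> vl f a x ∈ ZZ.
Proof. by move=> Hf Ha Hx; apply: app_funs Hf _; apply/in_pts. Qed.

Lemma pts_ext f g : f ∈ funs pts ZZ -> g ∈ funs pts ZZ ->
  (forall a x, a ∈ lambda -> x ∈ pow omega -> vl f a x = vl g a x) -> f = g.
Proof.
move=> Hf Hg H; apply: (funs_ext _ _ _ _ _ Hf Hg) => q /in_prod [a [x [Ha [Hx ->]]]]; exact: H.
Qed.

Lemma op_in f g b c : op f g b c ∈ funs pts ZZ.
Proof. by apply: lam_funs; [dd|]. Qed.

Lemma gen_in a : gen a ∈ funs pts ZZ.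
Proof. by apply: lam_funs => // q _; rewrite /ite; case: (decide _). Qed.

Lemma cst_in z : z ∈ ZZ -> cst z ∈ funs omega ZZ.
Proof. by move=> Hz; apply: lam_funs. Qed.

Lemma FF_cst b z x : b ∈ pow omega -> x ∈ pow omega -> FF b (cst z) x = z.
Proof.
by move=> Hb Hx; case: (FF_cases b x Hb Hx) => n [Hn ->]; rewrite app_lam.
Qed.

Lemma pow_emp : emp ∈ pow omega.
Proof. by apply/in_pow => x /in_emp. Qed.
Hint Resolve pow_emp : core.

(** A code consists of the indices of two functions already enumerated and the data [b], [c] of an
    application of [op]. *)
Let J : M := prod (prod lambda lambda) (prod (pow omega) (funs omega ZZ)).

Let inj_J : inj J lambda.
Proof. by apply: inj_prod; apply: inj_prod => //; apply: inj_subset. Qed.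

Let seed : M := lam lambda gen.
Let opq h q : M := op (app h (pr1 (pr1 q))) (app h (pr2 (pr1 q))) (pr1 (pr2 q)) (pr2 (pr2 q)).

Let Dopq (s1 s2 : (nat -> M) -> M) : Dt s1 -> Dt s2 -> Dt (fun e => opq (s1 e) (s2 e)).
Proof. by move=> *; rewrite /opq; apply: Dop; dd. Qed.

(* [stage j n], for [j] an injection of the codes [J] into lambda, enumerates
   by lambda what is obtained from the generators by [n] rounds of [op]. *)
Let dec j c : M := the (fun q => q ∈ J /\ app j q = c).
Let next j h : M := lam lambda (fun c =>
  ite (exists q, q ∈ J /\ app j q = c) (opq h (dec j c)) (app h c)).
Let stage j n : M := nrec seed (fun _ h => next j h) n.

Let Ddec : Dt (fun e => dec (e 0) (e 1)).
Proof. rewrite /dec; dd. Qed.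

Let Dnext : Dt (fun e => next (e 0) (e 1)).
Proof. by rewrite /next; apply: Dt_lam; [dd|apply: Dt_ite; [dd|apply: Dopq; dd|dd]]. Qed.

Let Dstage : Dt (fun e => stage (e 0) (e 1)).
Proof. by rewrite /stage; apply: Dt_nrec; dd. Qed.

(** [S] is the union of countably many stages, each indexed by [lambda], which bounds its size. The
    last clause comes from induction over the stages, whence its restriction to definable [P]. *)
Lemma closure_exists : exists S : M,
  inj S lambda /\ (forall a, a ∈ lambda -> gen a ∈ S) /\
  (forall f g b c, f ∈ S -> g ∈ S -> b ∈ pow omega -> c ∈ funs omega ZZ -> op f g b c ∈ S) /\
  (forall P : M -> Prop, Dp (fun e => P (e 0)) -> (forall a, a ∈ lambda -> P (gen a)) ->
    (forall f g b c, b ∈ pow omega -> c ∈ funs omega ZZ -> P f -> P g -> P (op f g b c)) ->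
    forall f, f ∈ S -> P f).
Proof.
case: inj_J => j Hj; case/is_inj_elim: (Hj) => j1 j2.
have dec_j q : q ∈ J -> dec j (app j q) = q by move=> Hq; apply: the_eq => // q' [Hq' E]; apply: j2.
have stage_0 a : a ∈ lambda -> app (stage j emp) a = gen a.
  by move=> Ha; rewrite /stage nrec_0; dd; rewrite /seed app_lam.
have stage_S n c : n ∈ omega -> c ∈ lambda -> app (stage j (sc n)) c =
    ite (exists q, q ∈ J /\ app j q = c) (opq (stage j n) (dec j c)) (app (stage j n) c).
  move=> Hn Hc; rewrite /stage nrec_S //.
  rewrite {1}/next app_lam //; by apply: Dt_ite; [dd|apply: Dopq; dd|dd].
have stage_in n : n ∈ omega -> forall c, c ∈ lambda -> app (stage j n) c ∈ funs pts ZZ.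
{ move: n; apply: omega_ind; first by dd.
  - by move=> c Hc; rewrite stage_0 //; apply: gen_in.
  - move=> n Hn IH c Hc; rewrite stage_S // /ite; case: (decide _) => _; [exact: op_in|exact: IH]. }
set val := fun n f => exists c, c ∈ lambda /\ f = app (stage j n) c.
have val_op n f g b c : n ∈ omega -> val n f -> val n g -> b ∈ pow omega -> c ∈ funs omega ZZ ->
    val (sc n) (op f g b c).
{ move=> Hn [x [Hx ->]] [y [Hy ->]] Hb Hc.
  have Hq : opair (opair x y) (opair b c) ∈ J by rewrite /J !in_prod_opair.
  exists (app j (opair (opair x y) (opair b c))); split; first exact: j1.
  rewrite stage_S //; last exact: j1.
  rewrite ite_true; last by exists (opair (opair x y) (opair b c)).
  by rewrite dec_j // /opq !(pr1_opair, pr2_opair). }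
have val_S n f : n ∈ omega -> val n f -> val (sc n) f.
{ move=> Hn V; have Hf : f ∈ funs pts ZZ by case: V => c [Hc ->]; apply: stage_in.
  (* The index of [f] may be overwritten at the next stage, so [f] is preserved by rebuilding it as
     [f - 0 f]. *)
  have -> : f = op f f emp (cst z0).
  { apply: pts_ext => //; first exact: op_in.
    move=> a x Ha Hx; rewrite vl_op // FF_cst //; have := vl_in f a x Hf Ha Hx => ?; zring. }
  by apply: val_op => //; apply: cst_in. }
have val_le m : m ∈ omega -> forall n f, n ∈ omega -> subset n m -> val n f -> val m f.
{ move: m; apply: omega_ind; first by rewrite /val; dd.
  - move=> n f Hn Sn; case: (omega_case _ Hn) => [-> //|[k [Hk E]]].
    by case: (in_emp emp); apply: Sn; rewrite E; apply: emp_in_sc.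
  - move=> m Hm IH n f Hn Sn V; case: (nat_total _ (omega_sc _ Hm) _ Hn) => [K|[<- //|K]].
    + apply: val_S => //; apply: (IH n) => //.
      by move/in_sc: K => [K|-> //] x; apply: nat_trans.
    + by case: (nat_irrefl (sc m)); auto. }
set S := img (prod omega lambda) (fun q => app (stage j (pr1 q)) (pr2 q)).
have inS f : f ∈ S <-> exists n, n ∈ omega /\ val n f.
{ rewrite /S in_img; last by dd.
  split.
  - by move=> [q [/in_prod [n [c [Hn [Hc ->]]]]]]; rewrite pr1_opair pr2_opair => ->; exists n; split=> //; exists c.
  - by move=> [n [Hn [c [Hc ->]]]]; exists (opair n c); rewrite in_prod_opair pr1_opair pr2_opair. }
exists S; split; last split; last split.
- have PL : inj (prod omega lambda) lambda by apply: inj_prod; apply: inj_subset.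
  apply: (inj_trans _ _ _ _ PL).
  apply: (inj_image (prod omega lambda) S lambda (fun q => app (stage j (pr1 q)) (pr2 q)) OL) => //.
  move=> f /inS [n [Hn [c [Hc ->]]]]; exists (opair n c).
  by rewrite in_prod_opair pr1_opair pr2_opair.
- by move=> a Ha; apply/inS; exists emp; split=> //; exists a; rewrite stage_0.
- move=> f g b c /inS [n [Hn Vn]] /inS [m [Hm Vm]] Hb Hc.
  case: (nat_max _ _ Hn Hm) => k [Hk [S1 S2]]; apply/inS; exists (sc k); split; first exact: omega_sc.
  by apply: val_op => //; [apply: (val_le k Hk n)|apply: (val_le k Hk m)].
- move=> P DP Pg Pop f /inS [n [Hn [c [Hc ->]]]]; move: n Hn c Hc; apply: omega_ind; first by dd.
  + by move=> c Hc; rewrite stage_0 //; apply: Pg.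
  + move=> n Hn IH c Hc; rewrite stage_S // /ite; case: (decide _) => [[q [Hq E]]|_]; last exact: IH.
    rewrite -E dec_j //; move: Hq => /in_prod [r [t [/in_prod [x [y [Hx [Hy ->]]]] [/in_prod [b [d [Hb [Hd ->]]]] ->]]]].
    by rewrite /opq !(pr1_opair, pr2_opair); apply: Pop => //; apply: IH.
Qed.

End Closure.

(** * The quotient group and its properties *)

Section Quotient.
Context {M : set_structure} {HM : Model M}.
Variables (lambda S : M).
Hypotheses (OL : ordinal lambda) (oL : subset omega lambda).
Hypothesis inj_prod : forall A B : M, inj A lambda -> inj B lambda -> inj (prod A B) lambda.
Hypotheses (inj_pow : inj (pow omega) lambda).
Hypothesis S_inj : inj S lambda.
Hypothesis S_gen : forall a, a ∈ lambda -> gen lambda a ∈ S.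
Hypothesis S_op : forall f g b c, f ∈ S -> g ∈ S -> b ∈ pow omega -> c ∈ funs omega ZZ ->
  op lambda f g b c ∈ S.
Hypothesis S_ind : forall P : M -> Prop, Dp (fun e => P (e 0)) ->
  (forall a, a ∈ lambda -> P (gen lambda a)) ->
  (forall f g b c, b ∈ pow omega -> c ∈ funs omega ZZ -> P f -> P g -> P (op lambda f g b c)) ->
  forall f, f ∈ S -> P f.
Implicit Types (a b c i k n s t x y z f g u v w : M).

Add Ring int_ring : (@int_ring M HM) (setoid (@eqZ_equiv M HM) (@int_ring_ext M HM)).

Hint Resolve pow_emp cst_in : core.

Let pts := pts lambda.

Let Dvl : Dt (fun e : nat -> M => vl (e 0) (e 1) (e 2)).
Proof. rewrite /vl; dd. Qed.

Definition eqv f g : Prop := forall a, a ∈ lambda -> dense (on_cyl (fun y => vl f a y = vl g a y)).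
(** Local constancy on a dense open subset of each copy. It passes through [op] because [FF b c] has
    it, so all of [S] enjoys it. *)
Definition dlc f : Prop := forall a, a ∈ lambda ->
  dense (fun k s => exists z, z ∈ ZZ /\ on_cyl (fun y => vl f a y = z) k s).

Let Deqv : Dp (fun e => eqv (e 0) (e 1)).
Proof. rewrite /eqv /dense /on_cyl; dd. Qed.

Let Ddlc : Dp (fun e => dlc (e 0)).
Proof. rewrite /dlc /dense /on_cyl; dd. Qed.

Let loc_persistent f a : persistent (fun k s => exists z, z ∈ ZZ /\ on_cyl (fun y => vl f a y = z) k s).
Proof. by move=> k s k' s' R [z [Hz H]]; exists z; split=> //; apply: on_cyl_persistent R H. Qed.

Let dlc_gen a : dlc (gen lambda a).
Proof.
move=> a' Ha' k s Hk Hs; exists k, s; split; first exact: refines_refl.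
exists (ite (a' = a) z1 z0); split; first by rewrite /ite; case: (decide _).
by move=> y Hy _; rewrite /gen vl_lam // pr1_opair.
Qed.

Let dlc_op f g b c : b ∈ pow omega -> c ∈ funs omega ZZ -> dlc f -> dlc g -> dlc (op lambda f g b c).
Proof.
move=> Hb Hc Hf Hg a Ha.
have H := dense_and _ _ (loc_persistent f a) (Hf a Ha)
  (dense_and _ _ (loc_persistent g a) (Hg a Ha) (FF_locally_constant b c Hb Hc)).
apply: dense_impl H => k s Hk Hs [[z [Hz E]] [[z' [Hz' E']] [z2 [Hz2 E2]]]].
exists (zsub z (zmul z2 z')); split=> // y Hy Ay.
by rewrite vl_op // E // E' // E2.
Qed.

Let S_dlc f : f ∈ S -> dlc f.
Proof. exact: (S_ind dlc Ddlc (fun a _ => dlc_gen a) dlc_op). Qed.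

Let S_funs f : f ∈ S -> f ∈ funs pts ZZ.
Proof. by apply: (S_ind (fun f => f ∈ funs pts ZZ)); [dd|move=> *; apply: gen_in|move=> *; apply: op_in]. Qed.

Let vlS f a x : f ∈ S -> a ∈ lambda -> x ∈ pow omega -> vl f a x ∈ ZZ.
Proof. by move=> /S_funs Hf; apply: vl_in. Qed.

Definition fadd f g : M := lam pts (fun q => zadd (app f q) (app g q)).
Definition mulF f b c : M := lam pts (fun q => zmul (FF b c (pr2 q)) (app f q)).
Definition fzero : M := lam pts (fun _ => z0).
Definition fneg f : M := lam pts (fun q => zneg (app f q)).

Let Dfadd : Dt (fun e => fadd (e 0) (e 1)).
Proof. rewrite /fadd; dd. Qed.

Let DmulF : Dt (fun e => mulF (e 0) (e 1) (e 2)).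
Proof. rewrite /mulF; dd. Qed.

Let vl_fadd f g a x : a ∈ lambda -> x ∈ pow omega -> vl (fadd f g) a x = zadd (vl f a x) (vl g a x).
Proof. by move=> Ha Hx; rewrite /fadd vl_lam. Qed.

Let vl_mulF f b c a x : a ∈ lambda -> x ∈ pow omega ->
  vl (mulF f b c) a x = zmul (FF b c x) (vl f a x).
Proof. by move=> Ha Hx; rewrite /mulF vl_lam ?pr2_opair //; dd. Qed.

Let vl_fzero a x : a ∈ lambda -> x ∈ pow omega -> vl fzero a x = z0.
Proof. by move=> Ha Hx; rewrite /fzero vl_lam. Qed.

Let vl_fneg f a x : a ∈ lambda -> x ∈ pow omega -> vl (fneg f) a x = zneg (vl f a x).
Proof. by move=> Ha Hx; rewrite /fneg vl_lam. Qed.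

Let fadd_funs f g : fadd f g ∈ funs pts ZZ. Proof. by apply: lam_funs. Qed.
Let mulF_funs f b c : mulF f b c ∈ funs pts ZZ. Proof. by apply: lam_funs; [dd|]. Qed.
Let fzero_funs : fzero ∈ funs pts ZZ. Proof. by apply: lam_funs. Qed.
Let fneg_funs f : fneg f ∈ funs pts ZZ. Proof. by apply: lam_funs. Qed.

Let S_fzero : fzero ∈ S.
Proof.
have H0 : gen lambda emp ∈ S by apply/S_gen/oL.
have -> : fzero = op lambda (gen lambda emp) (gen lambda emp) emp (cst z1).
{ apply: (pts_ext lambda) => //; first exact: op_in.
  move=> a x Ha Hx; rewrite vl_fzero // vl_op // FF_cst //.
  have := vlS _ a x H0 Ha Hx => ?; zring. }
by apply: S_op => //; apply: cst_in.
Qed.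

Let S_fneg f : f ∈ S -> fneg f ∈ S.
Proof.
move=> Hf; have -> : fneg f = op lambda fzero f emp (cst z1).
{ apply: (pts_ext lambda) => //; first exact: op_in.
  move=> a x Ha Hx; rewrite vl_fneg // vl_op // FF_cst // vl_fzero //; zring. }
by apply: S_op => //; apply: cst_in.
Qed.

Let S_fadd f g : f ∈ S -> g ∈ S -> fadd f g ∈ S.
Proof.
move=> Hf Hg; have -> : fadd f g = op lambda f (fneg g) emp (cst z1).
{ apply: (pts_ext lambda) => //; first exact: op_in.
  move=> a x Ha Hx; rewrite vl_fadd // vl_op // FF_cst // vl_fneg //; zring. }
by apply: S_op => //; [exact: S_fneg|apply: cst_in].
Qed.

Let S_mulF f b c : f ∈ S -> b ∈ pow omega -> c ∈ funs omega ZZ -> mulF f b c ∈ S.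
Proof.
move=> Hf Hb Hc; have -> : mulF f b c = op lambda fzero (fneg f) b c.
{ apply: (pts_ext lambda) => //; first exact: op_in.
  move=> a x Ha Hx; rewrite vl_mulF // vl_op // vl_fzero // vl_fneg //; zring. }
by apply: S_op => //; exact: S_fneg.
Qed.

Let eqv_refl f : eqv f f.
Proof. by move=> a Ha k s Hk Hs; exists k, s; split=> //; apply: refines_refl. Qed.

Let eqv_sym f g : eqv f g -> eqv g f.
Proof. by move=> H a Ha; apply: dense_impl (H a Ha) => k s _ _ K y Hy Ay; rewrite K. Qed.

Let eqv_trans f g h : eqv f g -> eqv g h -> eqv f h.
Proof.
move=> H K a Ha.
apply: dense_impl (dense_and _ _ (on_cyl_persistent _) (H a Ha) (K a Ha)) => k s _ _ [E E'] y Hy Ay.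
by rewrite E // E'.
Qed.

Let eqv_fadd f f' g g' : eqv f f' -> eqv g g' -> eqv (fadd f g) (fadd f' g').
Proof.
move=> H K a Ha.
apply: dense_impl (dense_and _ _ (on_cyl_persistent _) (H a Ha) (K a Ha)) => k s _ _ [E E'] y Hy Ay.
by rewrite !vl_fadd // E // E'.
Qed.

Definition cls f : M := sep S (fun g => eqv f g).
Definition GG : M := img S cls.
Definition gop u v : M :=
  the (fun w => exists f g, f ∈ S /\ g ∈ S /\ u = cls f /\ v = cls g /\ w = cls (fadd f g)).
Definition pG : M := mkop GG gop.

Let Dcls : Dt (fun e => cls (e 0)).
Proof. rewrite /cls; dd. Qed.

Let Dgop : Dt (fun e => gop (e 0) (e 1)).
Proof. rewrite /gop; dd. Qed.

Let in_cls f g : g ∈ cls f <-> g ∈ S /\ eqv f g.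
Proof. by apply: in_sep. Qed.

Let cls_eq f g : g ∈ S -> cls f = cls g <-> eqv f g.
Proof.
move=> Hg; split=> [E|E].
- have : g ∈ cls f by rewrite E; apply/in_cls.
  by move/in_cls => [].
- apply: ext => h; rewrite !in_cls; split=> -[Hh K]; split=> //.
  + exact: eqv_trans (eqv_sym _ _ E) K.
  + exact: eqv_trans E K.
Qed.

Let in_GG u : u ∈ GG <-> exists f, f ∈ S /\ u = cls f.
Proof. exact: in_img. Qed.

Let cls_in f : f ∈ S -> cls f ∈ GG.
Proof. by move=> Hf; apply/in_GG; exists f. Qed.

Let gop_cls f g : f ∈ S -> g ∈ S -> gop (cls f) (cls g) = cls (fadd f g).
Proof.
move=> Hf Hg; apply: the_eq; first by exists f, g.
move=> w [f' [g' [Hf' [Hg' [/(cls_eq _ _ Hf') E [/(cls_eq _ _ Hg') E' ->]]]]]].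
by symmetry; apply/cls_eq; [exact: S_fadd|exact: eqv_fadd].
Qed.

Let app2_pG u v w : app2 pG u v w <-> u ∈ GG /\ v ∈ GG /\ w = gop u v.
Proof. exact: app2_mkop. Qed.

Lemma abelian_G : abelian_group GG pG.
Proof.
apply: (abelian_group_mkop GG gop (cls fzero)) => //.
- by move=> u v /in_GG [f [Hf ->]] /in_GG [g [Hg ->]]; rewrite gop_cls //; apply/cls_in/S_fadd.
- move=> u v w /in_GG [f [Hf ->]] /in_GG [g [Hg ->]] /in_GG [h [Hh ->]].
  have K1 := S_fadd _ _ Hf Hg; have K2 := S_fadd _ _ Hg Hh.
  rewrite !gop_cls //; congr cls; apply: (pts_ext lambda) => // a x Ha Hx.
  rewrite !vl_fadd //; zring.
- move=> u v /in_GG [f [Hf ->]] /in_GG [g [Hg ->]]; rewrite !gop_cls //; congr cls.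
  apply: (pts_ext lambda) => // a x Ha Hx; rewrite !vl_fadd //; zring.
- exact: cls_in.
- move=> u /in_GG [f [Hf ->]]; rewrite gop_cls //; congr cls.
  apply: (pts_ext lambda) => //; first exact: S_funs.
  move=> a x Ha Hx; rewrite vl_fadd // vl_fzero //; have := vlS f a x Hf Ha Hx => ?; zring.
- move=> u /in_GG [f [Hf ->]]; exists (cls (fneg f)); split; first exact/cls_in/S_fneg.
  rewrite gop_cls //; last exact: S_fneg.
  congr cls; apply: (pts_ext lambda) => // a x Ha Hx; rewrite vl_fadd // vl_fzero // vl_fneg //; zring.
Qed.

Let z1_neq0 : (z1 : M) <> z0.
Proof.
rewrite /z1 /z0 => /(proj1 (cl_eq _ _ _ _ none_in omega_emp omega_emp omega_emp)).
by rewrite !nadd_0 !nn_id //; apply: sc_not_emp.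
Qed.

Lemma card_G : equipotent GG lambda.
Proof.
apply: bernstein.
- apply: (inj_trans _ _ _ _ S_inj); apply: (inj_image S GG lambda cls OL) => //.
  by move=> u /in_GG.
- apply: (inj_intro _ _ (fun a => cls (gen lambda a))).
  + by rewrite /gen; dd.
  + by move=> a Ha; apply/cls_in/S_gen.
  + move=> a b Ha Hb /(cls_eq _ _ (S_gen _ Hb)) E; apply: NNPP => N.
    (* On copy [a] the two indicators are constantly 1 and constantly 0, so no cylinder sees them
       agree. *)
    case: (E a Ha emp emp omega_emp pow_emp) => k [s [[_ [Hs _]] K]].
    have := K s Hs (agree_refl k s); rewrite /gen !vl_lam // !pr1_opair.
    by rewrite ite_true // ite_false.
Qed.

Lemma dual_G : trivial_dual GG pG.
Proof.
exists ZZ, pZZ; split; first exact: integers_ZZ.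
move=> h [Hh Hadd] u z /(rel_app _ _ _ _ _ Hh) [/in_GG [f0 [Hf0 ->]] ->]; apply/is_zero_ZZ.
have H_in f : f ∈ S -> app h (cls f) ∈ ZZ by move=> Hf; apply: (app_in _ _ _ _ Hh); apply: cls_in.
have H_add f g : f ∈ S -> g ∈ S -> app h (cls (fadd f g)) = zadd (app h (cls f)) (app h (cls g)).
{ move=> Hf Hg; have Hfg := S_fadd _ _ Hf Hg.
  have /app2_pZZ [_ [_ //]] : app2 pZZ (app h (cls f)) (app h (cls g)) (app h (cls (fadd f g))).
  apply: (Hadd (cls f) (cls g) (cls (fadd f g))); try exact: cls_in.
  - by apply/app2_pG; rewrite gop_cls //; do !split=> //; apply: cls_in.
  - by apply/(rel_app _ _ _ _ _ Hh); split=> //; apply: cls_in.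
  - by apply/(rel_app _ _ _ _ _ Hh); split=> //; apply: cls_in.
  - by apply/(rel_app _ _ _ _ _ Hh); split=> //; apply: cls_in. }
apply: NNPP => N0; move: f0 Hf0 N0 => f Hf N0.
(* [m k s] is the value of [h] at [f] cut down to the cylinder [(k, s)], up to an error at the point
   [s] that the class ignores. *)
set m := fun k s => app h (cls (mulF f s (uu k))).
have Dm : Dt (fun e => m (e 0) (e 1)) by rewrite /m; dd.
have m_0 : m emp emp = app h (cls f).
{ rewrite /m; congr app; congr cls; apply: (pts_ext lambda) => //; first exact: S_funs.
  move=> a x Ha Hx; rewrite vl_mulF //; case: (FF_cases emp x) => // n [Hn ->].
  rewrite app_uu // ite_false; last exact: in_emp.
  have := vlS f a x Hf Ha Hx => ?; zring. }
(* The two realisations of the same indicator can differ only at [s] and [b], and cylinders avoiding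
   both points are dense. *)
have m_ext k s b : k ∈ omega -> s ∈ pow omega -> b ∈ pow omega -> agree k s b -> m k s = m k b.
{ move=> Hk Hs Hb Ag; rewrite /m; congr app; apply/cls_eq; first by apply: S_mulF => //; apply: uu_in.
  move=> a Ha; apply: dense_impl (dense_and _ _ (on_cyl_persistent _) (dense_neq s) (dense_neq b)) => k' s' _ _ [E1 E2] y Hy Ay; rewrite !vl_mulF //; congr zmul.
  have F1 := E1 y Hy Ay; have F2 := E2 y Hy Ay; rewrite !FF_uu // /ite.
  case: (decide (agree k s y)) => Q1; case: (decide (agree k b y)) => Q2 //.
  - by case: Q2; apply: agree_trans (agree_sym _ _ _ Ag) Q1.
  - by case: Q1; apply: agree_trans Ag Q2. }
(* The cylinder is halved according to membership of [k]; [flip k s] names the half not containing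
   [s]. *)
have m_split k s : k ∈ omega -> s ∈ pow omega -> m k s = zadd (m (sc k) s) (m (sc k) (flip k s)).
{ move=> Hk Hs; have Hk' := omega_sc _ Hk; have Hfl := flip_in k s.
  have U := uu_in (sc k).
  rewrite /m -H_add; try by apply: S_mulF.
  congr app; apply/cls_eq; first by apply: S_fadd; apply: S_mulF.
  move=> a Ha; apply: dense_impl (dense_and _ _ (on_cyl_persistent _) (dense_neq s) (dense_neq (flip k s))) => k' s' _ _ [E1 E2] y Hy Ay.
  have F1 := E1 y Hy Ay; have F2 := E2 y Hy Ay.
  rewrite vl_fadd // !vl_mulF // !FF_uu //.
  have Kf := vlS f a y Hf Ha Hy.
  have A1 : agree (sc k) s y <-> agree k s y /\ (k ∈ s <-> k ∈ y).
  { split=> [Q|[Q1 Q2] i /in_sc [Hi|-> //]]; last exact: Q1.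
    by split; [move=> i Hi; apply: Q; apply/in_sc; left|apply: Q; apply/in_sc; right]. }
  have A2 : agree (sc k) (flip k s) y <-> agree k s y /\ ~ (k ∈ s <-> k ∈ y).
  { have Af := agree_flip k s Hk; have Nf := flip_differ k s Hk.
    split=> [Q|[Q1 Q2] i /in_sc [Hi|->]].
    - have Q1 : agree k (flip k s) y by move=> i Hi; apply: Q; apply/in_sc; left.
      split; first exact: agree_trans Af Q1.
      have : k ∈ flip k s <-> k ∈ y by apply: Q; apply/in_sc; right.
      tauto.
    - by rewrite -(Af i Hi); apply: Q1.
    - by move: Nf Q2; clear; tauto. }
  rewrite /ite; case: (decide (agree k s y)) => Q1; case: (decide (agree (sc k) s y)) => Q2;
    case: (decide (agree (sc k) (flip k s) y)) => Q3; try tauto; zring. }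
have mE k s : m k s = app h (cls (mulF f s (uu k))) by [].
clearbody m.
(* The branch stays with [s] if its half has nonzero value; otherwise [m_split] makes the other half
   nonzero. *)
set br := fun k => nrec emp (fun k s => ite (m (sc k) s <> z0) s (flip k s)) k.
have Dbr : Dt (fun e => br (e 0)) by rewrite /br; dd.
have br_S k : k ∈ omega -> br (sc k) = ite (m (sc k) (br k) <> z0) (br k) (flip k (br k)).
  by move=> Hk; rewrite /br nrec_S //; dd.
have br_spec k : k ∈ omega -> br k ∈ pow omega /\ m k (br k) <> z0.
{ move: k; apply: omega_ind; first by dd.
  - by rewrite /br nrec_0; dd; rewrite m_0.
  - move=> k Hk [Hb Nb]; rewrite br_S //.
    case: (classic (m (sc k) (br k) <> z0)) => K; first by rewrite ite_true.
    rewrite ite_false //; split; first exact: flip_in.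
    move=> E; apply: Nb; rewrite m_split // E; have -> : m (sc k) (br k) = z0 by apply: NNPP.
    by zring. }
have br_agree k : k ∈ omega -> agree k (br k) (br (sc k)).
{ move=> Hk; rewrite br_S // /ite; case: (decide _) => _; [exact: agree_refl|exact: agree_flip]. }
(* Membership of [i] may still be flipped in passing from [br i] to [br (sc i)], and is final from
   then on. *)
set b := sep omega (fun i => i ∈ br (sc i)).
have in_b i : i ∈ b <-> i ∈ omega /\ i ∈ br (sc i) by apply: in_sep; dd.
have Hb : b ∈ pow omega by apply/in_pow => i /in_b [].
have b_agree k : k ∈ omega -> agree k (br k) b.
{ move: k; apply: omega_ind; first by dd.
  - by move=> i /in_emp.
  - move=> k Hk IH i /in_sc [Hi|->].
    + by rewrite -(br_agree k Hk i Hi); apply: IH.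
    + by rewrite in_b; tauto. }
(* At [uu k] this map takes the value [m k b = m k (br k)], which is nonzero for all [k]. *)
apply: (slender (fun c => app h (cls (mulF f b c)))).
- by dd.
- by move=> c Hc; apply/H_in/S_mulF.
- move=> c d Hc Hd; rewrite -H_add; try by apply: S_mulF.
  congr app; congr cls; apply: (pts_ext lambda) => // a x Ha Hx.
  rewrite vl_fadd // !vl_mulF //; case: (FF_cases b x) => // n [Hn E].
  rewrite !E app_cadd //; zring.
- move=> k Hk; case: (br_spec k Hk) => Hbk Nb.
  by rewrite -mE -(m_ext k (br k) b) //; apply: b_agree.
Qed.

(** The value of a class at a point of copy [a]. Representatives can be altered at single points, so
    the value is read off one that is constant near [x]. *)
Let locv g a x z : Prop := exists f, f ∈ g /\ exists k, k ∈ omega /\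
  forall y, y ∈ pow omega -> agree k x y -> vl f a y = z.

Let Dlocv (s1 s2 s3 s4 : (nat -> M) -> M) : Dt s1 -> Dt s2 -> Dt s3 -> Dt s4 ->
  Dp (fun e => locv (s1 e) (s2 e) (s3 e) (s4 e)).
Proof. move=> *; rewrite /locv; dd. Qed.

(** Two representatives agree on a dense open set, which meets every common neighbourhood of [x]. *)
Let locv_uniq g a x z z' : g ∈ GG -> a ∈ lambda -> x ∈ pow omega ->
  locv g a x z -> locv g a x z' -> z = z'.
Proof.
move=> /in_GG [f0 [Hf0 ->]] Ha Hx [f [/in_cls [Hf E] [k [Hk K]]]] [f' [/in_cls [Hf' E'] [k' [Hk' K']]]].
case: (nat_max _ _ Hk Hk') => n [Hn [S1 S2]].
case: (eqv_trans _ _ _ (eqv_sym _ _ E) E' a Ha n x Hn Hx) => k2 [s2 [[Hk2 [Hs2 [Sk A]]] Q]].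
rewrite -(K s2) //; last exact: agree_sub A.
rewrite -(K' s2) //; last exact: agree_sub A.
by apply: Q.
Qed.

Lemma aleph1_free_G : aleph1_free GG pG.
Proof.
move=> H pH [HS [HA Hp]] [w [phi [/is_omega_eq -> Hphi]]].
set I := sep pts (fun q => forall g, g ∈ H -> exists z, z ∈ ZZ /\ locv g (pr1 q) (pr2 q) z).
have in_I a x : opair a x ∈ I <-> (a ∈ lambda /\ x ∈ pow omega) /\
    forall g, g ∈ H -> exists z, z ∈ ZZ /\ locv g a x z.
{ rewrite /I in_sep; last by dd; apply: Dlocv; dd.
  by rewrite in_pts pr1_opair pr2_opair. }
have I_pts i : i ∈ I -> exists a x, a ∈ lambda /\ x ∈ pow omega /\ i = opair a x /\
    forall g, g ∈ H -> exists z, z ∈ ZZ /\ locv g a x z.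
{ move=> Hi; have : i ∈ pts by move: Hi; rewrite /I in_sep; [case|dd; apply: Dlocv; dd].
  move=> /in_prod [a [x [Ha [Hx E]]]]; exists a, x; do 3 split=> //.
  by rewrite E in Hi; case/in_I: Hi. }
have [ci Hci] : inj I lambda.
{ apply: (inj_trans _ pts); last by apply: inj_prod => //; apply: inj_subset.
  by apply: inj_subset => i /I_pts [a [x [Ha [Hx [-> _]]]]]; apply/in_pts. }
set ev := fun g i => the (fun z => z ∈ ZZ /\ locv g (pr1 i) (pr2 i) z).
have Dev : Dt (fun e => ev (e 0) (e 1)) by rewrite /ev; dd; apply: Dlocv; dd.
have ev_eq g a x z : g ∈ H -> a ∈ lambda -> x ∈ pow omega -> z ∈ ZZ -> locv g a x z ->
    ev g (opair a x) = z.
{ move=> Hg Ha Hx Hz K; apply: the_eq; rewrite pr1_opair pr2_opair //.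
  by move=> z' [_ K']; apply: (locv_uniq g a x) => //; apply: HS. }
have [cc Hcc] : inj (prod omega (pow omega)) lambda by apply: inj_prod => //; apply: inj_subset.
(* A Baire category argument: the conditions posed by the countably many elements of [H] are met one
   after another along shrinking cylinders. An embedding of the cylinder codes in [lambda] lets
   [pick] choose each next cylinder. *)
have generic a k0 s0 : a ∈ lambda -> k0 ∈ omega -> s0 ∈ pow omega ->
    exists x, x ∈ pow omega /\ agree k0 s0 x /\ opair a x ∈ I.
{ move=> Ha Hk0 Hs0.
  (* Step [n] treats the element that [phi] numbers [n]; if there is none, the cylinder may stay as
     it is. *)
  set good := fun n q q' => refines (pr1 q) (pr2 q) (pr1 q') (pr2 q') /\
    forall g, g ∈ H -> app phi g = n -> exists f z, f ∈ g /\ z ∈ ZZ /\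
      on_cyl (fun y => vl f a y = z) (pr1 q') (pr2 q').
  have Dgood (s1 s2 s3 : (nat -> M) -> M) : Dt s1 -> Dt s2 -> Dt s3 -> Dp (fun e => good (s1 e) (s2 e) (s3 e)).
    by move=> *; rewrite /good /on_cyl; dd.
  set next := fun n q => pick cc (prod omega (pow omega)) (good n q).
  have Dnext : Dt (fun e => next (e 0) (e 1)).
    by rewrite /next; apply: (Dt_pick _ _ (fun e => good (e 0) (e 1))); apply: Dgood; dd.
  have next_spec n q : q ∈ prod omega (pow omega) -> next n q ∈ prod omega (pow omega) /\ good n q (next n q).
  { move=> /in_prod [k [s [Hk [Hs ->]]]].
    apply: (pick_spec cc _ lambda (good n (opair k s))) => //; first by apply: Dgood; dd.
    case: (classic (exists g, g ∈ H /\ app phi g = n)) => [[g [Hg E]]|N].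
    - case/in_GG: (HS _ Hg) => f [Hf Eg].
      case: (S_dlc f Hf a Ha k s Hk Hs) => k' [s' [R [z [Hz Q]]]].
      exists (opair k' s'); rewrite in_prod_opair; split; first by case: R => ? [].
      split; rewrite !pr1_opair !pr2_opair // => g' Hg' E'.
      have -> : g' = g by case/is_inj_elim: Hphi => _; apply=> //; rewrite E.
      by exists f, z; split=> //; rewrite Eg; apply/in_cls.
    - exists (opair k s); rewrite in_prod_opair; split=> //.
      split; rewrite !pr1_opair !pr2_opair; first exact: refines_refl.
      by move=> g Hg E; case: N; exists g. }
  set st := fun n => nrec (opair k0 s0) next n.
  have Dst : Dt (fun e => st (e 0)) by rewrite /st; dd.
  have st_S n : n ∈ omega -> st (sc n) = next n (st n) by move=> Hn; rewrite /st nrec_S.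
  have st_in n : n ∈ omega -> st n ∈ prod omega (pow omega).
  { move: n; apply: omega_ind; first by dd.
    - by rewrite /st nrec_0 // in_prod_opair.
    - by move=> n Hn IH; rewrite st_S //; case: (next_spec n (st n) IH). }
  have st_pr n : n ∈ omega -> pr1 (st n) ∈ omega /\ pr2 (st n) ∈ pow omega.
    by move=> /st_in /in_prod [k [s [Hk [Hs ->]]]]; rewrite pr1_opair pr2_opair.
  have st_good n : n ∈ omega -> good n (st n) (st (sc n)).
    by move=> Hn; rewrite st_S //; case: (next_spec n (st n) (st_in n Hn)).
  have st_ref m : m ∈ omega -> forall n, n ∈ m ->
      refines (pr1 (st n)) (pr2 (st n)) (pr1 (st m)) (pr2 (st m)).
  { move: m; apply: omega_ind; first by dd.
    - by move=> n /in_emp.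
    - move=> m Hm IH n /in_sc [Hn|->]; last by case: (st_good m Hm).
      by apply: refines_trans (IH n Hn) _; case: (st_good m Hm). }
  (* A point common to all the cylinders: each stage contributes the part it has already fixed. The
     lengths need not tend to infinity, and what is never fixed is left out of [x0]. *)
  set x0 := sep omega (fun i => exists n, n ∈ omega /\ i ∈ pr1 (st n) /\ i ∈ pr2 (st n)).
  have in_x0 i : i ∈ x0 <-> i ∈ omega /\ exists n, n ∈ omega /\ i ∈ pr1 (st n) /\ i ∈ pr2 (st n).
    by apply: in_sep; dd.
  have Hx0 : x0 ∈ pow omega by apply/in_pow => i /in_x0 [].
  have x0_agree n : n ∈ omega -> agree (pr1 (st n)) (pr2 (st n)) x0.
  { move=> Hn i Hi; case: (st_pr n Hn) => Hk Hs; split=> [Ki|/in_x0 [Hi' [m [Hm [K1 K2]]]]].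
    - by apply/in_x0; split; [exact: omega_trans Hi|exists n].
    - case: (nat_total _ Hn _ Hm) => [L|[<- //|L]].
      + by case: (st_ref n Hn m L) => _ [_ [_ A]]; apply/(A i K1).
      + by case: (st_ref m Hm n L) => _ [_ [_ A]]; apply/(A i Hi). }
  exists x0; split=> //; split.
    have := x0_agree emp omega_emp; by rewrite /st nrec_0 // pr1_opair pr2_opair.
  apply/in_I; split=> // g Hg.
  have Hn : app phi g ∈ omega by case/is_inj_elim: Hphi => + _; apply.
  case: (st_good _ Hn) => _ /(_ g Hg eq_refl) [f [z [Hf [Hz Q]]]]; exists z; split=> //.
  have Hn' := omega_sc _ Hn; exists f; split=> //; exists (pr1 (st (sc (app phi g)))).
  split; first by case: (st_pr _ Hn').
  by move=> y Hy Ay; apply: Q => //; apply: agree_trans (x0_agree _ Hn') Ay. }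
have sub_op x y z : x ∈ H -> y ∈ H -> app2 pH x y z -> z ∈ H /\ z = gop x y.
{ move=> Hx Hy E; have /app2_pG [_ [_ K]] := Hp _ _ _ Hx Hy E; split=> //.
  case: HA => /is_binop_iff Hf _; move/app2_rel: E => /(rel_app _ _ _ _ _ Hf) [Hq ->].
  exact: app_in Hf Hq. }
apply: (free_criterion lambda H pH I ci phi ev OL oL HA Hci Hphi Dev).
- move=> g i Hg /I_pts [a [x [Ha [Hx [-> K]]]]]; case: (K g Hg) => z [Hz L].
  by rewrite (ev_eq g a x z).
- move=> x y z i Hx Hy /I_pts [a [t [Ha [Ht [-> K]]]]] /(sub_op _ _ _ Hx Hy) [Hz Ez].
  case: (K x Hx) => zx [Hzx Lx]; case: (K y Hy) => zy [Hzy Ly].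
  rewrite (ev_eq x a t zx) // (ev_eq y a t zy) //; apply: ev_eq => //.
  case: Lx => f [Hf [k [Hk Q]]]; case: Ly => g [Hg [k' [Hk' Q']]].
  case/in_GG: (HS _ Hx) => f0 [Hf0 Ex]; case/in_GG: (HS _ Hy) => g0 [Hg0 Ey].
  rewrite Ex in Hf; rewrite Ey in Hg; case/in_cls: Hf => Hf Ef; case/in_cls: Hg => Hg Eg.
  case: (nat_max _ _ Hk Hk') => n [Hn [S1 S2]].
  exists (fadd f g); split.
    rewrite Ez Ex Ey gop_cls //; apply/in_cls; split; [exact: S_fadd|exact: eqv_fadd].
  exists n; split=> // v Hv Av; rewrite vl_fadd // Q ?Q' //; exact: agree_sub Av.
(* Densely many cylinders make representatives of both [x] and [y] constant. Each contains a generic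
   point, where the two constants are compared, so equal coordinates force agreement on a dense open
   set. *)
- move=> x y Hx Hy E; apply: NNPP => N.
  case/in_GG: (HS _ Hx) => f [Hf Ex]; case/in_GG: (HS _ Hy) => g [Hg Ey].
  apply: N; rewrite Ex Ey; apply/cls_eq => // a Ha.
  have D := dense_and _ _ (loc_persistent f a) (S_dlc f Hf a Ha) (S_dlc g Hg a Ha).
  move=> k s Hk Hs; case: (D k s Hk Hs) => k' [s' [R [[z [Hz Q]] [z' [Hz' Q']]]]].
  exists k', s'; split=> //; case: (R) => Hk' [Hs' _].
  case: (generic a k' s' Ha Hk' Hs') => x0 [Hx0 [A0 I0]].
  have Zx : ev x (opair a x0) = z.
  { apply: ev_eq => //; exists f; split; first by rewrite Ex; apply/in_cls.
    by exists k'; split=> // v Hv Av; apply: Q => //; apply: agree_trans A0 Av. }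
  have Zy : ev y (opair a x0) = z'.
  { apply: ev_eq => //; exists g; split; first by rewrite Ey; apply/in_cls.
    by exists k'; split=> // v Hv Av; apply: Q' => //; apply: agree_trans A0 Av. }
  have Ezz : z = z' by rewrite -Zx -Zy; apply: E.
  by move=> v Hv Av; rewrite Q // Q'.
Qed.

End Quotient.

Theorem mainTheorem16 (M : set_structure)
    (hZF : ZF M) (hDC : DC M) (hAx4 : Ax4 M)
    (lambda mu : M)
    (hsucc : succ_cardinal lambda mu)
    (htrue : true_succ_cardinal lambda)
    (hpow : eq_pow_aleph0 mu) :
  exists G p : M,
    abelian_group G p /\
    aleph1_free G p /\
    equipotent G lambda /\
    trivial_dual G p.
Proof.
have HM : Model M := hZF.
have OL : ordinal lambda by case: hsucc => _ [[]].
have oL : subset omega lambda by apply: omega_sub_lambda hsucc.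
have IP A B : inj A lambda -> inj B lambda -> inj (prod A B) lambda
  by apply: inj_prod_lambda hsucc htrue hpow _ _.
have Ipow : inj (pow omega) lambda by apply: pow_omega_inj hsucc hpow.
have Iseq : inj (funs omega ZZ) lambda by apply: seq_ZZ_inj hsucc hpow.
case: (closure_exists lambda OL oL IP Ipow Iseq) => S [S1 [S2 [S3 S4]]].
exists (GG lambda S), (pG lambda S); split; last split; last split.
- exact: abelian_G.
- exact: aleph1_free_G.
- exact: card_G.
- exact: dual_G.
Qed.
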